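(* Let $K$ be an algebraically closed field of characteristic $p$ and let $f\in \langle x,y\rangle\subset K[[x,y]]$ be reduced. Assume that $p>\kappa(f)$. Then $f$ has no wild vanishing cycle, i.e. $\mathrm{Sw}(f)=0$. Moreover one has $$\kappa(f)= 2\delta(f)+\mathrm{mt}(f)-r(f)=\mu(f)+\mathrm{mt}(f)-1.$$
   Context: For $f,g\in K[[x,y]]$, $i(f,g):=\dim_K K[[x,y]]/\langle f,g\rangle\in\mathbb{N}\cup\{\infty\}$; $f_x,f_y$ are the partial derivatives. $f$ is reduced if it is nonzero and has no multiple irreducible factor. The kappa invariant is $\kappa(f):=i(f,\alpha f_x+\beta f_y)$ for generic $(\alpha:\beta)\in\mathbb{P}^1$. The Milnor number is $\mu(f):=i(f_x,f_y)$. The multiplicity $\mathrm{mt}(f)$ is the largest $k$ with $f\in\langle x,y\rangle^k$. For reduced $f$: $\delta(f):=\dim_K \bar R/R$, where $R=K[[x,y]]/\langle f\rangle$ and $\bar R$ is its normalization; $r(f)$ is the number of branches (irreducible factors) of $f$. Swan conductor: for $f$ with $\mu(f)<\infty$, regard $f$ as a morphism $\mathrm{Spec}\,K[[x,y]]\to \mathrm{Spec}\,K[[t]]$, $t\mapsto f$, and let $\Phi^1$ be the stalk at the closed point of the first vanishing cycle sheaf with coefficients in $\mathbb{Z}/\ell\mathbb{Z}$, $\ell\neq p$ prime; it is a representation of the absolute Galois group of $K((t))$, and $\mathrm{Sw}(f)$ is its Swan conductor (the ''number of wild vanishing cycles''). Deligne's theorem (SGA 7, Exp. XVI), a known result, gives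 $\mu(f)=2\delta(f)-r(f)+1+\mathrm{Sw}(f)$, so $\mathrm{Sw}(f)$ may equivalently be taken to be $\mu(f)-(2\delta(f)-r(f)+1)$. *)

(* Defs.v *)
From HB Require Import structures.
From mathcomp Require Import all_boot all_order all_algebra generic_quotient.
From mathcomp Require Import ring_quotient ring.
From mathcomp Require Import boolp classical_sets constructive_ereal.

Set Implicit Arguments.
Unset Strict Implicit.
Unset Printing Implicit Defensive.

Import Order.TTheory GRing.Theory Num.Theory.

Local Open Scope ring_scope.
Local Open Scope quotient_scope.

(* A record rather than a bare function type, so that the pointwise ring
   structure on functions cannot be picked up by unification. *)
Record fps (R : Type) := FPS { fps_coef :> nat -> R }.

HB.instance Definition _ (R : Type) := gen_eqMixin (fps R).
HB.instance Definition _ (R : Type) := gen_choiceMixin (fps R).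

Lemma fpsP (R : Type) (f g : fps R) : (forall n, f n = g n) -> f = g.
Proof. by case: f g => [f] [g] /= /funext ->. Qed.

Section FpsRing.
Variable R : comNzRingType.
Implicit Types f g h : fps R.

Definition fpsC (c : R) : fps R := FPS (fun n => if n == 0%N then c else 0).
Definition fps_add f g := FPS (fun n => f n + g n).
Definition fps_opp f := FPS (fun n => - f n).
Definition fps_mul f g := FPS (fun n => \sum_(i < n.+1) f i * g (n - i)%N).

Let addA : associative fps_add.
Proof. by move=> f g h; apply: fpsP => n /=; rewrite addrA. Qed.
Let addC : commutative fps_add.
Proof. by move=> f g; apply: fpsP => n /=; rewrite addrC. Qed.
Let add0 : left_id (fpsC 0) fps_add.
Proof. by move=> f; apply: fpsP => n /=; rewrite if_same add0r. Qed.
Let addN : left_inverse (fpsC 0) fps_opp fps_add.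
Proof. by move=> f; apply: fpsP => n /=; rewrite if_same addNr. Qed.

HB.instance Definition _ := GRing.isZmodule.Build (fps R) addA addC add0 addN.

Let trunc N f : {poly R} := \poly_(i < N) f i.

Let mul_trunc N f g i : (i < N)%N ->
  fps_mul f g i = (trunc N f * trunc N g)`_i.
Proof.
move=> iN; rewrite coefM /=; apply: eq_bigr => -[j /= ji] _.
by rewrite !coef_poly !ifT ?(leq_ltn_trans _ iN) ?leq_subr.
Qed.

Let mulA : associative fps_mul.
Proof.
move=> f g h; apply: fpsP => n.
have -> : fps_mul f (fps_mul g h) n =
    (trunc n.+1 f * (trunc n.+1 g * trunc n.+1 h))`_n.
  rewrite coefM; apply: eq_bigr => i _.
  by rewrite -(@mul_trunc n.+1) ?ltnS ?leq_subr // coef_poly ltn_ord.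
rewrite mulrA coefM; apply: eq_bigr => i _.
by rewrite -(@mul_trunc n.+1) // coef_poly ltnS leq_subr.
Qed.
Let mulC : commutative fps_mul.
Proof.
by move=> f g; apply: fpsP => n; rewrite !(@mul_trunc n.+1) // mulrC.
Qed.
Let mul1 : left_id (fpsC 1) fps_mul.
Proof.
move=> f; apply: fpsP => n /=.
rewrite big_ord_recl /= subn0 mul1r big1 ?addr0 // => i _.
by rewrite mul0r.
Qed.
Let mulDl : left_distributive fps_mul +%R.
Proof.
move=> f g h; apply: fpsP => n /=.
by rewrite -big_split; apply: eq_bigr => i _; rewrite mulrDl.
Qed.
Let one_neq0 : fpsC 1 != 0.
Proof.
by apply/eqP => /(congr1 (fun f : fps R => f 0%N)) /eqP /=; rewrite oner_eq0.
Qed.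

HB.instance Definition _ :=
  GRing.Zmodule_isComNzRing.Build (fps R) mulA mulC mul1 mulDl one_neq0.

Definition fps_unit : pred (fps R) := fun f => `[< exists g, g * f = 1 >].
Definition fps_inv f := if f \in fps_unit then xget 0 [set g | g * f = 1] else f.

Let mulV : {in fps_unit, left_inverse 1 fps_inv *%R}.
Proof.
move=> f fU; rewrite /fps_inv fU.
by case: xgetP => [g _ //|no]; have /asboolP[g /no] := fU.
Qed.
Let unitP f g : g * f = 1 -> fps_unit f.
Proof. by move=> gf; apply/asboolP; exists g. Qed.
Let inv_out : {in [predC fps_unit], fps_inv =1 id}.
Proof. by move=> f; rewrite /fps_inv inE /= => /negPf ->. Qed.

HB.instance Definition _ :=
  GRing.ComNzRing_hasMulInverse.Build (fps R) mulV unitP inv_out.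

Lemma fpsC_is_zmod_morphism : zmod_morphism fpsC.
Proof. by move=> a b; apply: fpsP => -[|n] //=; rewrite subr0. Qed.
Lemma fpsC_is_monoid_morphism : monoid_morphism fpsC.
Proof.
split=> // a b; apply: fpsP => n /=.
rewrite big_ord_recl /= subn0 big1 ?addr0 => [|i _]; last by rewrite mul0r.
by case: n => //=; rewrite mulr0.
Qed.
HB.instance Definition _ :=
  GRing.isZmodMorphism.Build R (fps R) fpsC fpsC_is_zmod_morphism.
HB.instance Definition _ :=
  GRing.isMonoidMorphism.Build R (fps R) fpsC fpsC_is_monoid_morphism.

Definition fpsX : fps R := FPS (fun n => (n == 1%N)%:R).

Definition fps_deriv f : fps R := FPS (fun n => f n.+1 *+ n.+1).

End FpsRing.

(* K[[x,y]] is encoded as K[[x]][[y]]: [f j i] is the coefficient of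
   x ^ i * y ^ j. *)
Section TwoVariables.
Variable K : comNzRingType.

Definition fps2C : K -> fps (fps K) := @fpsC (fps K) \o @fpsC K.
HB.instance Definition _ := GRing.RMorphism.on fps2C.

Definition varx : fps (fps K) := fpsC (fpsX K).
Definition vary : fps (fps K) := fpsX (fps K).

Definition derx (f : fps (fps K)) : fps (fps K) :=
  FPS (fun j => fps_deriv (f j)).
Definition dery (f : fps (fps K)) : fps (fps K) := fps_deriv f.

End TwoVariables.

Section Ideals.
Variable R : comNzRingType.

Definition ideal (S : set R) : set R :=
  [set a | exists n (c s : 'I_n -> R),
     (forall i, S (s i)) /\ a = \sum_i c i * s i].

Definition ideal_mul (I J : set R) : set R :=
  ideal [set c | exists a b, [/\ I a, J b & c = a * b]].

Definition ideal_exp (I : set R) (k : nat) : set R :=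
  iter k (ideal_mul I) setT.

Definition rdvd (a b : R) : Prop := exists c, b = c * a.

Lemma ideal1P (f a : R) : ideal [set f] a <-> rdvd f a.
Proof.
split=> [[n [c [s [sf ->]]]]|[c ->]].
  exists (\sum_i c i); rewrite mulr_suml; apply: eq_bigr => i _.
  by rewrite (sf i).
by exists 1%N, (fun=> c), (fun=> f); split=> //; rewrite big_ord1.
Qed.

End Ideals.

Section Irreducible.
Variable R : comUnitRingType.

Definition irreducible (a : R) : Prop :=
  [/\ a != 0, a \isn't a GRing.unit
    & forall b c, a = b * c -> b \is a GRing.unit \/ c \is a GRing.unit].

Definition associated (a b : R) : Prop :=
  exists2 u, u \is a GRing.unit & b = u * a.

Definition reduced (f : R) : Prop :=
  f != 0 /\ forall g, irreducible g -> ~ rdvd (g ^+ 2) f.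

End Irreducible.

(* R / <f>, for f not a unit. *)
Section PrincipalQuotient.
Variables (R : comUnitRingType) (f : R) (fNU : f \isn't a GRing.unit).

(* The proof is an argument because {ideal_quot _} wants a proper ideal. *)
Definition principal of f \isn't a GRing.unit : {pred R} :=
  fun a => `[< ideal [set f] a >].

Lemma principal_idealr_closed : idealr_closed (principal fNU).
Proof.
split.
- by apply/asboolP/ideal1P; exists 0; rewrite mul0r.
- apply/negP => /asboolP/ideal1P[c cf].
  by move/negP: fNU; apply; apply/unitrPr; exists c; rewrite mulrC.
- move=> a u v /asboolP/ideal1P[c ->] /asboolP/ideal1P[d ->].
  by apply/asboolP/ideal1P; exists (a * c + d); rewrite mulrDl mulrA.
Qed.

HB.instance Definition _ :=
  isIdealr.Build R (principal fNU) principal_idealr_closed.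

Definition principal_quot : comNzRingType := {ideal_quot (principal fNU)}.

Definition to_quot (a : R) : principal_quot := \pi_{ideal_quot (principal fNU)} a.

Lemma to_quot_is_zmod_morphism : zmod_morphism to_quot.
Proof. by move=> a b; rewrite /to_quot; exact: rmorphB. Qed.
Lemma to_quot_is_monoid_morphism : monoid_morphism to_quot.
Proof. by split=> [|a b]; rewrite /to_quot; [exact: rmorph1|exact: rmorphM]. Qed.
HB.instance Definition _ :=
  GRing.isZmodMorphism.Build R principal_quot to_quot to_quot_is_zmod_morphism.
HB.instance Definition _ :=
  GRing.isMonoidMorphism.Build R principal_quot to_quot to_quot_is_monoid_morphism.

End PrincipalQuotient.

(* Total ring of fractions: R localized at all its non-zero-divisors; the
   construction follows {fraction _}, which needs an integral domain. *)
Module TotalFrac.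
Section TotalFrac.
Variable R : comNzRingType.

Definition regular : pred R := fun b => `[< GRing.lreg b >].

Lemma regular1 : regular 1.
Proof. by apply/asboolP; exact: GRing.lreg1. Qed.
Lemma regularM a b : regular a -> regular b -> regular (a * b).
Proof. by move=> /asboolP ha /asboolP hb; apply/asboolP; exact: lregM. Qed.

Record ratio := Ratio { frac :> R * R; _ : regular frac.2 }.
HB.instance Definition _ := [isSub for frac].
HB.instance Definition _ := [Choice of ratio by <:].

Implicit Types x y z : ratio.

Lemma denP x : regular x.2. Proof. by case: x. Qed.
Lemma denI x (a b : R) : a * x.2 = b * x.2 -> a = b.
Proof. by move=> e; apply: (asboolW (denP x)); rewrite ![x.2 * _]mulrC. Qed.

Definition equiv x y := x.1 * y.2 == y.1 * x.2.

Lemma equiv_refl : reflexive equiv. Proof. by move=> x; exact: eqxx. Qed.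
Lemma equiv_sym : symmetric equiv. Proof. by move=> x y; exact: eq_sym. Qed.
Lemma equiv_trans : transitive equiv.
Proof.
move=> y x z /eqP xy /eqP yz; apply/eqP/(@denI y).
transitivity ((x.1 * y.2) * z.2); first by ring.
rewrite xy; transitivity ((y.1 * z.2) * x.2); first by ring.
by rewrite yz; ring.
Qed.
Canonical equiv_equiv := EquivRel equiv equiv_refl equiv_sym equiv_trans.

Definition type := {eq_quot equiv}.
HB.instance Definition _ : EqQuotient _ equiv type := EqQuotient.on type.
HB.instance Definition _ := Choice.on type.

Definition ratio_of (a : R) : ratio := @Ratio (a, 1) regular1.
Definition addf x y : ratio :=
  @Ratio (x.1 * y.2 + y.1 * x.2, x.2 * y.2) (regularM (denP x) (denP y)).
Definition oppf x : ratio := @Ratio (- x.1, x.2) (denP x).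
Definition mulf x y : ratio :=
  @Ratio (x.1 * y.1, x.2 * y.2) (regularM (denP x) (denP y)).

Lemma repr_equiv x :
  (repr (\pi_type x)).1 * x.2 = x.1 * (repr (\pi_type x)).2.
Proof.
have : repr (\pi_type x) == x %[mod type] by rewrite reprK.
by rewrite eqmodE => /eqP.
Qed.

Definition tofrac := lift_embed type ratio_of.
Canonical tofrac_pi_morph := PiEmbed tofrac.

Definition add := lift_op2 type addf.
Lemma pi_add : {morph \pi : x y / addf x y >-> add x y}.
Proof.
move=> x y; unlock add; apply/eqmodP/eqP => /=.
have := repr_equiv x; have := repr_equiv y.
set x' := repr (\pi_type x); set y' := repr (\pi_type y) => ey ex.
transitivity ((x.1 * x'.2) * y.2 * y'.2 + (y.1 * y'.2) * x.2 * x'.2); first by ring.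
by rewrite -ex -ey; ring.
Qed.
Canonical pi_add_morph := PiMorph2 pi_add.

Definition opp := lift_op1 type oppf.
Lemma pi_opp : {morph \pi : x / oppf x >-> opp x}.
Proof.
move=> x; unlock opp; apply/eqmodP/eqP => /=.
by rewrite !mulNr repr_equiv.
Qed.
Canonical pi_opp_morph := PiMorph1 pi_opp.

Definition mul := lift_op2 type mulf.
Lemma pi_mul : {morph \pi : x y / mulf x y >-> mul x y}.
Proof.
move=> x y; unlock mul; apply/eqmodP/eqP => /=.
by rewrite mulrACA -!repr_equiv mulrACA.
Qed.
Canonical pi_mul_morph := PiMorph2 pi_mul.

Lemma addA : associative add.
Proof.
by elim/quotW=> x; elim/quotW=> y; elim/quotW=> z; rewrite !piE;
  apply/eqmodP/eqP => /=; ring.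
Qed.
Lemma addC : commutative add.
Proof.
by elim/quotW=> x; elim/quotW=> y; rewrite !piE; apply/eqmodP/eqP => /=; ring.
Qed.
Lemma add0 : left_id (tofrac 0) add.
Proof. by elim/quotW=> x; rewrite !piE; apply/eqmodP/eqP => /=; ring. Qed.
Lemma addN : left_inverse (tofrac 0) opp add.
Proof. by elim/quotW=> x; rewrite !piE; apply/eqmodP/eqP => /=; ring. Qed.

HB.instance Definition _ := GRing.isZmodule.Build type addA addC add0 addN.

Lemma mulA : associative mul.
Proof.
by elim/quotW=> x; elim/quotW=> y; elim/quotW=> z; rewrite !piE;
  apply/eqmodP/eqP => /=; ring.
Qed.
Lemma mulC : commutative mul.
Proof.
by elim/quotW=> x; elim/quotW=> y; rewrite !piE; apply/eqmodP/eqP => /=; ring.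
Qed.
Lemma mul1 : left_id (tofrac 1) mul.
Proof. by elim/quotW=> x; rewrite !piE; apply/eqmodP/eqP => /=; ring. Qed.
Lemma mulDl : left_distributive mul add.
Proof.
by elim/quotW=> x; elim/quotW=> y; elim/quotW=> z; rewrite !piE;
  apply/eqmodP/eqP => /=; ring.
Qed.
Lemma one_neq0 : tofrac 1 != tofrac 0.
Proof. by rewrite !piE /equiv /= !mulr1 oner_eq0. Qed.

HB.instance Definition _ :=
  GRing.Zmodule_isComNzRing.Build type mulA mulC mul1 mulDl one_neq0.

Lemma tofrac_is_zmod_morphism : zmod_morphism tofrac.
Proof.
move=> a b; unlock tofrac; rewrite -[X in _ = _ + X]pi_opp -[RHS]pi_add.
by apply/eqmodP/eqP => /=; ring.
Qed.
Lemma tofrac_is_monoid_morphism : monoid_morphism tofrac.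
Proof.
split=> [//|a b]; unlock tofrac; rewrite -[RHS]pi_mul.
by apply/eqmodP/eqP => /=; ring.
Qed.
HB.instance Definition _ :=
  GRing.isZmodMorphism.Build R type tofrac tofrac_is_zmod_morphism.
HB.instance Definition _ :=
  GRing.isMonoidMorphism.Build R type tofrac tofrac_is_monoid_morphism.

End TotalFrac.
End TotalFrac.
HB.export TotalFrac.

Notation total_frac := TotalFrac.type.
Notation to_total_frac := (@TotalFrac.tofrac _).

(* The value in N + {oo} of an invariant given by its characteristic property;
   [\bar int] is used as codomain so that differences make sense. *)
Definition enat_of (P : nat -> Prop) : \bar int :=
  if pselect (exists n, P n) then ((xget 0%N [set n | P n])%:Z)%:E else +oo%E.

Section Dimension.
Variables (K : fieldType) (T : comNzRingType) (phi : {rmorphism K -> T}).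

(* b induces a K-basis of V / W, where T is a K-algebra through phi and
   W <= V are K-subspaces of T. *)
Definition basis_mod (V W : set T) n (b : 'I_n -> T) : Prop :=
  [/\ forall i, V (b i),
      forall v, V v -> exists c : 'I_n -> K, W (v - \sum_i phi (c i) * b i)
    & forall c : 'I_n -> K, W (\sum_i phi (c i) * b i) -> forall i, c i = 0].

Definition dim_mod (V W : set T) : \bar int :=
  enat_of (fun n => exists b : 'I_n -> T, basis_mod V W b).

End Dimension.

Section Invariants.
Variable K : fieldType.
Local Notation A := (fps (fps K)).
Implicit Types f g : A.

Definition maxideal : set A := ideal [set varx K; vary K].

Definition inter f g : \bar int :=
  dim_mod (@fps2C K) setT (ideal [set f; g]).

Definition milnor f : \bar int := inter (derx f) (dery f).

(* Generic means: outside finitely many points of P^1(K), a point (a : b) being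
   given by a nonzero pair of homogeneous coordinates. *)
Definition generic_value (F : K -> K -> \bar int) (v : \bar int) : Prop :=
  exists s : seq (K * K), (0, 0) \notin s /\
    forall a b, (a, b) != (0, 0) ->
      (forall q, q \in s -> a * q.2 != b * q.1) -> F a b = v.

Definition kappa f : \bar int :=
  xget +oo%E [set v | generic_value
    (fun a b => inter f (fps2C a * derx f + fps2C b * dery f)) v].

Definition mult f : \bar int :=
  enat_of (fun k => ideal_exp maxideal k f /\
    forall l, ideal_exp maxideal l f -> (l <= k)%N).

Definition branches f : \bar int :=
  enat_of (fun n => exists g : 'I_n -> A,
    [/\ forall i, irreducible (g i) /\ rdvd (g i) f,
        forall i j, associated (g i) (g j) -> i = j
      & forall h, irreducible h -> rdvd h f -> exists i, associated (g i) h]).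

Section Delta.
Variables (f : A) (fNU : f \isn't a GRing.unit).
Local Notation R := (principal_quot fNU).

Definition scalars : K -> total_frac R := to_total_frac \o @to_quot _ f fNU \o @fps2C K.
HB.instance Definition _ := GRing.RMorphism.on scalars.

(* Integral closure in the total ring of fractions, as R need not be a domain. *)
Definition normalization : set (total_frac R) :=
  [set z | integralOver (@TotalFrac.tofrac R) z].

Definition delta_nonunit : \bar int :=
  dim_mod scalars normalization (range (@TotalFrac.tofrac R)).

End Delta.

(* If f is a unit then K[[x,y]] / <f> is the zero ring. *)
Definition delta f : \bar int :=
  if pselect (f \isn't a GRing.unit) is left fNU then delta_nonunit fNU else 0%E.

(* The Swan conductor of the vanishing cycles of f, taken in the form given by
   Deligne's formula mu = 2 delta - r + 1 + Sw (SGA 7, Exp. XVI). *)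
Definition swan f : \bar int :=
  (milnor f - (2%:E * delta f - branches f + 1))%E.

End Invariants.

(* Main.v *)
(* Write O = K[[x]]. After a linear change of coordinates x -> x + c y with c generic,
   f has order m = mt(f) in y and kappa(f) = i(f, f_y). Setting x = 0 bounds
   i(f, f_y) below by m - 1, and by m if p divides m, so m < p and every factor of f
   is tame over O: by Newton-Puiseux each branch is parametrized by x = t^d,
   y = phi(t), with d prime to p and the d conjugates phi(zeta t) distinct.

   For one branch, compare the lattice R = O[phi] in K[[t]] with K[[t]] itself: the
   Vandermonde matrix of the conjugates of phi is the matrix of R times the
   Vandermonde matrix of the conjugates of t, and the orders of the determinants give
   i(G, G_y) = 2 delta + d - 1. As delta(G Q) = delta(G) + delta(Q) + i(G, Q) and
   i(G Q, h) = i(G, h) + i(Q, h), summing over the branches yields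
   kappa = 2 delta + m - r.

   For the Milnor number, f_y has order m - 1 < p in y, so its branches are tame too.
   On such a branch d/dt f(x(t), y(t)) = f_x x'(t), and ord f(x(t), y(t)) <= kappa < p,
   whence ord f_x = ord f - d; summing gives mu = kappa - (m - 1). *)

Require Import Defs.
From HB Require Import structures.
From mathcomp Require Import all_boot all_order all_algebra all_field cyclic.
From mathcomp Require Import generic_quotient ring_quotient zify ring.
From mathcomp Require Import boolp classical_sets constructive_ereal.

Set Implicit Arguments.
Unset Strict Implicit.
Unset Printing Implicit Defensive.

Import Order.TTheory GRing.Theory Num.Theory.
Local Open Scope ring_scope.

Arguments fps_coef : simpl never.

(** * Power series *)

(** The bound [kappa f < p] acts three times: it forces m < p, it makes the polar curve, of order m
    - 1 in y, tame as well, and it keeps every order of f along a polar branch below p, so that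
    differentiation never kills a leading coefficient. Factorization comes from the branches
    themselves: each one is the kernel of a homomorphism to K[[t]], hence prime, and Weierstrass
    division makes this kernel principal; dividing its generator out lowers the order in y. The
    obstacle for delta is the integral closure in the total ring of fractions. [model] replaces it
    by any integrally closed ring U receiving A with kernel (f), integrally and with finite
    codimension. Such rings are built as products of copies of K[[t]], and only
    [delta_nonunit_model] compares U with the actual normalization. The two formulas for kappa
    together give mu = 2 delta - r + 1, which is the vanishing of Sw. *)

Section FpsCoef.
Variable R : comNzRingType.
Implicit Types f g : fps R.

Lemma fpsE (F : nat -> R) n : FPS F n = F n. Proof. by []. Qed.
Lemma fps0E n : (0 : fps R) n = 0. Proof. by case: n. Qed.
Lemma fps1E n : (1 : fps R) n = (n == 0%N)%:R. Proof. by case: n. Qed.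
Lemma fpsXE n : fpsX R n = (n == 1%N)%:R. Proof. by []. Qed.
Lemma fpsDE f g n : (f + g) n = f n + g n. Proof. by []. Qed.
Lemma fpsNE f n : (- f) n = - f n. Proof. by []. Qed.
Lemma fpsBE f g n : (f - g) n = f n - g n. Proof. by []. Qed.
Lemma fpsME f g n : (f * g) n = \sum_(i < n.+1) f i * g (n - i)%N.
Proof. by []. Qed.
Lemma fpsCE c n : fpsC c n = c *+ (n == 0%N) :> R. Proof. by case: n. Qed.
Lemma fps_sumE I (r : seq I) (P : pred I) (F : I -> fps R) n :
  (\sum_(i <- r | P i) F i) n = \sum_(i <- r | P i) F i n.
Proof.
elim/big_rec2: _ => [|i a b _ <-]; last by rewrite fpsDE.
exact: fps0E.
Qed.
Lemma fpsCM c f n : (fpsC c * f) n = c * f n.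
Proof.
rewrite fpsME big_ord_recl subn0 fpsCE eqxx big1 ?addr0 // => i _.
by rewrite fpsCE mulr0n mul0r.
Qed.
Lemma fpsM0 f g : (f * g) 0%N = f 0%N * g 0%N.
Proof. by rewrite fpsME big_ord1. Qed.
Lemma fpsXM0 f : (fpsX R * f) 0%N = 0.
Proof. by rewrite fpsM0 /= mul0r. Qed.
Lemma fpsXMS f n : (fpsX R * f) n.+1 = f n.
Proof.
rewrite fpsME 2!big_ord_recl /= mul0r add0r mul1r /bump /= subSS subn0.
by rewrite big1 ?addr0 // => i _; rewrite mul0r.
Qed.
Lemma fpsXnM k f n : (fpsX R ^+ k * f) n = if (n < k)%N then 0 else f (n - k)%N.
Proof.
elim: k f n => [|k IH] f n; first by rewrite expr0 mul1r subn0.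
rewrite exprS -mulrA; case: n => [|n]; first by rewrite fpsXM0.
by rewrite fpsXMS IH ltnS subSS.
Qed.
Lemma fpsXnE k n : (fpsX R ^+ k) n = (n == k)%:R.
Proof.
rewrite -[_ ^+ _]mulr1 fpsXnM fps1E; case: ltngtP => //.
- by move=> kn; rewrite subn_eq0 leqNgt kn.
- by move=> ->; rewrite subnn.
Qed.

Definition fps_drop k f : fps R := FPS (fun n => f (k + n)%N).
Definition fps_take k f : fps R := FPS (fun n => if (n < k)%N then f n else 0).

Lemma fps_dropE k f n : fps_drop k f n = f (k + n)%N. Proof. by []. Qed.
Lemma fps_take_drop k f : f = fps_take k f + fpsX R ^+ k * fps_drop k f.
Proof.
apply: fpsP => n; rewrite fpsDE fpsXnM fpsE; case: ltnP => kn.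
  by rewrite addr0.
by rewrite add0r fpsE subnKC.
Qed.
Lemma fps_dropXn k f : fps_drop k (fpsX R ^+ k * f) = f.
Proof. by apply: fpsP => n; rewrite fps_dropE fpsXnM ltnNge leq_addr /= addKn. Qed.
Lemma fps_drop0 k f : (forall n, (n < k)%N -> f n = 0) ->
  f = fpsX R ^+ k * fps_drop k f.
Proof.
move=> f0; apply: fpsP => n; rewrite fpsXnM; case: ltnP => kn; first exact: f0.
rewrite fps_dropE.
by rewrite subnKC.
Qed.
Lemma fps_drop_add k f g : fps_drop k (f + g) = fps_drop k f + fps_drop k g.
Proof. exact: fpsP. Qed.
Lemma fps_dropB k f g : fps_drop k (f - g) = fps_drop k f - fps_drop k g.
Proof. exact: fpsP. Qed.
Lemma fps_takeE k f : fps_take k f = \sum_(i < k) fpsC (f i) * fpsX R ^+ i.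
Proof.
apply: fpsP => n; rewrite fps_sumE fpsE; case: ltnP => nk.
  rewrite (bigD1 (Ordinal nk)) //= fpsCM fpsXnE eqxx mulr1 big1 ?addr0 // => i.
  by rewrite fpsCM fpsXnE -val_eqE /= eq_sym => /negPf ->; rewrite mulr0.
rewrite big1 // => i _; rewrite fpsCM fpsXnE gtn_eqF ?mulr0 //.
exact: leq_trans (ltn_ord i) nk.
Qed.

Lemma fps_derivD f g : fps_deriv (f + g) = fps_deriv f + fps_deriv g.
Proof. by apply: fpsP => n; rewrite fpsDE !fpsE -mulrnDl. Qed.
Lemma fps_derivM f g : fps_deriv (f * g) = fps_deriv f * g + f * fps_deriv g.
Proof.
apply: fpsP => n; rewrite fpsDE [LHS]fpsE.
pose G (i : nat) := f i * g (n.+1 - i)%N.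
have -> : (f * g) n.+1 *+ n.+1 = \sum_(i < n.+2) (G i *+ i + G i *+ (n.+1 - i)).
  rewrite fpsME -sumrMnl; apply: eq_bigr => i _.
  by rewrite -mulrnDr subnKC // -ltnS.
rewrite big_split /=; congr (_ + _).
  rewrite big_ord_recl mulr0n add0r; apply: eq_bigr => i _.
  by rewrite /G /bump /= subSS fpsE mulrnAl.
rewrite big_ord_recr /= subnn mulr0n addr0; apply: eq_bigr => i _.
have le_in : (i <= n)%N by rewrite -ltnS.
by rewrite /G fpsE subSn // mulrnAr.
Qed.
Lemma fps_derivC c : fps_deriv (fpsC c) = 0 :> fps R.
Proof. by apply: fpsP => n; rewrite fps0E fpsE fpsCE mulr0n mul0rn. Qed.
Lemma fps_derivX : fps_deriv (fpsX R) = 1.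
Proof. by apply: fpsP => -[|n]; rewrite fps1E !fpsE //= mul0rn. Qed.

End FpsCoef.

Section FpsOrd.
Variable R : idomainType.
Implicit Types f g : fps R.

Lemma fps_neq0P f : f != 0 -> exists n, f n != 0.
Proof.
move=> f0; apply/not_existsP => h; case/eqP: f0; apply: fpsP => n.
by rewrite fps0E; apply/eqP/negPn/negP => /h.
Qed.

(* The junk value at the zero series is 0. *)
Definition ord f : nat :=
  if pselect (exists n, f n != 0) is left h then ex_minn h else 0%N.

Lemma ordP f : f != 0 -> f (ord f) != 0 /\ forall n, (n < ord f)%N -> f n = 0.
Proof.
move=> /fps_neq0P f0; rewrite /ord; case: pselect => // h.
case: ex_minnP => m fm mmin; split=> // n nm; apply/eqP/negPn/negP => /mmin.
by rewrite leqNgt nm.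
Qed.
Lemma ord_eq f n : f n != 0 -> (forall i, (i < n)%N -> f i = 0) -> ord f = n.
Proof.
move=> fn fl; have f0 : f != 0 by apply: contraNneq fn => ->; rewrite fps0E.
have [fo fol] := ordP f0; case: (ltngtP (ord f) n) => // [/fl|/fol] e.
  by rewrite e eqxx in fo.
by rewrite e eqxx in fn.
Qed.
Lemma fps_idomain : GRing.integral_domain_axiom (fps R).
Proof.
move=> f g fg; apply/orP; case: (eqVneq f 0) => [|f0]; first by left.
case: (eqVneq g 0) => [|g0]; first by right.
have [fo fl] := ordP f0; have [go gl] := ordP g0.
have := congr1 (fun h : fps R => h (ord f + ord g)%N) fg; rewrite fpsME fps0E.
have lt : (ord f < (ord f + ord g).+1)%N by rewrite ltnS leq_addr.
rewrite (bigD1 (Ordinal lt)) //= addKn big1 ?addr0 => [/eqP|i].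
  by rewrite mulf_eq0 (negPf fo) (negPf go).
rewrite -val_eqE /= neq_ltn => /orP[/fl->|ltoi]; first by rewrite mul0r.
by rewrite gl ?mulr0 // ltn_subLR ?ltn_add2r // -ltnS.
Qed.
HB.instance Definition _ :=
  GRing.ComUnitRing_isIntegral.Build (fps R) fps_idomain.

Lemma ordM f g : f != 0 -> g != 0 -> ord (f * g) = (ord f + ord g)%N.
Proof.
move=> f0 g0; have [fo fl] := ordP f0; have [go gl] := ordP g0.
have lt : (ord f < (ord f + ord g).+1)%N by rewrite ltnS leq_addr.
apply: ord_eq => [|n ltn]; rewrite fpsME.
  rewrite (bigD1 (Ordinal lt)) //= addKn big1 ?addr0 ?mulf_neq0 // => i.
  rewrite -val_eqE /= neq_ltn => /orP[/fl->|ltoi]; first by rewrite mul0r.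
  by rewrite gl ?mulr0 // ltn_subLR ?ltn_add2r // -ltnS.
rewrite big1 // => i _; case: (ltnP i (ord f)) => [/fl->|leoi].
  by rewrite mul0r.
by rewrite gl ?mulr0 //; have := ltn_ord i; lia.
Qed.
Lemma ord_fps1 : ord (1 : fps R) = 0%N.
Proof. by apply: ord_eq => //; rewrite fps1E oner_eq0. Qed.
Lemma ordXn n : ord (fpsX R ^+ n) = n.
Proof.
apply: ord_eq => [|i lt]; rewrite fpsXnE ?eqxx ?oner_eq0 //.
by rewrite ltn_eqF.
Qed.
Lemma fpsX_neq0 : fpsX R != 0.
Proof.
by apply/eqP => /(congr1 (fun h : fps R => h 1%N)) /eqP; rewrite fps0E /= oner_eq0.
Qed.
Lemma ord_prod I (r : seq I) (P : pred I) (F : I -> fps R) :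
  (forall i, P i -> F i != 0) ->
  ord (\prod_(i <- r | P i) F i) = (\sum_(i <- r | P i) ord (F i))%N.
Proof.
move=> F0.
have [] : ord (\prod_(i <- r | P i) F i) = (\sum_(i <- r | P i) ord (F i))%N /\
  \prod_(i <- r | P i) F i != 0; last by [].
elim/big_rec2: _ => [|i n f Pi [<- f0]]; first by rewrite ord_fps1 oner_neq0.
by rewrite ordM ?mulf_neq0 ?F0.
Qed.
Lemma ord_fpsC c : ord (fpsC c : fps R) = 0%N.
Proof.
case: (eqVneq c 0) => [->|c0]; last exact: ord_eq.
rewrite /ord; case: pselect => // -[n] hn; exfalso.
by move: hn; rewrite fpsCE mul0rn eqxx.
Qed.
Lemma ordN f : ord (- f) = ord f.
Proof.
case: (eqVneq f 0) => [->|f0]; first by rewrite oppr0.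
have [fo fl] := ordP f0; apply: ord_eq => [|i /fl fi]; rewrite fpsNE ?oppr_eq0 //.
by rewrite fi oppr0.
Qed.

End FpsOrd.

(** * Complete filtrations and substitution *)

(** A complete separated filtration, with completeness stated for series: [fil_sum] sums any
    sequence whose n-th term lies in the n-th step. This is the form in which substitution into
    power series uses it. *)
Record filtration (S : comNzRingType) := Filtration {
  fil :> nat -> S -> Prop;
  fil_full : forall a, fil 0 a;
  fil_zero : forall n, fil n 0;
  filB : forall n a b, fil n a -> fil n b -> fil n (a - b);
  filM : forall m n a b, fil m a -> fil n b -> fil (m + n) (a * b);
  fil_le : forall m n a, (m <= n)%N -> fil n a -> fil m a;
  fil_sep : forall a, (forall n, fil n a) -> a = 0;
  fil_sum : forall u : nat -> S, (forall n, fil n (u n)) ->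
    exists s, forall n, fil n (s - \sum_(k < n) u k) }.

Section FiltrationTheory.
Variables (S : comNzRingType) (Phi : filtration S).

Lemma filN n a : Phi n a -> Phi n (- a).
Proof. by move=> ha; rewrite -sub0r; apply: filB => //; exact: fil_zero. Qed.
Lemma filD n a b : Phi n a -> Phi n b -> Phi n (a + b).
Proof. by move=> ha hb; rewrite -[b]opprK; apply: filB => //; exact: filN. Qed.
Lemma filMl n a b : Phi n b -> Phi n (a * b).
Proof. by rewrite -{2}[n]add0n; apply: filM; exact: fil_full. Qed.
Lemma filMr n a b : Phi n a -> Phi n (a * b).
Proof. by rewrite mulrC; exact: filMl. Qed.
Lemma fil_bigsum n I (r : seq I) (P : pred I) F :
  (forall i, P i -> Phi n (F i)) -> Phi n (\sum_(i <- r | P i) F i).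
Proof. by move=> h; elim/big_ind: _ => //; [exact: fil_zero|exact: filD]. Qed.
Lemma filX n a k : Phi n a -> Phi (k * n)%N (a ^+ k).
Proof.
move=> ha; elim: k => [|k IH]; first exact: fil_full.
by rewrite exprS mulSn; exact: filM.
Qed.

End FiltrationTheory.

Section TrivialFiltration.
Variable S : comNzRingType.

(** The discrete filtration, from which the X-adic and (x, y)-adic ones are obtained by iterating
    [fps_filtration]. *)
Definition triv_fil n (a : S) : Prop := n = 0%N \/ a = 0.

Lemma triv_filM m n a b :
  triv_fil m a -> triv_fil n b -> triv_fil (m + n) (a * b).
Proof.
move=> [-> [->|->]|-> _]; first by left.
  by right; rewrite mulr0.
by right; rewrite mul0r.
Qed.
Lemma triv_filB n a b : triv_fil n a -> triv_fil n b -> triv_fil n (a - b).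
Proof. by move=> [->|->]; [left|move=> [->|->]; [left|right; rewrite subrr]]. Qed.
Lemma triv_fil_le m n a : (m <= n)%N -> triv_fil n a -> triv_fil m a.
Proof. by move=> mn [n0|->]; [left; lia|right]. Qed.
Lemma triv_fil_sep a : (forall n, triv_fil n a) -> a = 0.
Proof. by move=> /(_ 1%N) []. Qed.
Lemma triv_fil_sum (u : nat -> S) : (forall n, triv_fil n (u n)) ->
  exists s, forall n, triv_fil n (s - \sum_(k < n) u k).
Proof.
move=> hu; exists (u 0%N) => -[|n]; first by left.
right; rewrite big_ord_recl big1 ?addr0 ?subrr // => i _.
by case: (hu (lift ord0 i)).
Qed.

Definition trivial_filtration : filtration S :=
  Filtration (fun a => or_introl erefl) (fun n => or_intror erefl)
    triv_filB triv_filM triv_fil_le triv_fil_sep triv_fil_sum.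

End TrivialFiltration.

Section FpsFiltration.
Variables (S : comNzRingType) (Phi : filtration S).

(** Total weight: X counts for 1 and coefficients keep their own weight. The truncated subtraction
    leaves coefficients of index at least n free. *)
Definition fps_fil n (f : fps S) : Prop := forall j, Phi (n - j)%N (f j).

Lemma fps_fil_full f : fps_fil 0 f.
Proof. by move=> j; rewrite sub0n; exact: fil_full. Qed.
Lemma fps_fil_zero n : fps_fil n 0.
Proof. by move=> j; rewrite fps0E; exact: fil_zero. Qed.
Lemma fps_filB n f g : fps_fil n f -> fps_fil n g -> fps_fil n (f - g).
Proof. by move=> hf hg j; rewrite fpsBE; apply: filB. Qed.
Lemma fps_filM m n f g : fps_fil m f -> fps_fil n g -> fps_fil (m + n) (f * g).
Proof.
move=> hf hg j; rewrite fpsME; apply: fil_bigsum => i _.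
apply: (@fil_le _ _ _ ((m - i) + (n - (j - i)))%N); last exact: filM.
by have := ltn_ord i; lia.
Qed.
Lemma fps_fil_le m n f : (m <= n)%N -> fps_fil n f -> fps_fil m f.
Proof. by move=> mn hf j; apply: fil_le (hf j); lia. Qed.
Lemma fps_fil_sep f : (forall n, fps_fil n f) -> f = 0.
Proof.
move=> hf; apply: fpsP => j; rewrite fps0E; apply: (@fil_sep _ Phi) => n.
by rewrite -(addnK j n); exact: hf.
Qed.
Lemma fps_fil_sum (u : nat -> fps S) : (forall n, fps_fil n (u n)) ->
  exists s, forall n, fps_fil n (s - \sum_(k < n) u k).
Proof.
move=> hu.
(* At a fixed coefficient j the terms [u k j] with k < j are unrestricted, and those with k >= j
   form a summable sequence for [Phi]. *)
have /choice [s hs] j : exists s, forall n, Phi n (s - \sum_(l < n) u (j + l)%N j).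
  apply: (@fil_sum _ Phi (fun l => u (j + l)%N j)) => n.
  by rewrite -{1}(addKn j n); exact: hu.
exists (FPS (fun j => \sum_(k < j) u k j + s j)) => n j.
rewrite fpsBE fpsE fps_sumE; case: (leqP n j) => nj.
  by have -> : (n - j = 0)%N by [lia]; exact: fil_full.
have -> : \sum_(k < n) u k j = \sum_(k < j) u k j + \sum_(l < n - j) u (j + l)%N j.
  have [m ->] : exists m, n = (j + m)%N by exists (n - j)%N; lia.
  by rewrite addKn big_split_ord.
by rewrite opprD addrACA subrr add0r; exact: hs.
Qed.

Definition fps_filtration : filtration (fps S) :=
  Filtration fps_fil_full fps_fil_zero fps_filB fps_filM fps_fil_le
    fps_fil_sep fps_fil_sum.

End FpsFiltration.

(** * Substitution homomorphisms and their uniqueness *)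

Section Eval.
Variables (R S : comNzRingType) (Phi : filtration S).

(** The value at f is the sum of the series. Separation determines it from its partial sums, so the
    ring laws reduce to congruences between truncations. *)
Lemma fps_evalP (iota : {rmorphism R -> S}) (a : S) : Phi 1%N a ->
  exists E : {rmorphism fps R -> S},
    [/\ forall c, E (fpsC c) = iota c, E (fpsX R) = a
      & forall f n, Phi n (E f - \sum_(k < n) iota (f k) * a ^+ k)].
Proof.
move=> ha.
have hX k : Phi k (a ^+ k) by have := filX k ha; rewrite muln1.
have /choice [E hE] (f : fps R) : exists s, forall n,
    Phi n (s - \sum_(k < n) iota (f k) * a ^+ k).
  by apply: (@fil_sum _ Phi (fun k => iota (f k) * a ^+ k)) => n; exact: filMl.
have uniqE (f : fps R) s : (forall n, Phi n (s - \sum_(k < n) iota (f k) * a ^+ k)) -> E f = s.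
  move=> hs; apply/esym/eqP; rewrite -subr_eq0; apply/eqP/(@fil_sep _ Phi) => n.
  by have := filB (hs n) (hE f n); rewrite opprB addrA subrK.
have EB : zmod_morphism E.
  move=> f g; apply: uniqE => n.
  have -> : \sum_(k < n) iota ((f - g) k) * a ^+ k =
    \sum_(k < n) iota (f k) * a ^+ k - \sum_(k < n) iota (g k) * a ^+ k.
    by rewrite -sumrB; apply: eq_bigr => k _; rewrite fpsBE rmorphB mulrBl.
  rewrite (_ : _ - _ = (E f - \sum_(k < n) iota (f k) * a ^+ k) -
    (E g - \sum_(k < n) iota (g k) * a ^+ k)); first exact: filB.
  by ring.
have EM : monoid_morphism E.
  split=> [|f g]; apply: uniqE => n.
    case: n => [|n]; first exact: fil_full.
    rewrite big_ord_recl fps1E rmorph1 mul1r expr0 big1 ?addr0 ?subrr.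
      exact: fil_zero.
    by move=> i _; rewrite fps1E rmorph0 mul0r.
  (* Truncations are polynomials, and [pt f * pt g] agrees with [pt (f * g)] below degree n; the
     remaining terms carry [a ^+ i] with i >= n. *)
  pose pt (h : fps R) := \poly_(k < n) iota (h k).
  have ptE h : (pt h).[a] = \sum_(k < n) iota (h k) * a ^+ k.
    exact: horner_poly.
  rewrite -ptE.
  have -> : E f * E g - (pt (f * g)).[a] =
      (E f - (pt f).[a]) * E g + (pt f).[a] * (E g - (pt g).[a])
      + (pt f * pt g - pt (f * g)).[a].
    by rewrite hornerD hornerN hornerM; ring.
  apply: filD; first apply: filD.
  - by apply: filMr; rewrite ptE.
  - by apply: filMl; rewrite ptE.
  rewrite horner_coef; apply: fil_bigsum => i _.
  case: (ltnP i n) => ni; last by apply: filMl; apply: fil_le (hX _).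
  rewrite coefB coefM coef_poly ni fpsME rmorph_sum.
  suff -> : \sum_(j < i.+1) (pt f)`_j * (pt g)`_(i - j) =
     \sum_(j < i.+1) iota (f j * g (i - j)%N).
    by rewrite subrr mul0r; exact: fil_zero.
  apply: eq_bigr => j _; have := ltn_ord j => ltj.
  by rewrite !coef_poly rmorphM !ifT //; lia.
pose m1 := GRing.isZmodMorphism.Build _ _ E EB.
pose m2 := GRing.isMonoidMorphism.Build _ _ E EM.
pose E' : {rmorphism fps R -> S} := HB.pack E m1 m2.
exists E'; split=> [c||//].
  apply: uniqE => -[|n]; first exact: fil_full.
  rewrite big_ord_recl fpsCE eqxx expr0 mulr1 big1 ?addr0 ?subrr.
    exact: fil_zero.
  by move=> i _; rewrite fpsCE rmorph0 mul0r.
apply: uniqE => -[|[|n]]; first exact: fil_full.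
  by rewrite big_ord1 fpsXE rmorph0 mul0r subr0.
rewrite 2!big_ord_recl !fpsXE /= rmorph0 mul0r add0r rmorph1 mul1r expr1.
rewrite big1 ?addr0 ?subrr; first exact: fil_zero.
by move=> i _; rewrite mul0r.
Qed.

Lemma fps_split0 (f : fps R) : f = fpsC (f 0%N) + fpsX R * fps_drop 1 f.
Proof.
apply: fpsP => -[|n]; rewrite fpsDE fpsCE; first by rewrite fpsXM0 addr0.
by rewrite fpsXMS fpsE add0r.
Qed.

(** Continuity is automatic: writing f = f(0) + X g, the difference of the two values at f is e(X)
    times the difference at g, so by iteration it lies in every step of the filtration. *)
Lemma fps_hom_ext (e e' : {rmorphism fps R -> S}) :
  Phi 1%N (e (fpsX R)) -> (forall c, e (fpsC c) = e' (fpsC c)) ->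
  e (fpsX R) = e' (fpsX R) -> e =1 e'.
Proof.
move=> hX hC eX f; apply/eqP; rewrite -subr_eq0; apply/eqP/(@fil_sep _ Phi) => n.
elim: n f => [|n IH] f; first exact: fil_full.
rewrite (fps_split0 f) !rmorphD !rmorphM hC -eX.
rewrite opprD addrACA subrr add0r -mulrBr -add1n; apply: filM => //; exact: IH.
Qed.

(** Same mechanism: D f = e(X) D g when f = f(0) + X g. Identities such as the chain rule are then
    checked on constants and variables only. *)
Lemma fps_derivation0 (e : {rmorphism fps R -> S}) (D : fps R -> S) :
  Phi 1%N (e (fpsX R)) -> (forall f g, D (f + g) = D f + D g) ->
  (forall f g, D (f * g) = D f * e g + e f * D g) ->
  (forall c, D (fpsC c) = 0) -> D (fpsX R) = 0 -> forall f, D f = 0.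
Proof.
move=> hX DD DM DC DX f; apply: (@fil_sep _ Phi) => n.
elim: n f => [|n IH] f; first exact: fil_full.
rewrite (fps_split0 f) DD DM DC DX mul0r !add0r -add1n; apply: filM => //.
Qed.

Lemma fil_hom (Psi : filtration R) (e : {rmorphism fps R -> S}) :
  Phi 1%N (e (fpsX R)) -> (forall n c, Psi n c -> Phi n (e (fpsC c))) ->
  forall n f, fps_filtration Psi n f -> Phi n (e f).
Proof.
move=> hX hC n; elim: n => [|n IH] f hf; first exact: fil_full.
rewrite (fps_split0 f) rmorphD rmorphM; apply: filD.
  by apply: hC; have := hf 0%N.
rewrite -add1n; apply: filM => //; apply: IH => j.
by rewrite fpsE -subSS; exact: hf.
Qed.

End Eval.

Lemma fps_unitE (R : comUnitRingType) (f : fps R) :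
  (f \is a GRing.unit) = (f 0%N \is a GRing.unit).
Proof.
apply/idP/idP => [/unitrPr [g fg]|f0].
  by apply/unitrPr; exists (g 0%N); rewrite -fpsM0 fg fps1E.
(* Geometric series: the inverse of f / f(0) is the value of 1 + X + X^2 + ... at h = 1 - f / f(0),
   which has no constant term. *)
pose h : fps R := 1 - fpsC (f 0%N)^-1 * f.
have h1 : fps_filtration (trivial_filtration R) 1%N h.
  move=> [|j]; last by rewrite subSS sub0n; exact: fil_full.
  by right; rewrite fpsBE fpsCM mulVr // fps1E subrr.
have [E [_ EX _]] := fps_evalP (@fpsC R : {rmorphism R -> fps R}) h1.
have : E ((1 - fpsX R) * FPS (fun=> 1)) = 1.
  rewrite -[RHS](rmorph1 E); congr (E _); apply: fpsP => -[|n].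
    by rewrite fpsM0 fpsBE fpsXE !fps1E subr0 mul1r fpsE.
  by rewrite mulrBl mul1r fpsBE fpsXMS fps1E !fpsE subrr.
rewrite rmorphM rmorphB rmorph1 EX /h subKr => e.
apply/unitrPr; exists (fpsC (f 0%N)^-1 * E (FPS (fun=> 1))).
by rewrite mulrA [f * _]mulrC.
Qed.

Section Filtration1.
Variable K : fieldType.

Definition xfil1 : filtration (fps K) := fps_filtration (trivial_filtration K).
Definition xyfil : filtration (fps (fps K)) := fps_filtration xfil1.

Lemma xfil1P n (f : fps K) : xfil1 n f <-> forall i, (i < n)%N -> f i = 0.
Proof.
split=> [hf i ni|hf j]; first by case: (hf i) => //; lia.
by case: (ltnP j n) => [/hf|]; [right|left; lia].
Qed.
Lemma xyfilP n (f : fps (fps K)) :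
  xyfil n f <-> forall j i, (j + i < n)%N -> f j i = 0.
Proof.
split=> [hf j i ni|hf j].
  by have /xfil1P := hf j; apply; lia.
by apply/xfil1P => i ni; apply: hf; lia.
Qed.
Lemma xfil1_1 (f : fps K) : f 0%N = 0 -> xfil1 1%N f.
Proof. by move=> f0; apply/xfil1P => -[]. Qed.
End Filtration1.

(** * Dimensions of subquotients *)

Section Dim.
Variables (K : fieldType) (T : lmodType K).
Implicit Types (U V W : set T) (u v w : T).

Definition submod W : Prop :=
  W 0 /\ forall a u v, W u -> W v -> W (a *: u + v).

Lemma submodD W u v : submod W -> W u -> W v -> W (u + v).
Proof. by move=> [_ h] hu hv; rewrite -[u]scale1r; exact: h. Qed.
Lemma submodZ W a u : submod W -> W u -> W (a *: u).
Proof. by move=> [h0 h] hu; rewrite -[X in W X]addr0; exact: h. Qed.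
Lemma submodB W u v : submod W -> W u -> W v -> W (u - v).
Proof. by move=> hW hu hv; apply: submodD => //; rewrite -scaleN1r; exact: submodZ. Qed.
Lemma submod_sum W n (F : 'I_n -> T) :
  submod W -> (forall i, W (F i)) -> W (\sum_i F i).
Proof.
by move=> hW hF; elim/big_ind: _ => // [|u v]; [case: hW|exact: submodD].
Qed.
Lemma submod_cong W u v : submod W -> W (u - v) -> W u <-> W v.
Proof.
move=> hW huv; split=> h; last by rewrite -(subrK v u); exact: submodD.
by rewrite -[v](subKr u); exact: submodB.
Qed.

Definition hasdim V W n : Prop := exists b : 'I_n -> T,
  [/\ forall i, V (b i),
      forall v, V v -> exists c : 'I_n -> K, W (v - \sum_i c i *: b i)
    & forall c : 'I_n -> K, W (\sum_i c i *: b i) -> forall i, c i = 0].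

Let lc n (b : 'I_n -> T) (r : 'rV[K]_n) := \sum_i r 0 i *: b i.

Let lcM m n (b : 'I_n -> T) (M : 'M_(m, n)) (r : 'rV_m) :
  lc b (r *m M) = \sum_i r 0 i *: lc b (row i M).
Proof.
rewrite /lc; under [RHS]eq_bigr do rewrite scaler_sumr.
rewrite exchange_big; apply: eq_bigr => j _; rewrite mxE scaler_suml.
by apply: eq_bigr => i _; rewrite scalerA mxE.
Qed.

Let coords V W n (b : 'I_n -> T) m (b' : 'I_m -> T) :
  submod W -> (forall v, V v -> exists c : 'I_n -> K, W (v - \sum_i c i *: b i)) ->
  (forall i, V (b' i)) -> exists M : 'M[K]_(m, n),
  forall r, W (lc b' r - lc b (r *m M)).
Proof.
move=> hW hb hb'.
have /choice [c hc] i : exists c : 'I_n -> K, W (b' i - \sum_j c j *: b j).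
  exact/hb/hb'.
exists (\matrix_(i, j) c i j) => r.
rewrite lcM -sumrB; apply: submod_sum => // i; rewrite -scalerBr.
apply: submodZ => //; move: (hc i); congr (W (_ - _)).
by apply: eq_bigr => j _; rewrite !mxE.
Qed.

Lemma hasdim_ge V W n m (b' : 'I_m -> T) : submod W -> hasdim V W n ->
  (forall i, V (b' i)) ->
  (forall c : 'I_m -> K, W (\sum_i c i *: b' i) -> forall i, c i = 0) ->
  (m <= n)%N.
Proof.
move=> hW [b [Vb sb ib]] Vb' ib'; have [M hM] := coords hW sb Vb'.
suff /eqP <- : row_free M by exact: rank_leq_col.
apply: inj_row_free => v vM; apply/rowP => i; rewrite mxE.
apply: (ib' (fun i => v 0 i)); have := hM v; rewrite vM.
by rewrite /lc [X in _ - X]big1 ?subr0 // => j _; rewrite mxE scale0r.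
Qed.

Lemma hasdim_uniq V W n m : submod W -> hasdim V W n -> hasdim V W m -> n = m.
Proof.
move=> hW h1 h2; apply/eqP; rewrite eqn_leq.
case: (h1) (h2) => [b [Vb _ ib]] [b' [Vb' _ ib']].
by rewrite (hasdim_ge hW h2 Vb ib) (hasdim_ge hW h1 Vb' ib').
Qed.

Lemma hasdim_chain U V W m n : submod U -> submod V -> submod W ->
  (W `<=` V)%classic -> (V `<=` U)%classic ->
  hasdim U V m -> hasdim V W n -> hasdim U W (m + n).
Proof.
move=> hU hV hW WV VU [b [Ub sb ib]] [b' [Vb' sb' ib']].
pose B (i : 'I_(m + n)) := match split i with inl j => b j | inr j => b' j end.
have BE (c : 'I_(m + n) -> K) : \sum_i c i *: B i =
    \sum_i c (lshift n i) *: b i + \sum_i c (rshift m i) *: b' i.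
  rewrite big_split_ord /=; congr (_ + _); apply: eq_bigr => i _; rewrite /B.
    by rewrite (unsplitK (inl i)).
  by rewrite (unsplitK (inr i)).
exists B; split.
- by move=> i; rewrite /B; case: split => j //; apply: VU.
- move=> v /sb [c /sb' [c' hc']].
  exists (fun i => match split i with inl j => c j | inr j => c' j end).
  rewrite BE opprD addrA; move: hc'; congr (W (_ - _ - _)).
    by apply: eq_bigr => i _; rewrite (unsplitK (inl i)).
  by apply: eq_bigr => i _; rewrite (unsplitK (inr i)).
move=> c; rewrite BE => h.
have V' : V (\sum_i c (rshift m i) *: b' i).
  by apply: submod_sum => // i; exact: submodZ.
have c1 : forall i, c (lshift n i) = 0.
  apply: ib; rewrite -[X in V X](addrK (\sum_i c (rshift m i) *: b' i)).
  by apply: submodB => //; exact: WV.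
have c2 : forall i, c (rshift m i) = 0.
  apply: ib'; move: h; rewrite big1 ?add0r // => i _.
  by rewrite c1 scale0r.
by move=> i; rewrite -(splitK i); case: split.
Qed.

(** The matrix M expresses a basis of U / W in a basis of U / V, so V / W is the kernel of M and a
    row basis of [kermx M] gives a basis of it. This yields finite dimensions for which no explicit
    basis is visible. *)
Lemma hasdim_sub U V W k n : submod U -> submod V -> submod W ->
  (W `<=` V)%classic -> (V `<=` U)%classic -> hasdim U V k -> hasdim U W n ->
  exists2 l, hasdim V W l & n = (k + l)%N.
Proof.
move=> hU hV hW WV VU dUV dUW.
suff [l dVW] : exists l, hasdim V W l.
  by exists l => //; apply: hasdim_uniq dUW _ => //; exact: hasdim_chain dVW.
case: dUV dUW => [b [Ub sb ib]] [b' [Ub' sb' ib']].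
have [M hM] := coords hV sb Ub'.
have inV r : V (lc b' r) <-> r *m M = 0.
  split=> [h|rM].
    apply/rowP => i; rewrite [RHS]mxE; apply: (ib (fun i => (r *m M) 0 i)).
    exact/(submod_cong hV (hM r)).
  have := hM r; rewrite rM /lc [X in _ - X]big1 ?subr0 // => j _.
  by rewrite mxE scale0r.
pose N := row_base (kermx M).
have NM : N *m M = 0 by apply/sub_kermxP; rewrite eq_row_base.
pose B i := lc b' (row i N).
have BE (r : 'rV_(\rank (kermx M))) : \sum_i r 0 i *: B i = lc b' (r *m N).
  by rewrite lcM.
have BE' (c : 'I_(\rank (kermx M)) -> K) :
    \sum_i c i *: B i = lc b' ((\row_i c i) *m N).
  by rewrite -BE; apply: eq_bigr => i _; rewrite mxE.
exists (\rank (kermx M)), B; split.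
- by move=> i; apply/inV; rewrite -row_mul NM row0.
- move=> v Vv; have [c hc] := sb' v (VU _ Vv).
  have cE : \sum_i c i *: b' i = lc b' (\row_i c i).
    by apply: eq_bigr => i _; rewrite mxE.
  rewrite cE in hc.
  have /inV/sub_kermxP : V (lc b' (\row_i c i)).
    by apply/(submod_cong hV (WV _ hc)).
  rewrite -(eq_row_base (kermx M)) => /submxP [r rE].
  by exists (fun i => r 0 i); rewrite BE -rE.
move=> c; rewrite BE' => /ib' h i.
have : (\row_i c i) *m N = 0.
  by apply/rowP => j; rewrite [RHS]mxE; exact: h.
move/(congr1 (mulmx^~ (pinvmx N))); rewrite mulmxKp ?row_base_free // mul0mx.
by move=> /rowP /(_ i); rewrite !mxE.
Qed.

Lemma hasdim0 V W : (V `<=` W)%classic -> hasdim V W 0.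
Proof.
move=> VW; exists (fun=> 0); split=> [[]//|v Vv|c _ []//].
by exists (fun=> 0); rewrite big_ord0 subr0; exact: VW.
Qed.

Lemma hasdim_ext V W V' W' n : (forall v, V v <-> V' v) -> (forall v, W v <-> W' v) ->
  hasdim V W n -> hasdim V' W' n.
Proof.
move=> VV WW [b [Vb sb ib]]; exists b; split=> [i|v /VV/sb[c hc]|c /WW]; last exact: ib.
  exact/VV.
by exists c; apply/WW.
Qed.

End Dim.

Section DimTransport.
Variables (K : fieldType) (T T' : lmodType K) (f : T -> T').
Variables (V W : set T) (V' W' : set T').
Hypothesis f_lin : forall a u v, f (a *: u + v) = a *: f u + f v.
Hypothesis fV : forall v, V v -> V' (f v).
Hypothesis fW : forall v, V v -> (W v <-> W' (f v)).
Hypothesis f_surj : forall v', V' v' -> exists2 v, V v & W' (v' - f v).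
Hypothesis V_sub : submod V.
Hypothesis W'_sub : submod W'.

Let f0 : f 0 = 0.
Proof. by have := f_lin (-1) 0 0; rewrite scaler0 addr0 scaleN1r addNr. Qed.
Let f_sum n (c : 'I_n -> K) (b : 'I_n -> T) :
  f (\sum_i c i *: b i) = \sum_i c i *: f (b i).
Proof.
elim/big_rec2: _ => [|i u v _ <-]; first exact: f0.
exact: f_lin.
Qed.
Let V_sum n (c : 'I_n -> K) (b : 'I_n -> T) :
  (forall i, V (b i)) -> V (\sum_i c i *: b i).
Proof. by move=> Vb; apply: submod_sum => // i; exact: submodZ. Qed.
Let fB u v : f (u - v) = f u - f v.
Proof. by rewrite addrC -scaleN1r f_lin scaleN1r addrC. Qed.

(** The hypotheses of the section say that f induces an isomorphism from V / W onto V' / W'. *)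
Lemma hasdim_transport n : hasdim V W n -> hasdim V' W' n.
Proof.
move=> [b [Vb sb ib]]; exists (f \o b); split=> /= [i|v' V'v'|c].
- exact/fV.
- have [v Vv hv] := f_surj V'v'; have [c hc] := sb _ Vv; exists c.
  have h : V (v - \sum_i c i *: b i) by apply: submodB => //; exact: V_sum.
  rewrite -f_sum -[v'](subrK (f v)) -addrA -fB; apply: submodD => //.
  exact/fW.
by rewrite -f_sum => /fW h; apply: ib; apply: h; exact: V_sum.
Qed.

Lemma hasdim_transport_inv n : hasdim V' W' n -> hasdim V W n.
Proof.
move=> [b' [Vb' sb' ib']].
have /choice [b hb] i : exists v, V v /\ W' (b' i - f v).
  by have [v] := f_surj (Vb' i); exists v.
have bb' (c : 'I_n -> K) : W' (\sum_i c i *: b' i - f (\sum_i c i *: b i)).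
  rewrite f_sum -sumrB; apply: submod_sum => // i; rewrite -scalerBr.
  by apply: submodZ => //; case: (hb i).
have Vs c : V (\sum_i c i *: b i) by apply: V_sum => i; case: (hb i).
exists b; split=> [i|v Vv|c h]; first by case: (hb i).
  have [c hc] := sb' _ (fV Vv); exists c; apply/fW; first exact: submodB.
  rewrite fB -[f v](subrK (\sum_i c i *: b' i)) -addrA; apply: submodD => //.
by apply: ib'; apply/(submod_cong W'_sub (bb' c))/fW.
Qed.

End DimTransport.

(** A copy of T carrying the K-module structure given by [phi]. The tag matters because one ring,
    such as K[[t]], occurs with several structure maps. *)
Definition algmod (K T : comNzRingType) (phi : {rmorphism K -> T}) : Type := T.

Section AlgMod.
Variables (K : fieldType) (T : comNzRingType) (phi : {rmorphism K -> T}).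

HB.instance Definition _ := GRing.Zmodule.copy (algmod phi) T.

Definition algmod_scale (a : K) (v : algmod phi) : algmod phi := phi a * (v : T).

Lemma algmod_scaleA a b v :
  algmod_scale a (algmod_scale b v) = algmod_scale (a * b) v.
Proof. by rewrite /algmod_scale rmorphM mulrA. Qed.
Lemma algmod_scale1 : left_id 1 algmod_scale.
Proof. by move=> v; rewrite /algmod_scale rmorph1 mul1r. Qed.
Lemma algmod_scaleDr : right_distributive algmod_scale +%R.
Proof. by move=> a u v; exact: mulrDr. Qed.
Lemma algmod_scaleDl v : {morph algmod_scale^~ v : a b / a + b}.
Proof. by move=> a b; rewrite /algmod_scale rmorphD; exact: mulrDl. Qed.

HB.instance Definition _ := GRing.Zmodule_isLmodule.Build K (algmod phi)
  algmod_scaleA algmod_scale1 algmod_scaleDr algmod_scaleDl.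

Lemma algmodZE a (v : algmod phi) : a *: v = phi a * (v : T) :> T.
Proof. by []. Qed.

Definition adim (V W : set T) n := hasdim (V : set (algmod phi)) W n.

Lemma enat_of_eq (P : nat -> Prop) n :
  P n -> (forall m, P m -> m = n) -> enat_of P = n%:Z%:E.
Proof.
move=> Pn Pu; rewrite /enat_of; case: pselect => [h|[]]; last by exists n.
by case: xgetP => [m _ /= /Pu ->|/(_ n)].
Qed.

Lemma dim_mod_eq (V W : set T) n :
  submod (W : set (algmod phi)) -> adim V W n -> dim_mod phi V W = n%:Z%:E.
Proof.
move=> hW d; apply: enat_of_eq => // m hm.
by apply: (@hasdim_uniq _ (algmod phi) V W m n hW).
Qed.

Lemma dim_mod_fin (V W : set T) : dim_mod phi V W != +oo%E -> exists n, adim V W n.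
Proof. by rewrite /dim_mod /enat_of; by case: pselect => // _; rewrite eqxx. Qed.

End AlgMod.

(** * Weierstrass division *)

Section PolyFps.
Variable R : comNzRingType.

Definition poly_fps (p : {poly R}) : fps R := FPS (fun j => p`_j).

Lemma poly_fps_is_zmod_morphism : zmod_morphism poly_fps.
Proof. by move=> p q; apply: fpsP => j; rewrite fpsBE !fpsE coefB. Qed.
Lemma poly_fps_is_monoid_morphism : monoid_morphism poly_fps.
Proof.
split=> [|p q]; apply: fpsP => j; first by rewrite fps1E fpsE coef1.
by rewrite fpsE coefM.
Qed.
HB.instance Definition _ := GRing.isZmodMorphism.Build {poly R} (fps R)
  poly_fps poly_fps_is_zmod_morphism.
HB.instance Definition _ := GRing.isMonoidMorphism.Build {poly R} (fps R)
  poly_fps poly_fps_is_monoid_morphism.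

Lemma poly_fpsX : poly_fps 'X = fpsX R.
Proof. by apply: fpsP => j; rewrite fpsE coefX. Qed.
Lemma poly_fpsC c : poly_fps c%:P = fpsC c.
Proof. by apply: fpsP => j; rewrite fpsE coefC fpsCE; case: eqP. Qed.

Lemma hom_poly_fps (S : comNzRingType) (e : {rmorphism fps R -> S})
    (iota : {rmorphism R -> S}) p :
  (forall c, e (fpsC c) = iota c) ->
  e (poly_fps p) = (map_poly iota p).[e (fpsX R)].
Proof.
move=> eC; rewrite /map_poly horner_poly.
have -> : poly_fps p = fps_take (size p) (poly_fps p).
  by apply: fpsP => j; rewrite !fpsE; case: ltnP => // /(nth_default 0).
rewrite fps_takeE rmorph_sum; apply: eq_bigr => i _.
by rewrite rmorphM rmorphXn eC.
Qed.

End PolyFps.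

Section Weierstrass.
Variable K : fieldType.
Local Notation O := (fps K).
Local Notation A := (fps (fps K)).
Implicit Types F G h q w : A.

(* F(0, y): the outer variable of A is y. *)
Definition at_x0 F : fps K := FPS (fun j => F j 0%N).
Lemma at_x0E F j : at_x0 F j = F j 0%N. Proof. by []. Qed.
Lemma at_x0_is_zmod_morphism : zmod_morphism at_x0.
Proof. by move=> f g; apply: fpsP => j; rewrite [RHS]fpsBE !at_x0E !fpsBE. Qed.
Lemma at_x0_is_monoid_morphism : monoid_morphism at_x0.
Proof.
split=> [|f g]; apply: fpsP => j.
  by rewrite at_x0E !fps1E; case: eqP; rewrite ?fps1E ?fps0E.
rewrite [LHS]at_x0E (fpsME f g j) fps_sumE (fpsME (at_x0 f) (at_x0 g) j).
apply: eq_bigr => i _.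
by rewrite fpsM0.
Qed.
HB.instance Definition _ := GRing.isZmodMorphism.Build A (fps K)
  at_x0 at_x0_is_zmod_morphism.
HB.instance Definition _ := GRing.isMonoidMorphism.Build A (fps K)
  at_x0 at_x0_is_monoid_morphism.

Definition yreg n F : Prop := at_x0 F != 0 /\ ord (at_x0 F) = n.

Lemma yregP n F : yreg n F <-> F n 0%N != 0 /\ forall j, (j < n)%N -> F j 0%N = 0.
Proof.
split=> [[F0 <-]|[Fn Fl]]; first exact: (ordP F0).
split; last exact: ord_eq.
by apply: contraNneq Fn => e; rewrite -at_x0E e fps0E.
Qed.
Lemma yreg_neq0 n F : yreg n F -> F != 0.
Proof. by case=> h _; apply: contraNneq h => ->; rewrite rmorph0. Qed.
Lemma yreg_factor m n F G : yreg m F -> yreg n (F * G) ->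
  (m <= n)%N /\ yreg (n - m) G.
Proof.
move=> [F0 <-] [FG0 <-]; have FGE := rmorphM at_x0 F G.
rewrite /= in FGE; rewrite {}FGE in FG0 *.
have G0 : at_x0 G != 0 by apply: contraNneq FG0 => ->; rewrite mulr0.
by rewrite ordM // leq_addr addKn.
Qed.
Lemma unit2E F : (F \is a GRing.unit) = (F 0%N 0%N != 0).
Proof. by rewrite !fps_unitE unitfE. Qed.
Lemma yreg0 F : yreg 0 F <-> F \is a GRing.unit.
Proof. by rewrite unit2E; split=> [/yregP[]//|h]; apply/yregP. Qed.

Definition xdiv k F : Prop := forall j, xfil1 K k (F j).

Lemma xdivD k F G : xdiv k F -> xdiv k G -> xdiv k (F + G).
Proof. by move=> hF hG j; apply: filD. Qed.
Lemma xdivB k F G : xdiv k F -> xdiv k G -> xdiv k (F - G).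
Proof. by move=> hF hG j; apply: filB. Qed.
Lemma xdivM k l F G : xdiv k F -> xdiv l G -> xdiv (k + l) (F * G).
Proof. by move=> hF hG j; apply: fil_bigsum => i _; apply: filM. Qed.
Lemma xdiv_full F : xdiv 0 F.
Proof. by move=> j; exact: fil_full. Qed.
Lemma xdiv_sep F : (forall k, xdiv k F) -> F = 0.
Proof.
move=> hF; apply: fpsP => j; rewrite fps0E.
by apply: (@fil_sep _ (xfil1 K)) => k; exact: hF.
Qed.
Lemma xdivP k F : xdiv k F <-> forall j i, (i < k)%N -> F j i = 0.
Proof. by split=> h j; [apply/xfil1P|apply/xfil1P => i; exact: h]. Qed.

(** Contraction principle for the x-adic topology: the iterates u_(k+1) = c - T u_k agree modulo x^k
    from index k on. *)
Lemma xdiv_fixpoint (T : A -> A) c :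
  (forall v w, T (v - w) = T v - T w) ->
  (forall k w, xdiv k w -> xdiv k.+1 (T w)) ->
  exists w, w = c - T w.
Proof.
move=> TB Tx; pose u := fix u k := if k is k'.+1 then c - T (u k') else 0.
have uS k : xdiv k (u k.+1 - u k).
  elim: k => [|k IH]; first exact: xdiv_full.
  have -> : u k.+2 - u k.+1 = 0 - T (u k.+1 - u k) by rewrite TB /=; ring.
  apply: xdivB; last exact: Tx.
  by apply/xdivP => j i _; rewrite !fps0E.
have uc k l : (k <= l)%N -> xdiv k (u l - u k).
  move=> kl; rewrite -(subnKC kl); elim: (l - k)%N => [|m IH].
    by rewrite addn0 subrr; apply/xdivP => j i _; rewrite !fps0E.
  rewrite addnS -(subrK (u (k + m)%N) (u _.+1)) -addrA; apply: xdivD => //.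
  apply/xdivP => j i ik; have /xdivP := uS (k + m)%N; apply.
  exact: leq_trans ik (leq_addr _ _).
(* The coefficient of x^i is the same in all iterates from index i + 1 on. *)
pose w : A := FPS (fun j => FPS (fun i => u i.+1 j i)).
have wu k : xdiv k (w - u k).
  apply/xdivP => j i ik; rewrite !fpsBE !fpsE.
  have /xdivP/(_ j i (ltnSn i)) := uc _ _ ik; rewrite !fpsBE => /eqP.
  by rewrite subr_eq0 => /eqP ->; rewrite subrr.
exists w; apply/eqP; rewrite -subr_eq0; apply/eqP/xdiv_sep => k.
suff : xdiv k.+1 (w - (c - T w)).
  by move/xdivP => h; apply/xdivP => j i ik; apply: h; exact: ltnW.
have -> : w - (c - T w) = (w - u k.+1) + T (w - u k).
  by rewrite TB /=; ring.
by apply: xdivD; [exact: wu|apply/Tx/wu].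
Qed.

Section Division.
Variables (n : nat) (F : A).
Hypothesis Freg : yreg n F.

Let V := (fps_drop n F)^-1.
Let L := fps_take n F.
Let T w := fps_drop n (w * V * L).

Let UV : V * fps_drop n F = 1.
Proof.
apply: mulVr; rewrite unit2E fps_dropE addn0.
by have /yregP[] := Freg.
Qed.
Let FE : F = L + fpsX O ^+ n * fps_drop n F. Proof. exact: fps_take_drop. Qed.
Let dropF w : fps_drop n (w * V * F) = T w + w.
Proof.
rewrite {1}FE mulrDr fps_drop_add; congr (_ + _).
have -> : w * V * (fpsX O ^+ n * fps_drop n F) = fpsX O ^+ n * (w * (V * fps_drop n F)).
  by ring.
by rewrite UV mulr1 fps_dropXn.
Qed.
Let TB v w : T (v - w) = T v - T w.
Proof. by rewrite /T !mulrBl fps_dropB. Qed.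
Let Tx k w : xdiv k w -> xdiv k.+1 (T w).
Proof.
move=> hw.
have L1 : xdiv 1 L.
  apply/xdivP => j [|//] _; rewrite fpsE; case: ltnP => nj; last by rewrite fps0E.
  by have /yregP[_] := Freg; apply.
have h : xdiv k.+1 (w * V * L).
  rewrite -addn1; apply: xdivM => //; rewrite -[k]addn0; apply: xdivM => //.
  exact: xdiv_full.
by move=> j; rewrite fps_dropE; exact: h.
Qed.

(** Here F = [L] + y^n U, where U = [fps_drop n F] is a unit with inverse [V] and [L] is divisible
    by x. For q = w V, the absence of terms of degree n or more in h - q F reads w + T w =
    [fps_drop n h], and T raises the x-order by one. *)
Lemma weierstrass_division h : exists q, fps_drop n (h - q * F) = 0.
Proof.
have [w hw] := xdiv_fixpoint (fps_drop n h) TB Tx.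
by exists (w * V); rewrite fps_dropB dropF {2}hw; ring.
Qed.

Lemma fps_drop_eq0 h : fps_drop n h = 0 -> exists r : {poly O},
  (size r <= n)%N /\ h = poly_fps r.
Proof.
move=> h0; exists (\poly_(i < n) h i); split; first exact: size_poly.
apply: fpsP => j; rewrite fpsE coef_poly; case: ltnP => // nj.
have := congr1 (fun h : A => h (j - n)%N) h0.
by rewrite fps_dropE subnKC // fps0E.
Qed.

Lemma weierstrass_remainder h : exists q (r : {poly O}),
  (size r <= n)%N /\ h = q * F + poly_fps r.
Proof.
have [q /fps_drop_eq0 [r [sr hr]]] := weierstrass_division h.
by exists q, r; rewrite -hr addrC subrK.
Qed.

(* P is y ^ n minus its remainder in the division by F. *)
Lemma weierstrass_preparation : exists (P : {poly O}) (u : A),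
  [/\ P \is monic, size P = n.+1, forall j, (j < n)%N -> P`_j 0%N = 0,
      u \is a GRing.unit & poly_fps P = u * F].
Proof.
have [u [r [sr hr]]] := weierstrass_remainder (fpsX O ^+ n).
have sX : (size (- r) < size ('X^n : {poly O}))%N by rewrite size_polyN size_polyXn ltnS.
have uF : u * F = poly_fps ('X^n - r).
  by rewrite rmorphB rmorphXn /= poly_fpsX hr addrK.
(* At x = 0 the division reads y^n = u F + r with F(0, y) of order n and deg r < n: hence r(0, y) =
   0 and u(0, 0) is nonzero. *)
have x0 : fpsX K ^+ n = at_x0 u * at_x0 F + at_x0 (poly_fps r).
  rewrite -rmorphM -rmorphD -hr rmorphXn; congr (_ ^+ n).
  by apply: fpsP => j; rewrite at_x0E !fpsXE; case: eqP; rewrite ?fps1E ?fps0E.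
have /yregP[Fn Fl] := Freg.
have r0 j : (j < n)%N -> r`_j 0%N = 0.
  move=> jn; have := congr1 (fun f : fps K => f j) x0.
  rewrite fpsDE fpsXnE ltn_eqF // fpsME big1 => [|i _].
    by rewrite add0r at_x0E fpsE.
  rewrite [at_x0 F _]at_x0E Fl ?mulr0 //.
  exact: leq_ltn_trans (leq_subr _ _) jn.
exists ('X^n - r), u; split=> //.
- by rewrite monicE lead_coefDl // lead_coefXn.
- by rewrite size_polyDl // size_polyXn.
- move=> j jn; rewrite coefB coefXn ltn_eqF // fpsBE fps0E r0 // subr0.
  by [].
have := congr1 (fun f : fps K => f n) x0.
rewrite fpsDE fpsXnE eqxx fpsME big_ord_recl subn0 big1 => [|i _]; last first.
  rewrite [at_x0 F _]at_x0E Fl ?mulr0 //=.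
  by rewrite /bump; have := ltn_ord i; lia.
rewrite addr0 !at_x0E fpsE nth_default // fps0E addr0 => e.
rewrite unit2E; apply: contraNneq (oner_neq0 K) => u0.
by rewrite -[1]/(1%:R) e u0 mul0r.
Qed.

End Division.
End Weierstrass.

(** * Newton-Puiseux *)

Section Constant.
Variable R : comNzRingType.

Definition const_coef (f : fps R) : R := f 0%N.
Lemma const_coef_is_zmod_morphism : zmod_morphism const_coef.
Proof. by []. Qed.
Lemma const_coef_is_monoid_morphism : monoid_morphism const_coef.
Proof. by split=> [|f g]; [exact: fps1E|exact: fpsM0]. Qed.
HB.instance Definition _ := GRing.isZmodMorphism.Build (fps R) R
  const_coef const_coef_is_zmod_morphism.
HB.instance Definition _ := GRing.isMonoidMorphism.Build (fps R) R
  const_coef const_coef_is_monoid_morphism.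
Lemma fpsX0 f n : (0 < n)%N -> (fpsX R ^+ n * f) 0%N = 0.
Proof. by case: n => // n _; rewrite exprS -mulrA fpsXM0. Qed.

(** Serves twice: to remove the second coefficient by a translation, and to recognize from it when a
    reduced polynomial is a pure power. *)
Lemma coef_shift_lead (p : {poly R}) (a : R) n : (size p <= n.+2)%N ->
  (p \Po ('X + a%:P))`_n.+1 = p`_n.+1 /\
  (p \Po ('X + a%:P))`_n = p`_n + p`_n.+1 * a *+ n.+1.
Proof.
move=> sp; have XaE m i : (('X + a%:P) ^+ m)`_i = a ^+ (m - i) *+ 'C(m, i).
  rewrite addrC exprDn; case: (leqP i m) => im; last first.
    rewrite bin_small // mulr0n coef_sum big1 // => j _.
    rewrite coefMn -rmorphXn coefCM coefXn gtn_eqF ?mulr0 ?mul0rn //.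
    exact: leq_trans (ltn_ord j) im.
  rewrite coef_sum (bigD1 (Ordinal (im : (i < m.+1)%N))) //= big1 => [|j].
    by rewrite addr0 coefMn -rmorphXn coefCM coefXn eqxx mulr1.
  rewrite -val_eqE /= => ji.
  by rewrite coefMn -rmorphXn coefCM coefXn eq_sym (negPf ji) mulr0 mul0rn.
have pE : p = \poly_(i < n.+2) p`_i.
  by apply/polyP => i; rewrite coef_poly; case: ltnP => // h;
    rewrite nth_default // (leq_trans sp).
have cE i : (p \Po ('X + a%:P))`_i =
    \sum_(j < n.+2) p`_j * (a ^+ (j - i) *+ 'C(j, i)).
  rewrite coef_comp_poly -(big_mkord xpredT (fun j => p`_j * (('X + a%:P) ^+ j)`_i)).
  rewrite (big_nat_widen _ _ _ _ _ sp) big_mkcond big_mkord; apply: eq_bigr => j _.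
  rewrite /= XaE; case: ltnP => // h; by rewrite nth_default ?mul0r.
split; rewrite cE big_ord_recr /=.
  by rewrite subnn binn mulr1 big1 ?add0r // => j _; rewrite bin_small ?mulr0n ?mulr0.
rewrite big_ord_recr /= subnn binn mulr1 big1 => [|j _]; last first.
  by rewrite bin_small ?mulr0n ?mulr0.
by rewrite add0r subSnn expr1 binSn mulrnAr.
Qed.

End Constant.

Section Puiseux.
Variable K : closedFieldType.
Local Notation O := (fps K).
Local Notation A := (fps (fps K)).

(** A relation instead of a chosen map, so that the restriction of any parametrization to K[[x]]
    satisfies it; [power_subst_uniq] makes it as good as a function. *)
Definition power_subst d (iota : O -> O) : Prop :=
  (forall c, iota (fpsC c) = fpsC c) /\ iota (fpsX K) = fpsX K ^+ d.

Lemma power_subst_exists d : (0 < d)%N ->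
  exists iota : {rmorphism O -> O}, power_subst d iota.
Proof.
move=> d0; have h : xfil1 K 1%N (fpsX K ^+ d).
  by apply: xfil1_1; rewrite -[_ ^+ _]mulr1 fpsX0.
by have [E [EC EX _]] := fps_evalP (@fpsC K : {rmorphism K -> O}) h; exists E.
Qed.

Lemma power_subst_uniq d (i j : {rmorphism O -> O}) : (0 < d)%N ->
  power_subst d i -> power_subst d j -> i =1 j.
Proof.
move=> d0 [iC iX] [jC jX]; apply: (@fps_hom_ext _ _ (xfil1 K)).
- by rewrite iX; apply: xfil1_1; rewrite -[_ ^+ _]mulr1 fpsX0.
- by move=> c; rewrite iC jC.
by rewrite iX jX.
Qed.

Lemma power_subst0 d (iota : {rmorphism O -> O}) f : (0 < d)%N ->
  power_subst d iota -> iota f 0%N = f 0%N.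
Proof.
move=> d0 [iC iX]; rewrite {1}(fps_split0 f) rmorphD rmorphM iC iX fpsDE.
by rewrite fpsX0 // addr0 fpsCE eqxx.
Qed.

(* A parametrization x = t ^ d, y = phi(t). *)
Definition param d (e : A -> O) : Prop :=
  [/\ forall c, e (fps2C c) = fpsC c, e (varx K) = fpsX K ^+ d
    & (e (vary K)) 0%N = 0].

Lemma param_exists d (phi : O) : (0 < d)%N -> phi 0%N = 0 ->
  exists2 e : {rmorphism A -> O}, param d e & e (vary K) = phi.
Proof.
move=> d0 phi0; have [iota [iC iX]] := power_subst_exists d0.
have [E [EC EX _]] := fps_evalP iota (xfil1_1 phi0).
exists E => //; split=> [c||]; last by rewrite /vary EX.
  by rewrite [fps2C c]/= EC iC.
by rewrite /varx EC iX.
Qed.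

Lemma param_power_subst d (e : {rmorphism A -> O}) : param d e ->
  power_subst d (e \o @fpsC O).
Proof. by case. Qed.

Lemma param_uniq d (e e' : {rmorphism A -> O}) : (0 < d)%N ->
  param d e -> param d e' -> e (vary K) = e' (vary K) -> e =1 e'.
Proof.
move=> d0 he he' ey; apply: (@fps_hom_ext _ _ (xfil1 K)) => //.
  by apply: xfil1_1; case: he.
exact: (power_subst_uniq d0 (param_power_subst he) (param_power_subst he')).
Qed.

Lemma param_poly d (e : {rmorphism A -> O}) (iota : {rmorphism O -> O})
  (P : {poly O}) : (0 < d)%N -> param d e -> power_subst d iota ->
  e (poly_fps P) = (map_poly iota P).[e (vary K)].
Proof.
move=> d0 he hi; apply: hom_poly_fps.
exact: (power_subst_uniq d0 (param_power_subst he) hi).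
Qed.

Definition tame n := forall k, (0 < k <= n)%N -> k%:R != 0 :> K.

Lemma newton_polygon n (q : 'I_n -> O) : (exists i, q i != 0) ->
  exists i0, q i0 != 0 /\
    forall i, q i != 0 -> (ord (q i0) * (n - i) <= ord (q i) * (n - i0))%N.
Proof.
move=> [i1 qi1]; pose F (i : 'I_n) : rat := (ord (q i))%:R / (n - i)%:R.
have [i0 qi0 hmin] := @Order.TotalTheory.arg_minP _ _ _ i1 [pred i | q i != 0] F qi1.
exists i0; split=> // i qi; have := hmin i qi; rewrite /F.
have pos (j : 'I_n) : 0 < (n - j)%:R :> rat by rewrite ltr0n subn_gt0.
by rewrite ler_pdivrMr // mulrAC ler_pdivlMr // -!natrM ler_nat.
Qed.

(* The inductive step: the substitution x = s ^ k, y = s ^ r z given by the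
   steepest slope makes the reduction of q a polynomial whose roots are not all
   equal, because its second coefficient vanishes. *)
Lemma puiseux_step n (q : {poly O}) :
  q \is monic -> size q = n.+2 -> q`_n = 0 ->
  (forall j, (j < n.+1)%N -> q`_j 0%N = 0) -> tame n.+1 ->
  (forall m G, (0 < m <= n)%N -> yreg m G -> exists d (e : {rmorphism A -> O}),
    [/\ (0 < d)%N, d%:R != 0 :> K, param d e & e G = 0]) ->
  exists d (iota : {rmorphism O -> O}) (phi : O),
    [/\ (0 < d)%N, d%:R != 0 :> K, power_subst d iota, phi 0%N = 0
      & (map_poly iota q).[phi] = 0].
Proof.
move=> qm sq qn q0 tn IH.
have hornq (iota : {rmorphism O -> O}) (phi : O) :
    (map_poly iota q).[phi] = \sum_(i < n.+2) iota q`_i * phi ^+ i.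
  by rewrite /map_poly horner_poly sq.
have qlead : q`_n.+1 = 1 by rewrite -[n.+1]/(n.+2.-1) -sq; exact/eqP.
(* If all lower coefficients vanish, q is a pure power and 0 is a root. *)
case: (pselect (exists i : 'I_n.+1, q`_i != 0)) => [ex|nex]; last first.
  have [iota hi] := power_subst_exists (isT : (0 < 1)%N).
  exists 1%N, iota, 0; split; rewrite ?oner_neq0 ?fps0E //.
  rewrite hornq big_ord_recr /= expr0n mulr0 addr0 big1 // => i _.
  suff -> : q`_i = 0 by rewrite rmorph0 mul0r.
  by apply/eqP/negPn/negP => h; apply: nex; exists i.
have [i0 [qi0 slope]] := newton_polygon ex.
pose k := (n.+1 - i0)%N; pose r := ord q`_i0.
have k0 : (0 < k)%N by rewrite subn_gt0.
have r0 : (0 < r)%N.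
  rewrite lt0n; apply: contraNneq (proj1 (ordP qi0)) => /eqP; rewrite -/r.
  by move=> /eqP ->; rewrite q0.
have [ik hik] := power_subst_exists k0; have [ikC ikX] := hik.
(* Coefficients in z of q(s^k, s^r z) / s^(r (n + 1)). The slope inequality makes the truncated
   difference in the exponent a true one, and it is 0 at [i0]. *)
pose h i := if i == n.+1 then 1 else
  fpsX K ^+ (k * ord q`_i - r * (n.+1 - i)) * ik (fps_drop (ord q`_i) q`_i).
have qh i : (i < n.+2)%N -> ik q`_i = fpsX K ^+ (r * (n.+1 - i)) * h i.
  rewrite ltnS leq_eqVlt /h; case: eqP => [-> _|_ /= ltin].
    by rewrite qlead subnn muln0 rmorph1 mulr1.
  case: (eqVneq q`_i 0) => [->|qi].
    suff -> : fps_drop (ord (0 : O)) 0 = 0 :> O by rewrite rmorph0 !mulr0.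
    by apply: fpsP => j; rewrite fps_dropE !fps0E.
  rewrite mulrA -exprD subnKC; last first.
    by have := slope (Ordinal ltin) qi; rewrite /= mulnC [(k * _)%N]mulnC mulnC.
  by rewrite exprM -ikX -rmorphXn -rmorphM -fps_drop0 //; case: (ordP qi).
have hn : h n = 0.
  rewrite /h ltn_eqF // qn; suff -> : fps_drop (ord (0 : O)) 0 = 0 :> O.
    by rewrite rmorph0 mulr0.
  by apply: fpsP => j; rewrite fps_dropE !fps0E.
have hi0 : h i0 0%N != 0.
  rewrite /h ltn_eqF // -/r -/k mulnC subnn expr0 mul1r (power_subst0 _ k0 hik).
  by rewrite fps_dropE addn0; case: (ordP qi0).
pose H := \poly_(i < n.+2) h i.
have sH : size H = n.+2 by rewrite size_poly_eq // /h eqxx oner_neq0.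
pose hb := map_poly (@const_coef K) H.
have hbE i : (i < n.+2)%N -> hb`_i = h i 0%N by move=> ?; rewrite coef_map coef_poly ifT.
have hbl : hb`_n.+1 = 1 by rewrite hbE // /h eqxx fps1E.
have shb : size hb = n.+2.
  apply/eqP; rewrite eqn_leq -{1}sH size_poly /=.
  by apply: contraTT (oner_neq0 K); rewrite -ltnNge negbK -hbl => /leq_sizeP ->.
have /closed_rootP [a /rootP ra] : size hb != 1%N by rewrite shb.
pose G := poly_fps (H \Po ('X + (fpsC a)%:P)).
pose g := hb \Po ('X + a%:P).
have Gg : at_x0 G = poly_fps g.
  have -> : g = map_poly (@const_coef K) (H \Po ('X + (fpsC a)%:P)).
    rewrite map_comp_poly rmorphD /= map_polyX map_polyC /= /const_coef.
    by rewrite fpsCE eqxx.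
  by apply: fpsP => j; rewrite at_x0E; symmetry; exact: coef_map.
have [g1 g2] : g`_n.+1 = 1 /\ g`_n = a *+ n.+1.
  have [-> ->] := coef_shift_lead a (eq_leq shb).
  by rewrite hbl hbE // hn fps0E add0r mul1r.
have pg0 : poly_fps g != 0.
  apply: contraNneq (oner_neq0 K) => e.
  by rewrite -g1 -[g`_n.+1]/(poly_fps g n.+1) e fps0E.
have [go gl] := ordP pg0.
have Greg : yreg (ord (poly_fps g)) G by split; rewrite Gg.
have g0 : g`_0 = 0.
  by rewrite -horner_coef0 horner_comp hornerD hornerX hornerC add0r.
have lt0o : (0 < ord (poly_fps g))%N.
  by rewrite lt0n; apply: contraNneq go => ->; rewrite fpsE g0.
(* Otherwise g is a pure power: its coefficient of index n gives (n + 1) a = 0, tameness gives a =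
   0, and [hb] itself is a pure power, contradicting its nonzero coefficient at [i0]. *)
have leon : (ord (poly_fps g) <= n)%N.
  rewrite leqNgt; apply/negP => no.
  have a0 : a = 0.
    have := gl n no; rewrite fpsE g2 -mulr_natl => /eqP.
    by rewrite mulf_eq0 (negPf (tn _ _)) ?ltnSn // => /eqP.
  have := gl i0 (leq_trans (ltn_ord i0) no).
  rewrite fpsE /g a0 polyC0 addr0 comp_polyXr (hbE _ (leqW (ltn_ord i0))).
  by move/eqP; rewrite (negPf hi0).
have [|d' [e [d'0 d'K he eG]]] := IH _ G _ Greg; first by rewrite lt0o leon.
pose i' : {rmorphism O -> O} := e \o @fpsC O.
have [i'C i'X] : power_subst d' i' := param_power_subst he.
pose phi := e (vary K) + fpsC a.
have ea : e (fpsC (fpsC a)) = fpsC a := i'C a.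
have Hphi : (map_poly i' H).[phi] = 0.
  have := eG; rewrite /G ((@hom_poly_fps _ _ e i')) // map_comp_poly.
  by rewrite rmorphD /= map_polyX map_polyC /= horner_comp hornerD hornerX hornerC ea.
(* Composing with s = t^d' gives x = t^(k d') and y = t^(d' r) [phi], where [phi] is a root of the
   substituted [H]. *)
exists (k * d')%N, (i' \o ik), (fpsX K ^+ (d' * r) * phi); split.
- by rewrite muln_gt0 k0.
- by rewrite natrM mulf_neq0 // tn // k0 leq_subr.
- split=> [c|]; first by rewrite -[LHS]/(i' (ik (fpsC c))) ikC i'C.
  by rewrite -[LHS]/(i' (ik (fpsX K))) ikX rmorphXn i'X -exprM mulnC.
- by rewrite fpsX0 // muln_gt0 d'0.
rewrite hornq; transitivity (fpsX K ^+ (d' * r * n.+1) * (map_poly i' H).[phi]); last first.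
  by rewrite Hphi mulr0.
rewrite /map_poly horner_poly sH mulr_sumr; apply: eq_bigr => i _.
transitivity (i' (ik q`_i) * (fpsX K ^+ (d' * r) * phi) ^+ i); first by [].
rewrite qh // coef_poly ltn_ord rmorphM rmorphXn i'X exprMn -!exprM.
rewrite mulrACA mulrA -exprD mulrA; congr (_ ^+ _ * _ * _).
by have := ltn_ord i; nia.
Qed.

(** Preparation reduces to a Weierstrass polynomial, and the translation by [a], which divides by
    the degree, removes its second coefficient. The unit relating the polynomial to F is not killed
    by e, so a zero of one is a zero of the other. *)
Lemma puiseux_root n F : (0 < n)%N -> tame n -> yreg n F ->
  exists d (e : {rmorphism A -> O}),
    [/\ (0 < d)%N, d%:R != 0 :> K, param d e & e F = 0].
Proof.
elim/ltn_ind: n F => -[//|n] IH F _ tn Freg.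
have [P [u [Pm sP P0 uU PF]]] := weierstrass_preparation Freg.
have Plead : P`_n.+1 = 1 by rewrite -[n.+1]/(n.+2.-1) -sP; exact/eqP.
pose a := - (P`_n * fpsC (n.+1%:R)^-1).
have a0 : a 0%N = 0 by rewrite fpsNE fpsM0 P0 // mul0r oppr0.
pose q := P \Po ('X + a%:P).
have [q1 q2] := coef_shift_lead a (eq_leq sP).
have nK : n.+1%:R != 0 :> K by apply: tn; rewrite ltnSn.
have sXa : size ('X + a%:P) = 2%N by rewrite size_XaddC.
have sq : size q = n.+2 by rewrite size_comp_poly2.
have qm : q \is monic by rewrite monicE lead_coefE sq q1 Plead.
have qn : q`_n = 0.
  rewrite q2 Plead mul1r /a mulNrn -mulrnAr -[fpsC _ *+ _]rmorphMn /=.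
  by rewrite -mulr_natr mulVf // rmorph1 mulr1 subrr.
have q0 j : (j < n.+1)%N -> q`_j 0%N = 0.
  move=> jn; rewrite -[_ 0%N]/(const_coef q`_j) -coef_map map_comp_poly.
  rewrite rmorphD /= map_polyX map_polyC /= [const_coef a]a0 polyC0 addr0.
  by rewrite comp_polyXr coef_map /=; exact: P0.
have [|d [iota [phi [d0 dK hi phi0 qphi]]]] := puiseux_step qm sq qn q0 tn.
  move=> m G /andP[m0 mn] Gm; apply: (IH m) => // k /andP[k0 km].
  by apply: tn; rewrite k0 (leq_trans km) // ltnW.
have phi'0 : (phi + iota a) 0%N = 0.
  by rewrite fpsDE phi0 (power_subst0 _ d0 hi) a0 addr0.
have [e he ey] := param_exists d0 phi'0.
exists d, e; split=> //.
have : e (poly_fps P) = 0.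
  rewrite (param_poly _ d0 he hi) ey -qphi map_comp_poly rmorphD /=.
  by rewrite map_polyX map_polyC /= horner_comp hornerD hornerX hornerC.
rewrite PF rmorphM => /eqP; rewrite mulf_eq0 => /orP[/eqP eu|/eqP //].
by have := rmorph_unit e uU; rewrite eu unitr0.
Qed.

End Puiseux.

(** * Irreducible Weierstrass polynomials *)

Section Scale.
Variable K : fieldType.

Definition fps_scale (z : K) (f : fps K) : fps K := FPS (fun n => f n * z ^+ n).
Lemma fps_scaleE z f n : fps_scale z f n = f n * z ^+ n. Proof. by []. Qed.
Lemma fps_scale_is_zmod_morphism z : zmod_morphism (fps_scale z).
Proof. by move=> f g; apply: fpsP => n; rewrite [RHS]fpsBE !fps_scaleE fpsBE mulrBl. Qed.
Lemma fps_scale_is_monoid_morphism z : monoid_morphism (fps_scale z).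
Proof.
split=> [|f g]; apply: fpsP => n.
  by rewrite fps_scaleE !fps1E; case: n => [|n]; rewrite ?mul0r ?mul1r ?expr0.
rewrite fps_scaleE (fpsME f g) (fpsME (fps_scale z f)) mulr_suml.
apply: eq_bigr => i _; rewrite !fps_scaleE mulrACA -exprD subnKC //.
by rewrite -ltnS.
Qed.
HB.instance Definition _ z := GRing.isZmodMorphism.Build (fps K) (fps K)
  (fps_scale z) (fps_scale_is_zmod_morphism z).
HB.instance Definition _ z := GRing.isMonoidMorphism.Build (fps K) (fps K)
  (fps_scale z) (fps_scale_is_monoid_morphism z).

Lemma fps_scale_mul u v f : fps_scale u (fps_scale v f) = fps_scale (u * v) f.
Proof. by apply: fpsP => n; rewrite !fps_scaleE exprMn -mulrA [v ^+ n * _]mulrC. Qed.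
Lemma fps_scale1 f : fps_scale 1 f = f.
Proof. by apply: fpsP => n; rewrite fps_scaleE expr1n mulr1. Qed.
Lemma fps_scale_coef0 z f : fps_scale z f 0%N = f 0%N.
Proof. by rewrite fps_scaleE expr0 mulr1. Qed.

End Scale.

Section PowerSubst.
Variables (K : closedFieldType) (d : nat) (iota : {rmorphism fps K -> fps K}).
Hypothesis d0 : (0 < d)%N.
Hypothesis iotaP : power_subst d iota.

Lemma power_subst_coef (f : fps K) n : iota f n = if (d %| n)%N then f (n %/ d)%N else 0.
Proof.
have [iC iX] := iotaP; rewrite {1}(fps_take_drop n.+1 f) rmorphD rmorphM rmorphXn iX.
rewrite fpsDE -exprM fpsXnM ifT ?addr0; last first.
  by nia.
rewrite fps_takeE rmorph_sum fps_sumE.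
under eq_bigr => i _ do rewrite rmorphM rmorphXn iC iX -exprM fpsCM fpsXnE.
case: (boolP (d %| n)%N) => [/dvdnP[m ->]|dn]; last first.
  rewrite big1 // => i _; case: eqP => [ni|_]; rewrite ?mulr0 //.
  by case/negP: dn; apply/dvdnP; exists i; rewrite mulnC.
have ltm : (m < (m * d).+1)%N by rewrite ltnS leq_pmulr.
rewrite (bigD1 (Ordinal ltm)) //= big1 => [|i].
  by rewrite addr0 mulnC eqxx mulr1 mulKn.
rewrite -val_eqE /= => im.
by rewrite [X in (_ == X)%:R]mulnC eqn_pmul2r // eq_sym (negPf im) mulr0.
Qed.

Lemma power_subst_inj : injective iota.
Proof.
move=> f g fg; apply: fpsP => n.
have := congr1 (fun h : fps K => h (n * d)%N) fg.
by rewrite /= !power_subst_coef dvdn_mull // mulnK.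
Qed.

Lemma power_subst_image (f : fps K) : (forall n, f n != 0 -> (d %| n)%N) ->
  f = iota (FPS (fun i => f (i * d)%N)).
Proof.
move=> hf; apply: fpsP => n; rewrite power_subst_coef.
case: (boolP (d %| n)%N) => [dn|]; first by rewrite fpsE divnK.
by apply: contraNeq; exact: hf.
Qed.

Lemma fps_scale_power_subst (z : K) f : z ^+ d = 1 -> fps_scale z (iota f) = iota f.
Proof.
move=> zd; apply: fpsP => n; rewrite fps_scaleE power_subst_coef.
case: (boolP (d %| n)%N) => [/dvdnP[m ->]|]; rewrite ?mul0r //.
by rewrite mulnC exprM zd expr1n mulr1.
Qed.

Lemma ord_power_subst f : f != 0 -> ord (iota f) = (d * ord f)%N.
Proof.
move=> f0; have [fo fl] := ordP f0; apply: ord_eq => [|i].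
  by rewrite power_subst_coef dvdn_mulr // mulKn.
rewrite power_subst_coef; case: ifP => // /dvdnP[m ->]; rewrite mulnK // mulnC.
by rewrite ltn_pmul2l //; exact: fl.
Qed.

End PowerSubst.

Section Branch.
Variable K : closedFieldType.
Local Notation O := (fps K).
Local Notation A := (fps (fps K)).

(** Says that y(t) has d distinct conjugates under t -> z t with z^d = 1. *)
Definition primitive_param d (e : A -> O) : Prop :=
  forall z : K, z ^+ d = 1 -> fps_scale z (e (vary K)) = e (vary K) -> z = 1.

(** A parametrization with d minimal is primitive: if some z of order q > 1 fixed y(t), then y would
    be a series in t^q, and t^q would be a parameter with exponent d / q. *)
Lemma primitive_param_exists n F : (0 < n)%N -> tame K n -> yreg n F ->
  exists d (e : {rmorphism A -> O}),
    [/\ (0 < d)%N, d%:R != 0 :> K, param d e, primitive_param d e & e F = 0].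
Proof.
move=> n0 tn Freg.
pose Q d := `[< exists e : {rmorphism A -> O},
  [/\ (0 < d)%N, d%:R != 0 :> K, param d e & e F = 0] >].
have exQ : exists d, Q d.
  by have [d he] := puiseux_root n0 tn Freg; exists d; apply/asboolP.
case: (ex_minnP exQ) => d /asboolP[e [d0 dK he eF]] dmin.
exists d, e; split=> // z zd zy; set phi := e (vary K) in zy.
have [q qz qd] := prim_order_exists d0 zd.
have q0 := prim_order_gt0 qz.
have [iq hiq] := power_subst_exists K q0; have [iqC iqX] := hiq.
have phiE : phi = iq (FPS (fun i => phi (i * q)%N)).
  apply: (power_subst_image q0 hiq) => i phii.
  rewrite (prim_order_dvd qz); have := congr1 (fun f : O => f i) zy.
  rewrite /= fps_scaleE => /eqP; rewrite -subr_eq0 -[X in _ - X]mulr1 -mulrBr.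
  by rewrite mulf_eq0 (negPf phii) subr_eq0.
have dq : d = (q * (d %/ q))%N by rewrite mulnC divnK.
have dq0 : (0 < d %/ q)%N by rewrite divn_gt0 // dvdn_leq.
have [|e' he' e'y] := @param_exists K _ (FPS (fun i => phi (i * q)%N)) dq0.
  by rewrite fpsE mul0n; case: he.
pose e'' : {rmorphism A -> O} := iq \o e'.
have he'' : param d e''.
  split=> [c||].
  - by rewrite -[LHS]/(iq (e' (fps2C c))); case: he' => -> _ _; rewrite iqC.
  - rewrite -[LHS]/(iq (e' (varx K))); case: he' => _ -> _.
    by rewrite rmorphXn iqX -exprM -dq.
  by rewrite -[e'' _]/(iq (e' (vary K))) e'y -phiE; case: he.
have ee'' : e'' =1 e.
  apply: (param_uniq d0) => //.
  by rewrite -[LHS]/(iq (e' (vary K))) e'y -phiE.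
have e'F : e' F = 0.
  apply: (power_subst_inj q0 hiq); rewrite rmorph0 -eF -ee''.
  by [].
have /dmin : Q (d %/ q)%N.
  apply/asboolP; exists e'; split=> //.
  by apply: contraNneq dK => h; rewrite dq natrM h mulr0.
move=> dle; have q1 : q = 1%N.
  apply/eqP; rewrite eqn_leq q0 andbT leqNgt; apply/negP => q2.
  by have := ltn_Pdiv q2 d0; rewrite ltnNge dle.
by have := prim_expr_order qz; rewrite q1 expr1.
Qed.

Lemma prim_root_exists d : (0 < d)%N -> d%:R != 0 :> K ->
  exists z : K, d.-primitive_root z.
Proof.
move=> d0 dK; have [rs rsE] := closed_field_poly_normal ('X^d - 1 : {poly K}).
have lc : lead_coef ('X^d - 1 : {poly K}) = 1.
  by apply/eqP; rewrite -monicE monicXnsubC.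
rewrite lc scale1r in rsE.
have srs : size rs = d.
  by have := congr1 (fun p : {poly K} => size p) rsE;
    rewrite size_XnsubC // size_prod_XsubC => -[].
have urs : uniq rs.
  by rewrite -separable_prod_XsubC -rsE separable_Xn_sub_1.
have := @has_prim_root K d rs d0 _ urs; rewrite srs leqnn.
have ars : all d.-unity_root rs.
  by apply/allP => x xrs; rewrite /root_of_unity rsE root_prod_XsubC.
by move=> /(_ ars isT) /hasP[z _ hz]; exists z.
Qed.

Section Conjugates.
Variables (d : nat) (e : {rmorphism A -> O}) (z : K).
Hypothesis d0 : (0 < d)%N.
Hypothesis he : param d e.
Hypothesis hprim : primitive_param d e.
Hypothesis hz : d.-primitive_root z.

Local Notation iota := (e \o @fpsC O : {rmorphism O -> O}).
Definition conjug a := fps_scale (z ^+ a) (e (vary K)).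
(** The minimal polynomial of y(t) over K[[t^d]], when z is a primitive d-th root of unity and the
    conjugates are distinct. *)
Definition conj_poly : {poly O} := \prod_(a < d) ('X - (conjug a)%:P).

Let hi : power_subst d iota. Proof. exact: param_power_subst. Qed.

Lemma conjug0 : conjug 0 = e (vary K).
Proof. by rewrite /conjug expr0 fps_scale1. Qed.
Lemma conjug_scale a b : fps_scale (z ^+ b) (conjug a) = conjug (a + b).
Proof. by rewrite /conjug fps_scale_mul -exprD addnC. Qed.
Lemma conjug_coef0 a : conjug a 0%N = 0.
Proof. by rewrite /conjug fps_scale_coef0; case: he. Qed.
Lemma conjug_mod a : conjug (a + d) = conjug a.
Proof. by rewrite /conjug exprD (prim_expr_order hz) mulr1. Qed.

Lemma conjug_inj : {in [pred a | a < d]%N &, injective conjug}.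
Proof.
suff H a b : (a < b)%N -> (b < d)%N -> conjug a <> conjug b.
  move=> a b /= ad bd ab; case: (ltngtP a b) => // lt.
    by have := H a b lt bd.
  by have := H b a lt ad; case.
move=> ab bd h; have := congr1 (fps_scale (z ^+ (d - a))) h.
rewrite !conjug_scale subnKC ?(ltnW (ltn_trans ab bd)) //.
rewrite -{1}[d]add0n conjug_mod conjug0.
have -> : (b + (d - a) = (b - a) + d)%N by lia.
rewrite conjug_mod => /esym /hprim; rewrite -exprM mulnC exprM (prim_expr_order hz).
rewrite expr1n => /(_ erefl) /eqP; rewrite -(prim_order_dvd hz) => /dvdn_leq.
by lia.
Qed.

Lemma conj_poly_scale : map_poly (fps_scale z) conj_poly = conj_poly.
Proof.
rewrite /conj_poly rmorph_prod /=.
transitivity (\prod_(a < d) ('X - (conjug a.+1)%:P)).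
  apply: eq_bigr => a _; rewrite rmorphB /= map_polyX map_polyC /=.
  by rewrite -{1}[z]expr1 conjug_scale addn1.
case: d d0 conjug_mod => // d' _ cm.
rewrite -(big_mkord xpredT (fun a => 'X - (conjug a.+1)%:P)).
rewrite -(big_mkord xpredT (fun a => 'X - (conjug a)%:P)).
rewrite big_nat_recr // [RHS]big_nat_recl //= mulrC; congr (_ * _).
by rewrite -[d'.+1]add0n cm.
Qed.

(** The substitution t -> z t permutes the factors, so every coefficient is a series in t^d and
    comes from K[[x]]. *)
Lemma conj_poly_descent : exists G : {poly O}, map_poly iota G = conj_poly.
Proof.
exists (\poly_(j < size conj_poly) FPS (fun i => conj_poly`_j (i * d)%N)).
apply/polyP => j; rewrite coef_map coef_poly; case: ltnP => js; last first.
  by rewrite nth_default //; exact: (rmorph0 iota).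
symmetry; apply: (power_subst_image d0 hi) => n cn.
have := congr1 (fun p : {poly O} => p`_j n) conj_poly_scale.
rewrite /= coef_map /= fps_scaleE => /eqP.
rewrite -subr_eq0 -[X in _ - X]mulr1 -mulrBr mulf_eq0 (negPf cn) /= subr_eq0.
by rewrite -(prim_order_dvd hz).
Qed.

Variable G : {poly O}.
Hypothesis hG : map_poly iota G = conj_poly.

Lemma conj_poly_yreg : yreg d (poly_fps G).
Proof.
have e0 : at_x0 (poly_fps G) = fpsX K ^+ d.
  have -> : fpsX K ^+ d = poly_fps 'X^d by rewrite rmorphXn /= poly_fpsX.
  have <- : map_poly (@const_coef K) conj_poly = 'X^d.
    rewrite /conj_poly rmorph_prod /= -[d in RHS]card_ord -prodr_const.
    apply: eq_bigr => a _; rewrite rmorphB /= map_polyX map_polyC /=.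
    by rewrite [const_coef _]conjug_coef0 subr0.
  apply: fpsP => j; rewrite at_x0E -[RHS]/((map_poly (@const_coef K) conj_poly)`_j).
  rewrite -hG !coef_map /= /const_coef -[LHS]/(G`_j 0%N).
  by symmetry; exact: (power_subst0 _ d0 hi).
by split; rewrite e0 ?ordXn // expf_neq0 // fpsX_neq0.
Qed.

Lemma e_poly p : e (poly_fps p) = (map_poly iota p).[e (vary K)].
Proof. exact: (hom_poly_fps (iota := iota)). Qed.

Lemma poly_conj_roots (r : {poly O}) : e (poly_fps r) = 0 ->
  forall a, root (map_poly iota r) (conjug a).
Proof.
rewrite e_poly => h a; rewrite /root.
have /eqP := congr1 (fps_scale (z ^+ a)) h; rewrite rmorph0 -horner_map /=.
congr (_.[_] == _); rewrite -map_poly_comp; apply: eq_map_poly => c.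
apply: (fps_scale_power_subst d0 hi).
by rewrite -exprM mulnC exprM (prim_expr_order hz) expr1n.
Qed.

(** After division by G the remainder has degree less than d in y; being killed by e, it has all d
    distinct conjugates as roots, so it is zero. *)
Lemma conj_poly_ker h : e h = 0 <-> rdvd (poly_fps G) h.
Proof.
have eG : e (poly_fps G) = 0.
  rewrite e_poly hG /conj_poly horner_prod; case: d d0 => // d' _.
  by rewrite big_ord_recl hornerXsubC /= conjug0 subrr mul0r.
split=> [eh|[c ->]]; last by rewrite rmorphM eG mulr0.
have [q [r [sr hr]]] := weierstrass_remainder conj_poly_yreg h.
have er : e (poly_fps r) = 0.
  by have := eh; rewrite hr rmorphD rmorphM eG mulr0 add0r.
exists q; rewrite hr; suff -> : r = 0 by rewrite rmorph0 addr0.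
apply/eqP; apply: contraT => r0.
have r'0 : map_poly iota r != 0.
  apply: contra r0 => /eqP r'0; apply/eqP/polyP => j.
  apply: (power_subst_inj d0 hi); rewrite coef0 rmorph0.
  by have := congr1 (fun p : {poly O} => p`_j) r'0; rewrite coef_map coef0.
pose rs := [seq conjug a | a <- seq.iota 0 d].
have := @max_poly_roots _ _ rs r'0; rewrite size_map size_iota.
have -> : all (root (map_poly iota r)) rs.
  by apply/allP => x /mapP[a _ ->]; exact: poly_conj_roots.
have -> : uniq rs.
  rewrite map_inj_in_uniq ?iota_uniq // => a b; rewrite !mem_iota !add0n => ad bd.
  exact: conjug_inj.
move=> /(_ isT isT) lt; suff : (d < d)%N by rewrite ltnn.
by apply: (leq_trans lt); rewrite (leq_trans _ sr) // size_poly.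
Qed.

Lemma dery_poly_fps (p : {poly O}) : dery (poly_fps p) = poly_fps p^`().
Proof. by apply: fpsP => j; rewrite !fpsE coef_deriv. Qed.

(** The derivative of a split polynomial at one of its roots; this value generates the different of
    K[[x]][y(t)]. *)
Lemma e_dery_conj_poly :
  e (dery (poly_fps G)) = \prod_(a < d.-1) (conjug 0 - conjug a.+1).
Proof.
rewrite dery_poly_fps e_poly -deriv_map hG /conj_poly -conjug0.
case: d d0 => // d' _ /=; rewrite big_ord_recl derivM derivXsubC mul1r.
rewrite hornerD hornerM hornerXsubC subrr mul0r addr0 horner_prod.
by apply: eq_bigr => a _; rewrite hornerXsubC.
Qed.

Lemma e_dery_neq0 : e (dery (poly_fps G)) != 0.
Proof.
rewrite e_dery_conj_poly; apply/prodf_neq0 => a _; rewrite subr_eq0.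
apply/eqP => /conjug_inj h; suff : 0%N = a.+1 by [].
by apply: h; rewrite inE; have := ltn_ord a; move: d0; clear; case: d a => // n a _ /=.
Qed.

End Conjugates.
End Branch.

(** * The delta invariant of a branch *)

Lemma mulmx_row_change (R : comNzRingType) m n (M M' : 'M[R]_(m, n))
    (u u0 : 'rV_m) (w : 'rV_n) i0 :
  row i0 M' = w -> u0 0 i0 = 0 -> (forall i, i != i0 -> row i M' = row i M) ->
  (forall i, i != i0 -> u0 0 i = u 0 i) ->
  u *m M' = u 0 i0 *: w + u0 *m M.
Proof.
move=> Mw u00 MM uu; rewrite !mulmx_sum_row (bigD1 i0) //= Mw; congr (_ + _).
rewrite [RHS](bigD1 i0) //= u00 scale0r add0r; apply: eq_bigr => i ii0.
by rewrite MM // uu.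
Qed.

Section Lattice.
Variables (K : closedFieldType) (d : nat) (iota : {rmorphism fps K -> fps K}).
Hypothesis d0 : (0 < d)%N.
Hypothesis iotaP : power_subst d iota.
Local Notation O := (fps K).

(* K[[t]] is free over K[[t ^ d]] on the powers of t less than d. *)
Definition lvec (u : 'rV[O]_d) : O := \sum_(k < d) iota (u 0 k) * fpsX K ^+ k.
Definition lattice (M : 'M[O]_d) : set O :=
  [set f | exists u, f = lvec (u *m M)].

Lemma lvecD u v : lvec (u + v) = lvec u + lvec v.
Proof.
by rewrite /lvec -big_split; apply: eq_bigr => k _; rewrite mxE rmorphD mulrDl.
Qed.
Lemma lvecZ a u : lvec (a *: u) = iota a * lvec u.
Proof.
by rewrite /lvec mulr_sumr; apply: eq_bigr => k _; rewrite mxE rmorphM mulrA.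
Qed.
Lemma lvecB u v : lvec (u - v) = lvec u - lvec v.
Proof. by rewrite -scaleN1r lvecD lvecZ rmorphN1 mulN1r. Qed.

Lemma lvec_coef u (k : 'I_d) m : lvec u (m * d + k)%N = u 0 k m.
Proof.
rewrite /lvec fps_sumE (bigD1 k) //= mulrC fpsXnM ltnNge leq_addl /= addnK.
rewrite (power_subst_coef d0 iotaP) dvdn_mull // mulnK // big1 ?addr0 // => j jk.
rewrite mulrC fpsXnM; case: ltnP => // le; rewrite (power_subst_coef d0 iotaP).
case: ifP => // /dvdnP[q hq]; case/negP: jk; rewrite -val_eqE; apply/eqP => /=.
have e : (m * d + k = q * d + j)%N by rewrite -hq subnK.
have := congr1 (modn^~ d) e; rewrite !modnMDl !modn_small //.
Qed.
Lemma lvec_inj : injective lvec.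
Proof.
move=> u v uv; apply/rowP => k; apply: fpsP => m.
by rewrite -!lvec_coef uv.
Qed.
Lemma lvec_surj f : exists u, lvec u = f.
Proof.
exists (\row_(k < d) FPS (fun m => f (m * d + k)%N)).
apply: fpsP => n; rewrite (divn_eq n d).
rewrite -[(n %% d)%N]/(nat_of_ord (Ordinal (ltn_pmod n d0))) lvec_coef mxE.
by rewrite fpsE.
Qed.

Local Notation Kmod := (algmod (@fpsC K)).

Lemma lattice_submod M : submod (lattice M : set Kmod).
Proof.
split=> [|a _ _ [u ->] [v ->]].
  by exists 0; rewrite mul0mx -(subrr (0 : 'rV[O]_d)) lvecB subrr.
exists (fpsC a *: u + v); rewrite mulmxDl lvecD -scalemxAl lvecZ.
by case: iotaP => -> _.
Qed.

Section Step.
Variables (M : 'M[O]_d) (v : 'rV[K]_d) (i0 : 'I_d).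
Hypothesis v0 : v 0 i0 != 0.
Hypothesis vM : v *m map_mx (@const_coef K) M = 0.
Hypothesis dM : \det M != 0.

Let v' := map_mx (@fpsC K) v.
Let w := map_mx (fps_drop 1) (v' *m M).
Let M' : 'M[O]_d := \matrix_(i, j) if i == i0 then w 0 j else M i j.
(** The row operation replacing row [i0] of M by v M = X w. Its determinant is the unit v_i0, and
    the factor X is collected in the diagonal matrix [Dg]. *)
Let E : 'M[O]_d := \matrix_(i, j) if i == i0 then v' 0 j else (i == j)%:R.

Let wE : v' *m M = fpsX K *: w.
Proof.
apply/rowP => j; rewrite [RHS]mxE [w 0 j]mxE.
have := congr1 (fun u : 'rV[K]_d => u 0 j) vM; rewrite /= [RHS]mxE => h.
rewrite -[fpsX K]expr1; apply: fps_drop0 => -[|//] _; rewrite -h !mxE fps_sumE.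
by apply: eq_bigr => k _; rewrite !mxE fpsM0 fpsCE eqxx.
Qed.

Let detE : \det E = fpsC (v 0 i0).
Proof.
have cE j : cofactor E i0 j = (j == i0)%:R.
  have -> : cofactor E i0 j = cofactor (1%:M : 'M[O]_d) i0 j.
    rewrite /cofactor; congr (_ * \det _); apply/matrixP => a b; rewrite !mxE.
    by rewrite eq_sym (negPf (neq_lift _ _)).
  have := congr1 (fun B : 'M[O]_d => B j i0) (adj1 O d).
  by rewrite /= !mxE.
rewrite (expand_det_row _ i0) (bigD1 i0) //= big1 => [|j ji].
  by rewrite cE eqxx mulr1 addr0 !mxE eqxx.
by rewrite cE (negPf ji) mulr0.
Qed.

Let Dg : 'rV[O]_d := \row_i if i == i0 then fpsX K else 1.

Let EM : E *m M = diag_mx Dg *m M'.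
Proof.
apply/matrixP => i j; rewrite mul_diag_mx [LHS]mxE [RHS]mxE [Dg 0 i]mxE [M' i j]mxE.
case: (eqVneq i i0) => [->|ii0].
  have := congr1 (fun u : 'rV[O]_d => u 0 j) wE; rewrite /= [RHS]mxE => <-.
  by rewrite mxE; apply: eq_bigr => k _; rewrite [E _ _]mxE eqxx.
rewrite mul1r (bigD1 i) //= big1 => [|k ki].
  by rewrite mxE (negPf ii0) eqxx mul1r addr0.
by rewrite mxE (negPf ii0) eq_sym (negPf ki) mul0r.
Qed.

(* If v M vanishes at 0, replacing the row i0 of M by v M / X enlarges the lattice
   by one dimension and divides the determinant by X, up to a unit. *)
Lemma lattice_step : exists M1 : 'M[O]_d,
  [/\ \det M1 != 0, ord (\det M) = (ord (\det M1)).+1,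
      (lattice M `<=` lattice M1)%classic
    & adim (@fpsC K) (lattice M1) (lattice M) 1].
Proof.
have dE : fpsC (v 0 i0) * \det M = fpsX K * \det M'.
  rewrite -detE -det_mulmx EM det_mulmx det_diag; congr (_ * _).
  rewrite (bigD1 i0) //= mxE eqxx big1 ?mulr1 // => i ii0.
  by rewrite mxE (negPf ii0).
have C0 : fpsC (v 0 i0) != 0 :> O by rewrite fmorph_eq0.
have lhs0 : fpsC (v 0 i0) * \det M != 0 by rewrite mulf_neq0.
have dM' : \det M' != 0 by apply: contraNneq lhs0 => h; rewrite dE h mulr0.
exists M'; split=> //.
- have := congr1 (@ord K) dE; rewrite !ordM ?fpsX_neq0 // ord_fpsC add0n => ->.
  by rewrite -[fpsX K]expr1 ordXn.
- have uE : E \in unitmx.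
    by rewrite unitmxE detE fps_unitE fpsCE eqxx unitfE.
  move=> f [u ->]; exists (u *m invmx E *m diag_mx Dg).
  by rewrite -mulmxA -EM mulmxA mulmxKV.
exists (fun=> lvec w); split=> [_|f [u ->]|c].
- exists (delta_mx 0 i0); rewrite -rowE; congr lvec; apply/rowP => j.
  by rewrite !mxE eqxx.
- exists (fun=> u 0 i0 0%N).
  pose u0 : 'rV[O]_d := \row_i if i == i0 then 0 else u 0 i.
  exists (fps_drop 1 (u 0 i0) *: v' + u0).
  have uM' : u *m M' = u 0 i0 *: w + u0 *m M.
    apply: mulmx_row_change => [||i ii0|i ii0].
    - by apply/rowP => j; rewrite mxE [M' _ _]mxE eqxx.
    - by rewrite mxE eqxx.
    - by apply/rowP => j; rewrite [LHS]mxE [RHS]mxE [M' _ _]mxE (negPf ii0).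
    - by rewrite mxE (negPf ii0).
  rewrite big_ord1 algmodZE mulmxDl -scalemxAl wE uM' {1}(fps_split0 (u 0 i0)).
  set c := fpsC (u 0 i0 0%N).
  have cE : c * lvec w = lvec (c *: w) by rewrite lvecZ; case: iotaP => ->.
  rewrite -[X in _ - X]/(c * lvec w) cE -lvecB; congr lvec.
  by rewrite scalerDl scalerA [fps_drop _ _ * _]mulrC [LHS]addrC !addrA addNr add0r.
rewrite big_ord1 algmodZE => -[r]; set a := c ord0.
have aE : fpsC a * lvec w = lvec (fpsC a *: w) by rewrite lvecZ; case: iotaP => ->.
rewrite -[LHS]/(fpsC a * lvec w) aE => /lvec_inj awE [[|//] i].
rewrite (_ : Ordinal _ = ord0) -/a; last exact: val_inj.
(* Since det M is nonzero, a v = X r; the constant term at [i0] gives a v_i0 = 0. *)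
have : (fpsC a *: v' - fpsX K *: r) *m M = 0.
  by rewrite mulmxBl -!scalemxAl wE -awE !scalerA mulrC subrr.
move/(congr1 (mulmx^~ (\adj M))); rewrite mul0mx -mulmxA mul_mx_adj mul_mx_scalar.
move/rowP/(_ i0); rewrite !mxE => /eqP; rewrite mulf_eq0 (negPf dM) /= => /eqP h.
have := congr1 (fun f : O => f 0%N) h.
rewrite /= fpsBE fpsXM0 subr0 fpsCM fpsCE eqxx fps0E => /eqP.
by rewrite mulf_eq0 (negPf v0) orbF => /eqP.
Qed.

End Step.

(** Induction on the order of det M. Order 0 means that M is invertible; otherwise M(0) is singular,
    and a kernel vector feeds [lattice_step], which lowers the order by one at the cost of one
    dimension. *)
Lemma lattice_codim M : \det M != 0 ->
  adim (@fpsC K) setT (lattice M) (ord (\det M)).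
Proof.
move En : (ord (\det M)) => n; elim: n M En => [|n IH] M En dM.
  apply: hasdim0 => f _; have [u <-] := lvec_surj f.
  exists (u *m invmx M); rewrite mulmxKV //.
  by rewrite unitmxE fps_unitE unitfE -En; case: (ordP dM).
have : \det (map_mx (@const_coef K) M) == 0.
  by rewrite det_map_mx; apply/eqP; have [_] := ordP dM; apply; rewrite En.
case/det0P => v v0 vM.
have [i0 vi0] : exists i0, v 0 i0 != 0.
  apply/not_existsP => h; case/eqP: v0; apply/rowP => i; rewrite mxE.
  by apply/eqP/negPn/negP => /h.
have [M1 [dM1 oM MM1 dim1]] := lattice_step vi0 vM dM.
rewrite -addn1; apply: (@hasdim_chain K Kmod setT (lattice M1) (lattice M)) => //.
- exact: lattice_submod.
- exact: lattice_submod.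
by apply: IH => //; apply: succn_inj; rewrite -oM.
Qed.

End Lattice.

(** * Dedekind's formula for a branch *)

Section BranchDelta.
Variable K : closedFieldType.
Local Notation O := (fps K).
Local Notation A := (fps (fps K)).

Lemma ord_fps_scale (z : K) f : z != 0 -> ord (fps_scale z f) = ord f.
Proof.
move=> z0; case: (eqVneq f 0) => [->|f0]; first by rewrite rmorph0.
have [fo fl] := ordP f0; apply: ord_eq => [|i /fl fi]; rewrite fps_scaleE.
  by rewrite mulf_neq0 // expf_neq0.
by rewrite fi mul0r.
Qed.

(** Up to sign, the squared Vandermonde determinant is the product of c_j - c_i over all ordered
    pairs of distinct indices. The substitution t -> z^b t preserves orders and translates indices,
    so every i contributes the same sum as i = 0. This is applied to the conjugates of y(t) and to
    those of t. *)
Lemma prod_conj_ord d (z : K) (c : nat -> O) : d.+1.-primitive_root z ->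
  (forall a b, fps_scale (z ^+ b) (c a) = c (a + b)%N) ->
  (forall a, c (a + d.+1)%N = c a) ->
  (forall i j : 'I_d.+1, i != j -> c i != c j) ->
  (2 * ord (\det (Vandermonde d.+1 (\row_(a < d.+1) c a)))%R =
   d.+1 * ord (\prod_(a < d) (c 0%N - c a.+1))%R)%N /\
  \det (Vandermonde d.+1 (\row_(a < d.+1) c a)) != 0.
Proof.
move=> zp cS cm cinj.
have z0 : z != 0.
  apply: contraNneq (oner_neq0 K) => z0; rewrite -(prim_expr_order zp) z0.
  by rewrite expr0n.
have cmod a b : a = b %[mod d.+1] -> c a = c b.
  have cM k m : c (m * d.+1 + k)%N = c k.
    elim: m => [|m IH]; first by rewrite mul0n.
    by rewrite mulSn -addnA addnC cm.
  by move=> ab; rewrite (divn_eq a d.+1) (divn_eq b d.+1) !cM ab.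
pose o (i j : 'I_d.+1) := ord (c j - c i).
have oC i j : o i j = o j i.
  by rewrite /o -ordN opprB.
have ne (i j : 'I_d.+1) : i != j -> c j - c i != 0.
  by move=> ij; rewrite subr_eq0 cinj // eq_sym.
have sum_o i : (\sum_(j | j != i) o i j = \sum_(k | k != ord0) o ord0 k)%N.
  rewrite (reindex_inj (addrI i)); apply: eq_big => [k|k _].
    by rewrite -subr_eq0 addrC addKr.
  rewrite /o; have -> : c (i + k)%R = c (k + i)%N.
    by apply: cmod; rewrite /= modn_mod addnC.
  rewrite -[X in c X - _]/((k + i)%N) -cS -[X in _ - c X]add0n -cS -rmorphB.
  by rewrite ord_fps_scale // expf_neq0.
have dE : \det (Vandermonde d.+1 (\row_(a < d.+1) c a)) =
    \prod_(i < d.+1) \prod_(j < d.+1 | (i < j)%N) (c j - c i).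
  by rewrite det_Vandermonde; apply: eq_bigr => i _; apply: eq_bigr => j _; rewrite !mxE.
have lt_ne (i j : 'I_d.+1) : (i < j)%N -> i != j.
  by move=> ij; rewrite -val_eqE ltn_eqF.
split; last first.
  by rewrite dE; apply/prodf_neq0 => i _; apply/prodf_neq0 => j /lt_ne /ne.
have -> : ord (\det (Vandermonde d.+1 (\row_(a < d.+1) c a)))%R =
    (\sum_(i < d.+1) \sum_(j < d.+1 | (i < j)%N) o i j)%N.
  rewrite dE ord_prod => [|i _]; last by apply/prodf_neq0 => j /lt_ne /ne.
  by apply: eq_bigr => i _; rewrite ord_prod // => j /lt_ne /ne.
have -> : ord (\prod_(a < d) (c 0%N - c a.+1))%R = (\sum_(k | k != ord0) o ord0 k)%N.
  rewrite ord_prod => [|a _].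
    rewrite [RHS]big_mkcond [RHS]big_ord_recl /= add0n; apply: eq_bigr => a _.
    by rewrite oC.
  by have := ne (lift ord0 a) ord0; rewrite /= => ->.
have -> : (d.+1 * \sum_(k : 'I_d.+1 | k != ord0) o ord0 k =
    \sum_(i < d.+1) \sum_(j < d.+1 | j != i) o i j)%N.
  under [RHS]eq_bigr do rewrite sum_o.
  by rewrite sum_nat_const card_ord.
have -> : (\sum_(i < d.+1) \sum_(j < d.+1 | j != i) o i j =
   \sum_(i < d.+1) \sum_(j < d.+1 | (i < j)%N) o i j +
   \sum_(i < d.+1) \sum_(j < d.+1 | (j < i)%N) o i j)%N.
  rewrite -big_split; apply: eq_bigr => i _.
  rewrite (bigID (fun j : 'I_d.+1 => (i < j)%N)) /=; congr addn; apply: eq_bigl => j.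
    by rewrite andbC -val_eqE /=; case: ltngtP.
  by rewrite -val_eqE /=; case: ltngtP.
rewrite mul2n -addnn; congr addn.
rewrite [RHS](exchange_big_dep xpredT) //=; apply: eq_bigr => i _.
by apply: eq_bigr => j _; rewrite oC.
Qed.

(* The parametrization of an irreducible factor G of degree d in y, together
   with Dedekind's formula relating its delta invariant to the different. *)
Definition branch d (G : A) (e : {rmorphism A -> O}) (delta : nat) : Prop :=
  [/\ [/\ (0 < d)%N, d%:R != 0 :> K & param d e],
      yreg d G, forall h, e h = 0 <-> rdvd G h,
      adim (@fpsC K) setT (range e) delta
    & e (dery G) != 0 /\ ord (e (dery G)) = (2 * delta + d.-1)%N].

Lemma branch_exists n F : (0 < n)%N -> tame K n -> yreg n F ->
  exists d G e delta, branch d G e delta /\ e F = 0.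
Proof.
move=> n0 tn Freg.
have [d [e [d0 dK he hp eF]]] := primitive_param_exists n0 tn Freg.
have [z hz] := prim_root_exists d0 dK.
have [G hG] := conj_poly_descent d0 he hz.
pose iota : {rmorphism O -> O} := e \o @fpsC O.
have hi : power_subst d iota := param_power_subst he.
have [iC iX] := hi.
have /choice [Mr hM] (j : 'I_d) : exists u : 'rV[O]_d, lvec iota u = e (vary K) ^+ j.
  exact: lvec_surj.
pose M := \matrix_(j, k) Mr j 0 k.
have rM j : row j M = Mr j by apply/rowP => k; rewrite !mxE.
have lvM u : lvec iota (u *m M) = \sum_j iota (u 0 j) * e (vary K) ^+ j.
  rewrite mulmx_sum_row (big_morph _ (lvecD iota) (_ : lvec iota 0 = 0)).
    by apply: eq_bigr => j _; rewrite lvecZ rM hM.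
  by rewrite -(subrr 0) lvecB subrr.
(* By division by G, modulo the kernel of e every series is a polynomial of degree less than d in y,
   so the image of e is the K[[x]]-span of the powers of y(t) below d. *)
have range_lattice f : lattice iota M f <-> range e f.
  split=> [[u ->]|[h _ <-]].
    exists (poly_fps (\sum_(j < d) (u 0 j)%:P * 'X^j)) => //.
    rewrite lvM rmorph_sum rmorph_sum; apply: eq_bigr => j _.
    by rewrite !rmorphM !rmorphXn /= poly_fpsC poly_fpsX.
  have [q [r [sr hr]]] := weierstrass_remainder (conj_poly_yreg d0 he hG) h.
  exists (\row_j r`_j); rewrite lvM hr rmorphD rmorphM.
  have -> : e (poly_fps G) = 0.
    by apply/(conj_poly_ker d0 he hp hz hG); exists 1; rewrite mul1r.
  rewrite mulr0 add0r (e_poly e) /map_poly horner_poly.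
  rewrite -(big_mkord xpredT (fun j => iota (r`_j) * e (vary K) ^+ j)).
  rewrite (big_nat_widen _ _ _ _ _ sr) big_mkcond big_mkord.
  apply: eq_bigr => j _; rewrite mxE /=; case: ltnP => // h'.
  by rewrite nth_default // -[e (fpsC 0)]/(iota 0) rmorph0 mul0r.
(* From here on [d] is the degree minus one. *)
case: d d0 dK he hp hz hG hi iX Mr hM M rM lvM range_lattice => // d d0 dK he hp hz
  hG hi iX Mr hM M rM lvM range_lattice.
have [Vord V0] : (2 * ord (\det (Vandermonde d.+1 (\row_(a < d.+1) conjug e z a)))%R =
   d.+1 * ord (\prod_(a < d) (conjug e z 0%N - conjug e z a.+1))%R)%N /\
   \det (Vandermonde d.+1 (\row_(a < d.+1) conjug e z a)) != 0.
  apply: (prod_conj_ord hz) => [a b|a|i j].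
  - exact: conjug_scale.
  - exact: conjug_mod.
  apply: contra => /eqP /(conjug_inj d0 hp hz) h; apply/eqP/val_inj/h.
    by rewrite inE.
  by rewrite inE.
pose cX a := fps_scale (z ^+ a) (fpsX K).
have cXE a : cX a = fpsC (z ^+ a) * fpsX K.
  apply: fpsP => n'; rewrite fps_scaleE fpsCM fpsXE; case: (eqVneq n' 1%N) => [->|_].
    by rewrite mul1r mulr1 expr1.
  by rewrite mul0r mulr0.
have [Dord D0] : (2 * ord (\det (Vandermonde d.+1 (\row_(a < d.+1) cX a)))%R =
   d.+1 * ord (\prod_(a < d) (cX 0%N - cX a.+1))%R)%N /\
   \det (Vandermonde d.+1 (\row_(a < d.+1) cX a)) != 0.
  apply: (prod_conj_ord hz) => [a b|a|i j ij].
  - by rewrite /cX fps_scale_mul -exprD addnC.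
  - by rewrite /cX exprD (prim_expr_order hz) mulr1.
  apply: contra ij => /eqP h.
  have := congr1 (fun f : O => f 1%N) h; rewrite /= !fps_scaleE fpsXE !mul1r !expr1.
  move=> /eqP; rewrite (eq_prim_root_expr hz) => /eqP.
  by rewrite !modn_small // => e'; apply/eqP/val_inj.
have VMD : Vandermonde d.+1 (\row_(a < d.+1) conjug e z a) =
    map_mx iota M *m Vandermonde d.+1 (\row_(a < d.+1) cX a).
  apply/matrixP => j a; rewrite !mxE /conjug -rmorphXn -hM /lvec rmorph_sum.
  apply: eq_bigr => k _; rewrite !mxE rmorphM rmorphXn; congr (_ * _).
  have -> : M j k = Mr j 0 k by rewrite -rM mxE.
  apply: (fps_scale_power_subst d0 hi).
  by rewrite -exprM mulnC exprM (prim_expr_order hz) expr1n.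
have dV := congr1 determinant VMD; rewrite det_mulmx det_map_mx in dV.
have iM0 : iota (\det M) != 0 by apply: contraNneq V0 => h; rewrite dV h mul0r.
have M0 : \det M != 0 by apply: contraNneq iM0 => ->; rewrite rmorph0.
have oV := congr1 (@ord K) dV; rewrite ordM // (ord_power_subst d0 hi M0) in oV.
have oD : ord (\prod_(a < d) (cX 0%N - cX a.+1))%R = d.
  rewrite ord_prod => [|a _].
    rewrite -[RHS](card_ord d) -sum1_card; apply: eq_bigr => a _.
    rewrite !cXE -mulrBl -rmorphB ordM ?fpsX_neq0 //.
      by rewrite ord_fpsC -[fpsX K]expr1 ordXn.
    rewrite fmorph_eq0 subr_eq0 (eq_prim_root_expr hz) mod0n modn_small //.
    by rewrite ltnS.
  rewrite !cXE -mulrBl -rmorphB mulf_neq0 ?fpsX_neq0 //.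
  rewrite fmorph_eq0 subr_eq0 (eq_prim_root_expr hz) mod0n modn_small //.
  by rewrite ltnS.
exists d.+1, (poly_fps G), e, (ord (\det M)); split=> //; split=> //.
- exact: (conj_poly_yreg d0 he hG).
- by move=> h; exact: (conj_poly_ker d0 he hp hz hG).
- apply: (@hasdim_ext K (algmod (@fpsC K)) setT (lattice iota M)) => //.
  exact: lattice_codim.
split; first exact: (e_dery_neq0 d0 hp hz hG).
(* Doubling the orders in the determinant identity: [iota] multiplies the order of det M by d + 1,
   and the Vandermonde determinant of t has doubled order (d + 1) d. The common factor d + 1
   cancels. *)
rewrite (e_dery_conj_poly d0 hG) /=.
have : (d.+1 * ord (\prod_(a < d) (conjug e z 0%N - conjug e z a.+1))%R =
  d.+1 * (2 * ord (\det M)%R + d))%N.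
  by rewrite -Vord oV mulnDr Dord oD; lia.
by move/eqP; rewrite eqn_pmul2l // => /eqP.
Qed.

End BranchDelta.

(** * Intersection numbers *)

Section Ideals.
Variable R : comNzRingType.

Lemma ideal2P (f g a : R) :
  ideal [set f; g]%classic a <-> exists u v, a = u * f + v * g.
Proof.
split=> [[n [c [s [sfg ->]]]]|[u [v ->]]]; last first.
  exists 2%N, (fun i => if i == ord0 then u else v),
    (fun i => if i == ord0 then f else g); split; last by rewrite big_ord_recl big_ord1.
  by move=> i; case: eqP; [left|right].
elim/big_rec: _ => [|i x _ [u [v ->]]]; first by exists 0, 0; rewrite !mul0r addr0.
case: (sfg i) => ->; first by exists (c i + u), v; ring.
by exists u, (c i + v); ring.
Qed.

Lemma ideal2_sub (f g f' g' a : R) : (exists u v, f = u * f' + v * g') ->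
  (exists u v, g = u * f' + v * g') ->
  ideal [set f; g]%classic a -> ideal [set f'; g']%classic a.
Proof.
move=> [u [v ->]] [u' [v' ->]] /ideal2P[w [w' ->]]; apply/ideal2P.
by exists (w * u + w' * u'), (w * v + w' * v'); ring.
Qed.

End Ideals.

Section Intersection.
Variable K : closedFieldType.
Local Notation O := (fps K).
Local Notation A := (fps (fps K)).
Local Notation OK := (algmod (@fpsC K)).
Local Notation AK := (algmod (@fps2C K)).

Definition idim (f g : A) n := adim (@fps2C K) setT (ideal [set f; g]%classic) n.

Lemma ideal2_submod (f g : A) : submod (ideal [set f; g]%classic : set AK).
Proof.
split=> [|a x y /ideal2P[u [v ->]] /ideal2P[u' [v' ->]]]; apply/ideal2P.
  by exists 0, 0; rewrite !mul0r addr0.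
exists (fps2C a * u + u'), (fps2C a * v + v').
by rewrite -[_ *: _]/(fps2C a * (u * f + v * g)); ring.
Qed.

Lemma idim_uniq f g m n : idim f g m -> idim f g n -> m = n.
Proof. exact: (hasdim_uniq (ideal2_submod f g)). Qed.
Lemma inter_idim f g n : idim f g n -> inter f g = n%:Z%:E.
Proof. by apply: dim_mod_eq; exact: ideal2_submod. Qed.
Lemma idim_inter f g : inter f g != +oo%E -> exists n, idim f g n.
Proof. exact: dim_mod_fin. Qed.
Lemma idim_ideal f g f' g' n :
  (forall a, ideal [set f; g]%classic a <-> ideal [set f'; g']%classic a) ->
  idim f g n -> idim f' g' n.
Proof. by move=> h; apply: hasdim_ext. Qed.
Lemma idimC f g n : idim f g n -> idim g f n.
Proof.
apply: idim_ideal => a; split=> /ideal2P[u [v ->]]; apply/ideal2P;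
  by exists v, u; rewrite addrC.
Qed.
Lemma idim_unit u f g n : u \is a GRing.unit -> idim f g n -> idim (u * f) g n.
Proof.
move=> uU; apply: idim_ideal => a; split; apply: ideal2_sub.
- by exists u^-1, 0; rewrite mulKr // mul0r addr0.
- by exists 0, 1; rewrite mul0r mul1r add0r.
- by exists u, 0; rewrite mul0r addr0.
- by exists 0, 1; rewrite mul0r mul1r add0r.
Qed.
Lemma idim_modl f g c n : idim f g n -> idim f (g + c * f) n.
Proof.
apply: idim_ideal => a; split; apply: ideal2_sub.
- by exists 1, 0; ring.
- by exists (- c), 1; ring.
- by exists 1, 0; ring.
- by exists c, 1; ring.
Qed.
Lemma idim1 f : idim 1 f 0.
Proof.
apply: hasdim0 => a _; apply/ideal2P; exists a, 0.
by rewrite mulr1 mul0r addr0.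
Qed.

Lemma principal_codim (g : O) : g != 0 ->
  adim (@fpsC K) setT [set f | exists b, f = g * b]%classic (ord g).
Proof.
move=> g0; have [go gl] := ordP g0.
pose w := fps_drop (ord g) g.
have gE : g = fpsX K ^+ ord g * w by exact: fps_drop0.
have wU : w \is a GRing.unit by rewrite fps_unitE unitfE fps_dropE addn0.
have sumE (c : 'I_(ord g) -> K) (f : O) : f - \sum_i (c i *: (fpsX K ^+ i : OK)) =
    f - \sum_(i < ord g) fpsC (c i) * fpsX K ^+ i.
  by [].
exists (fun i => fpsX K ^+ i); split=> [//|f _|c].
  exists (fun i => f i); rewrite sumE -fps_takeE.
  exists (w^-1 * fps_drop (ord g) f).
  rewrite {1}(fps_take_drop (ord g) f) [X in X - _]addrC addrK.
  suff gw : g * w^-1 = fpsX K ^+ ord g by rewrite mulrA gw.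
  by apply: (mulIr wU); rewrite divrK.
move=> [b hb] i.
have hb' : \sum_(i < ord g) fpsC (c i) * fpsX K ^+ i = fpsX K ^+ ord g * (w * b).
  by rewrite mulrA -gE; exact: hb.
have := congr1 (fun h : O => h i) hb'; rewrite /= fpsXnM ltn_ord.
rewrite fps_sumE (bigD1 i) //= fpsCM fpsXnE eqxx mulr1 big1 ?addr0 // => j ji.
rewrite fpsCM fpsXnE; move: ji; rewrite -val_eqE /= eq_sym => /negPf ->.
by rewrite mulr0.
Qed.

Lemma range_submod (e : {rmorphism A -> O}) : (forall c, e (fps2C c) = fpsC c) ->
  submod (range e : set OK).
Proof.
move=> eC; split=> [|a _ _ [u _ <-] [v _ <-]]; first by exists 0; rewrite ?rmorph0.
by exists (fps2C a * u + v); rewrite // rmorphD rmorphM eC.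
Qed.

(* Compare the chains K[[t]] > h K[[t]] > h R and K[[t]] > R > h R, where R is
   the range of e. *)
Lemma branch_idim d G e delta h : branch d G e delta -> e h != 0 ->
  idim G h (ord (e h)).
Proof.
move=> [[d0 dK [eC ex ey]] Greg eker eR _] eh0.
pose hB : set OK := [set f | exists b, f = e h * b]%classic.
pose hR : set OK := [set f | exists a, f = e h * e a]%classic.
have sT : submod (setT : set OK) by split.
have shB : submod hB.
  split=> [|a _ _ [u ->] [v ->]]; first by exists 0; rewrite mulr0.
  exists (fpsC a * u + v); rewrite -[_ *: _]/(fpsC a * (e h * u)); ring.
have shR : submod hR.
  split=> [|a _ _ [u ->] [v ->]]; first by exists 0; rewrite rmorph0 mulr0.
  exists (fps2C a * u + v); rewrite -[_ *: _]/(fpsC a * (e h * e u)).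
  by rewrite rmorphD rmorphM eC; ring.
have sR := range_submod eC.
have dB : hasdim setT hB (ord (e h)) by exact: principal_codim.
have dhR : hasdim hB hR delta.
  apply: (@hasdim_transport K OK OK (fun v => e h * v) setT (range e)) eR => //.
  - move=> a u v; rewrite -[LHS]/(e h * (fpsC a * (u : O) + (v : O))).
    by rewrite -[RHS]/(fpsC a * (e h * (u : O)) + e h * (v : O)); ring.
  - by move=> v _; exists v.
  - move=> v _; split=> [[a _ <-]|[a]]; first by exists a.
    by move/(mulfI eh0) => ->; exists a.
  - by move=> _ [b ->]; exists b => //; exists 0; rewrite subrr rmorph0 mulr0.
have dhR' : hasdim setT hR (ord (e h) + delta).
  apply: (@hasdim_chain K OK setT hB hR) => //.
  by move=> _ [a ->]; exists (e a).
have [|//|l dRhR] := @hasdim_sub K OK setT (range e) hR _ _ sT sR shR _ _ eR dhR'.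
  by move=> _ [a ->]; exists (h * a); rewrite ?rmorphM.
rewrite addnC => /addnI ->.
apply: (@hasdim_transport_inv K AK OK e _ _ (range e) hR) dRhR => //.
- by move=> a u v; rewrite rmorphD -[a *: u]/(fps2C a * u) rmorphM eC.
- move=> v _; split=> [/ideal2P[u [w ->]]|[a ea]].
    exists w; rewrite rmorphD !rmorphM mulrC.
    have -> : e G = 0 by apply/eker; exists 1; rewrite mul1r.
    by rewrite mul0r add0r mulrC.
  have /eker [c hc] : e (v - h * a) = 0 by rewrite rmorphB rmorphM ea subrr.
  by apply/ideal2P; exists c, a; rewrite -hc; ring.
- by move=> _ [v _ <-]; exists v => //; exists 0; rewrite subrr rmorph0 mulr0.
Qed.

(** Multiplication by G identifies A / (Q, h) with (G, h) / (G Q, h), and A / (G, h) remains.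
    Injectivity is where e h <> 0 enters: G divides w h only if it divides w. *)
Lemma idim_mul (G Q h : A) (e : {rmorphism A -> O}) a b : G != 0 ->
  (forall h, e h = 0 <-> rdvd G h) -> e h != 0 ->
  idim G h a -> idim Q h b -> idim (G * Q) h (a + b).
Proof.
move=> G0 eker eh0 dG dQ.
apply: (@hasdim_chain K AK setT (ideal [set G; h]%classic)) dG _ => //;
  try exact: ideal2_submod.
  by move=> x /ideal2P[u [v ->]]; apply/ideal2P; exists (u * Q), v; ring.
apply: (@hasdim_transport K AK AK (fun v => G * v) _ _ _ _ _ _ _ _ _ _ _ dQ) => //;
  try exact: ideal2_submod.
- move=> c u v; rewrite -[LHS]/(G * (fps2C c * (u : A) + (v : A))).
  by rewrite -[RHS]/(fps2C c * (G * (u : A)) + G * (v : A)); ring.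
- by move=> v _; apply/ideal2P; exists v, 0; ring.
- move=> v _; split=> /ideal2P[u [w e']]; apply/ideal2P.
    by exists u, (G * w); rewrite e'; ring.
  have : e (w * h) = 0.
    have -> : w * h = (v - u * Q) * G by rewrite mulrBl [v * G]mulrC e'; ring.
    by apply/eker; exists (v - u * Q).
  move/eqP; rewrite rmorphM mulf_eq0 (negPf eh0) orbF => /eqP /eker [w' w'E].
  by exists u, w'; apply: (mulfI G0); rewrite e' w'E; ring.
- move=> _ /ideal2P[u [v ->]]; exists u => //; apply/ideal2P; exists 0, v; ring.
Qed.

(** The powers of x stay independent modulo (F, h): e kills both generators and sends x^i to t^(d
    i). *)
Lemma idim_no_common_branch d G e delta F h n : branch d G e delta ->
  rdvd G F -> e h = 0 -> ~ idim F h n.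
Proof.
move=> [[d0 dK [eC ex ey]] Greg eker eR _] GF eh hd.
suff : (n.+1 <= n)%N by rewrite ltnn.
apply: (hasdim_ge (b' := fun i : 'I_n.+1 => varx K ^+ i : AK) _ hd) => //.
  exact: ideal2_submod.
move=> c /ideal2P[u [v huv]] i.
have e0 : e (\sum_(i < n.+1) fps2C (c i) * varx K ^+ i) = 0.
  rewrite [X in e X]huv rmorphD !rmorphM eh mulr0 addr0.
  by have /eker -> := GF; rewrite mulr0.
have := congr1 (fun f : O => f (d * i)%N) e0; rewrite /= fps0E rmorph_sum fps_sumE.
under eq_bigr => j _ do rewrite rmorphM rmorphXn eC ex -exprM fpsCM fpsXnE.
rewrite (bigD1 i) //= eqxx mulr1 big1 ?addr0 // => j ji.
rewrite eqn_pmul2l //; move: ji; rewrite -val_eqE /= eq_sym => /negPf ->.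
by rewrite mulr0.
Qed.

Record Branch := MkBranch {
  bdeg : nat; bpoly : A; bhom : {rmorphism A -> O}; bdelta : nat;
  branchP : branch bdeg bpoly bhom bdelta }.

Lemma bpoly_neq0 (B : Branch) : bpoly B != 0.
Proof. by case: (branchP B) => _ /yreg_neq0. Qed.
Lemma bhomP (B : Branch) h : bhom B h = 0 <-> rdvd (bpoly B) h.
Proof. by case: (branchP B) => _ _ ->. Qed.
Lemma bhom_idim (B : Branch) h : bhom B h != 0 -> idim (bpoly B) h (ord (bhom B h)).
Proof. exact: (branch_idim (branchP B)). Qed.

(** Each branch given by [branch_exists] divides F, and the cofactor has its order in y lowered by
    the degree of the branch; order 0 means a unit. *)
Lemma branch_factorization n F : tame K n -> yreg n F ->
  exists (s : seq Branch) u, [/\ u \is a GRing.unit,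
    F = u * \prod_(B <- s) bpoly B & (\sum_(B <- s) bdeg B)%N = n].
Proof.
elim/ltn_ind: n F => n IH F tn Freg; case: (posnP n) => [n0|n0].
  exists [::], F; rewrite !big_nil mulr1 n0; split=> //.
  by apply/yreg0; rewrite -n0.
have [d [G [e [delta [hB eF]]]]] := branch_exists n0 tn Freg.
have [[d0 _ _] Greg eker _ _] := hB.
have /eker [Q QE] := eF.
have [dn Qreg] : (d <= n)%N /\ yreg (n - d) Q.
  by apply: (yreg_factor Greg); rewrite mulrC -QE.
have [||s [u [uU QE' sE]]] := IH (n - d)%N _ Q _ Qreg.
- by rewrite ltn_subrL d0.
- by move=> k /andP[k0 kn]; apply: tn; rewrite k0 (leq_trans kn) // leq_subr.
exists (MkBranch hB :: s), u; split=> //; rewrite big_cons /=.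
  by rewrite QE QE'; ring.
by rewrite sE subnKC.
Qed.

Lemma idim_prod (s : seq Branch) h : all (fun B => bhom B h != 0) s ->
  idim (\prod_(B <- s) bpoly B) h (\sum_(B <- s) ord (bhom B h))%N.
Proof.
elim: s => [|B s IH]; first by rewrite !big_nil => _; exact: idim1.
rewrite !big_cons /= => /andP[h0 hs].
apply: (idim_mul (bpoly_neq0 B) (bhomP B) h0 (bhom_idim h0)).
exact: IH.
Qed.

End Intersection.

(** * Models of the normalization *)

Section Model.
Variable K : closedFieldType.
Local Notation O := (fps K).
Local Notation A := (fps (fps K)).

(* a / b is integral over U exactly when a ^ n is of the form below. *)
Definition integrally_closed (U : comNzRingType) : Prop :=
  forall (a b : U) n (q : nat -> U), GRing.lreg b ->
  a ^+ n = \sum_(i < n) q i * a ^+ i * b ^+ (n - i) -> exists c, a = c * b.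

(* E : A -> U presents the normalization of A / (f), of which A / (f) is a
   subspace of codimension delta. *)
Definition model (X f : A) delta (U : comNzRingType) (E : {rmorphism A -> U}) : Prop :=
  [/\ forall h, E h = 0 <-> rdvd f h,
      adim (E \o @fps2C K) setT (range E) delta,
      integrally_closed U, forall u, integralOver E u & GRing.lreg (E X)].

Lemma fps_ord_dvd (a b : O) : b != 0 -> a != 0 -> (ord b <= ord a)%N ->
  exists c, a = c * b.
Proof.
move=> b0 a0 le; have [bo bl] := ordP b0; have [_ al] := ordP a0.
have [w wU bE] : exists2 w, w \is a GRing.unit & b = fpsX K ^+ ord b * w.
  exists (fps_drop (ord b) b); last exact: fps_drop0.
  by rewrite fps_unitE unitfE fps_dropE addn0.
move: le bE; set m := ord b => le ->.
exists (fpsX K ^+ (ord a - m) * fps_drop (ord a) a * w^-1).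
transitivity (fpsX K ^+ ord a * fps_drop (ord a) a); first exact: fps_drop0.
rewrite -{1}(subnK le) exprD.
transitivity (fpsX K ^+ (ord a - m) * fps_drop (ord a) a * (w^-1 * w) * fpsX K ^+ m).
  by rewrite mulVr // mulr1; ring.
by ring.
Qed.

(** If ord a < ord b, every term on the right has order larger than n ord a, which is the order of
    the left side. *)
Lemma fps_integrally_closed : integrally_closed O.
Proof.
move=> a b n q breg e.
have b0 : b != 0.
  apply: contraTneq (oner_neq0 O) => b0; rewrite negbK; apply/eqP.
  by apply: breg; rewrite b0 !mul0r.
case: (eqVneq a 0) => [->|a0]; first by exists 0; rewrite mul0r.
apply: fps_ord_dvd => //; rewrite leqNgt; apply/negP => lt.
have oX (f : O) k : f != 0 -> ord (f ^+ k) = (k * ord f)%N.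
  move=> f0; elim: k => [|k IH]; first by rewrite ord_fps1.
  by rewrite exprS ordM ?expf_neq0 // IH mulSn.
have fX (f : O) k : f != 0 -> xfil1 K (k * ord f)%N (f ^+ k).
  move=> f0; apply/xfil1P => i; rewrite -oX // => ilt.
  by have [_] := ordP (expf_neq0 k f0); apply.
have : xfil1 K (n * ord a).+1 (a ^+ n).
  rewrite e; apply: fil_bigsum => i _.
  apply: (@fil_le _ _ _ (i * ord a + (n - i) * ord b)%N).
    by have := ltn_ord i; nia.
  rewrite -mulrA mulrCA [q _ * _]mulrC mulrA; apply: filMr.
  by apply: filM; exact: fX.
move/xfil1P/(_ (n * ord a)%N (ltnSn _)); rewrite -oX // => /eqP.
by have [/negPf ->] := ordP (expf_neq0 n a0).
Qed.

Lemma branch_model d G e delta : branch d G e delta -> model (varx K) G delta e.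
Proof.
move=> hB; have [[d0 dK [eC ex ey]] Greg eker eR _] := hB; split=> //.
- apply: (@hasdim_transport K (algmod (@fpsC K)) (algmod (e \o @fps2C K)) id
    setT (range e)) eR => // [a u v|v' _|].
  + by rewrite -[RHS]/(e (fps2C a) * u + v) eC.
  + by exists v' => //; rewrite subrr; exists 0; rewrite ?rmorph0.
  split=> [|a _ _ [u _ <-] [v _ <-]]; first by exists 0; rewrite ?rmorph0.
  by exists (fps2C a * u + v); rewrite // rmorphD rmorphM.
- exact: fps_integrally_closed.
(* Every element of K[[t]] is a K[[x]]-combination of powers of t, and t is a root of T^d - x. *)
- move=> u; pose iota : {rmorphism O -> O} := e \o @fpsC O.
  have hi : power_subst d iota by [].
  have [w <-] := lvec_surj d0 hi u.
  rewrite /lvec; elim/big_rec: _ => [|k x _ IH]; first exact: integral0.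
  apply: integral_add => //; apply: integral_mul; first exact: (integral_id e (fpsC _)).
  have iX : integralOver e (fpsX K).
    exists ('X^d - (varx K)%:P); first exact: monicXnsubC.
    rewrite rmorphB /= map_polyXn map_polyC /= ex.
    by rewrite /root !hornerE subrr.
  by elim: (nat_of_ord k) => [|m IHm]; [exact: integral1|rewrite exprS; exact: integral_mul].
by apply: mulfI; rewrite ex expf_neq0 // fpsX_neq0.
Qed.

Section Product.
Variables (X f g : A) (m n k : nat) (U V : comNzRingType).
Variables (E : {rmorphism A -> U}) (F : {rmorphism A -> V}).
Hypothesis hE : model X f m E.
Hypothesis hF : model X g n F.
Hypothesis hfg : idim f g k.
Hypothesis coprime_fg : forall h, rdvd f h -> rdvd g h -> rdvd (f * g) h.

Definition pair_hom (h : A) : U * V := (E h, F h).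
Lemma pair_hom_is_zmod_morphism : zmod_morphism pair_hom.
Proof. by move=> a b; rewrite /pair_hom !rmorphB. Qed.
Lemma pair_hom_is_monoid_morphism : monoid_morphism pair_hom.
Proof. by split=> [|a b]; rewrite /pair_hom ?rmorph1 // !rmorphM. Qed.
HB.instance Definition _ := GRing.isZmodMorphism.Build A (U * V)%type pair_hom
  pair_hom_is_zmod_morphism.
HB.instance Definition _ := GRing.isMonoidMorphism.Build A (U * V)%type pair_hom
  pair_hom_is_monoid_morphism.

Local Notation UK := (algmod (E \o @fps2C K)).
Local Notation VK := (algmod (F \o @fps2C K)).
Local Notation PK := (algmod (pair_hom \o @fps2C K)).
Local Notation AK := (algmod (@fps2C K)).

Lemma pair_lreg (a : U * V) : GRing.lreg a -> GRing.lreg a.1 /\ GRing.lreg a.2.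
Proof.
move=> ha; split=> x y xy.
  have /ha [] : a * (x, 0) = a * (y, 0) by congr pair.
  by [].
have /ha [] : a * (0, x) = a * (0, y) by congr pair.
by [].
Qed.

Lemma integrally_closed_pair :
  integrally_closed U -> integrally_closed V -> integrally_closed (U * V)%type.
Proof.
move=> hU hV a b r q /pair_lreg [b1 b2] e.
have [c1 e1] : exists c, a.1 = c * b.1.
  apply: (hU _ _ r (fun i => (q i).1)) => //; rewrite -(rmorphXn fst) e.
  by rewrite rmorph_sum; apply: eq_bigr => i _; rewrite !rmorphM !rmorphXn.
have [c2 e2] : exists c, a.2 = c * b.2.
  apply: (hV _ _ r (fun i => (q i).2)) => //; rewrite -(rmorphXn snd) e.
  by rewrite rmorph_sum; apply: eq_bigr => i _; rewrite !rmorphM !rmorphXn.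
by exists (c1, c2); rewrite [a]surjective_pairing [b]surjective_pairing e1 e2.
Qed.

Lemma integral_pair (u : U * V) : integralOver E u.1 -> integralOver F u.2 ->
  integralOver pair_hom u.
Proof.
move=> [p pm pu] [q qm qv]; exists (p * q); first by rewrite monicMl.
have c1 : ((map_poly pair_hom (p * q)).[u]).1 = 0.
  transitivity (map_poly E (p * q)).[u.1]; last first.
    by rewrite rmorphM hornerM (rootP pu) mul0r.
  rewrite -[LHS](horner_map fst) -map_poly_comp.
  by congr (_.[_]); exact: eq_map_poly.
have c2 : ((map_poly pair_hom (p * q)).[u]).2 = 0.
  transitivity (map_poly F (p * q)).[u.2]; last first.
    by rewrite rmorphM hornerM (rootP qv) mulr0.
  rewrite -[LHS](horner_map snd) -map_poly_comp.
  by congr (_.[_]); exact: eq_map_poly.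
by apply/rootP; rewrite [LHS]surjective_pairing c1 c2.
Qed.

(** The chain U x V > U x F(A) > E(A) x F(A) > image of A has quotients V / F(A), U / E(A) and A /
    (f, g), the last one through v -> (E v, 0). *)
Lemma model_pair : model X (f * g) (m + n + k) pair_hom.
Proof.
case: hE hF => [kE dE cE iE lE] [kF dF cF iF lF]; split.
- move=> h; split=> [[/kE fh /kF gh]|[c ->]]; first exact: coprime_fg.
  congr pair; first by apply/kE; exists (c * g); ring.
  by apply/kF; exists (c * f); ring.
- pose W1 : set PK := [set x | range F x.2]%classic.
  pose W2 : set PK := [set x | range E x.1 /\ range F x.2]%classic.
  have s0 : submod (setT : set PK) by split.
  have rE (a : K) x y : range E x -> range E y -> range E (E (fps2C a) * x + y).
    by move=> [u _ <-] [v _ <-]; exists (fps2C a * u + v); rewrite // rmorphD rmorphM.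
  have rF (a : K) x y : range F x -> range F y -> range F (F (fps2C a) * x + y).
    by move=> [u _ <-] [v _ <-]; exists (fps2C a * u + v); rewrite // rmorphD rmorphM.
  have E0 : range E 0 by exists 0; rewrite ?rmorph0.
  have F0 : range F 0 by exists 0; rewrite ?rmorph0.
  have s1 : submod W1 by split=> [|a x y hx hy]; [|exact: rF].
  have s2 : submod W2.
    by split=> [|a x y [hx hx'] [hy hy']]; split=> //; [exact: rE|exact: rF].
  have s3 : submod (range pair_hom : set PK).
    split=> [|a _ _ [u _ <-] [v _ <-]]; first by exists 0; rewrite ?rmorph0.
    by exists (fps2C a * u + v); rewrite // rmorphD rmorphM.
  have d1 : hasdim (setT : set PK) W1 n.
    apply: (@hasdim_transport K VK PK (fun v => (0, v)) setT (range F)) dF => //.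
    + by move=> a x y; congr pair; rewrite /= mulr0 addr0.
    + move=> [a b] _; exists b => //; rewrite /W1 /=.
      by exists 0; rewrite // rmorph0 subrr.
  have d2 : hasdim W1 W2 m.
    apply: (@hasdim_transport K UK PK (fun u => (u, 0)) setT (range E)) dE => //.
    + by move=> a x y; congr pair; rewrite /= mulr0 addr0.
    + by move=> v _; split=> [h|[]].
    + move=> [a b] h; exists a => //; split; rewrite /= ?subrr //.
      by rewrite subr0.
  have d3 : hasdim W2 (range pair_hom) k.
    apply: (@hasdim_transport K AK PK (fun v => (E v, 0)) setT
      (ideal [set f; g]%classic)) hfg => //.
    + by move=> a x y; congr pair; rewrite /= ?mulr0 ?addr0 // rmorphD rmorphM.
    + move=> v _; split=> [/ideal2P[u [w ->]]|[a _ [ea fa]]].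
        exists (w * g) => //; congr pair.
          rewrite rmorphD; have -> : E (u * f) = 0 by apply/kE; exists u.
          by rewrite add0r.
        by apply/kF; exists w.
      have /kE [u hu] : E (v - a) = 0 by rewrite rmorphB ea subrr.
      have /kF [w hw] : F a = 0 by [].
      by apply/ideal2P; exists u, w; rewrite -hu -hw subrK.
    + move=> [_ _] [[a _ /= <-] [b _ /= <-]]; exists (a - b) => //.
      exists b => //; congr pair; first by rewrite /= rmorphB; ring.
      by rewrite /= subr0.
  rewrite -[(m + n)%N]addnC; apply: (@hasdim_chain K PK setT W2) d3 => //.
    by move=> _ [a _ <-]; split; exists a.
  apply: (@hasdim_chain K PK setT W1) d2 => //.
  by move=> x [].
- exact: integrally_closed_pair.
- by move=> u; exact: integral_pair.
by move=> x y e; rewrite [x]surjective_pairing [y]surjective_pairing;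
  congr pair; [apply: lE|apply: lF]; have := congr1 fst e; have := congr1 snd e.
Qed.

End Product.

Fixpoint coprime_branches (s : seq (Branch K)) : Prop :=
  if s is B :: s' then
    bhom B (\prod_(C <- s') bpoly C) <> 0 /\ coprime_branches s'
  else True.

Lemma deryM (f g : A) : dery (f * g) = dery f * g + f * dery g.
Proof. exact: fps_derivM. Qed.

(** The cross terms cancel: passing from Q to G Q adds 2 i(G, Q) both to 2 delta and to i(P, P_y),
    where it comes once from G and once from Q. *)
Lemma branches_model (B : Branch K) (s : seq (Branch K)) :
  coprime_branches (B :: s) ->
  let P := \prod_(C <- B :: s) bpoly C in
  exists delta k,
  [/\ exists (U : comNzRingType) (E : {rmorphism A -> U}), model (varx K) P delta E,
      idim P (dery P) k
    & (2 * delta + \sum_(C <- B :: s) bdeg C = k + (size s).+1)%N].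
Proof.
elim: s B => [|C s IH] B /= [BP cs].
  have hB := branchP B; have [[d0 _ _] _ _ _ [n0 ord_e]] := hB.
  rewrite !big_cons !big_nil !mulr1 addn0.
  exists (bdelta B), (ord (bhom B (dery (bpoly B)))); split.
  - by exists _, (bhom B); exact: (branch_model hB).
  - exact: bhom_idim.
  by rewrite ord_e; lia.
have [delta [k [[U [E hE]] hk hd]]] := IH C cs.
have hB := branchP B; have [[d0 _ _] _ _ _ [n0 ord_e]] := hB.
rewrite [\prod_(_ <- B :: _) _]big_cons [(\sum_(_ <- B :: _) _)%N]big_cons.
move: BP hE hk hd; set Q := \prod_(_ <- _) _ => /eqP BQ hE hk hd.
have eG : bhom B (bpoly B) = 0 by apply/bhomP; exists 1; rewrite mul1r.
have eD : bhom B (dery (bpoly B * Q)) = bhom B (dery (bpoly B)) * bhom B Q.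
  by rewrite deryM rmorphD !rmorphM eG mul0r addr0.
have eD0 : bhom B (dery (bpoly B * Q)) != 0 by rewrite eD mulf_neq0.
(* Modulo Q the derivative of G Q is G Q_y, so its intersection with Q splits into i(G, Q) and i(Q,
   Q_y). *)
have iQ : idim Q (dery (bpoly B * Q)) (ord (bhom B Q) + k).
  rewrite deryM addrC; apply: idim_modl; apply: idimC.
  apply: (idim_mul (bpoly_neq0 B) (bhomP B) BQ); first exact: bhom_idim.
  exact: idimC.
exists (bdelta B + delta + ord (bhom B Q))%N,
  (ord (bhom B (dery (bpoly B * Q)%R)) + (ord (bhom B Q) + k))%N; split.
- exists _, (pair_hom (bhom B) E); apply: model_pair (branch_model hB) hE _ _.
    exact: bhom_idim.
  move=> h [a ->] [b e].
  have /eqP : bhom B (b * Q) = 0 by rewrite -e rmorphM eG mulr0.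
  rewrite rmorphM mulf_eq0 (negPf BQ) orbF => /eqP/bhomP [c bE].
  by exists c; rewrite e bE; ring.
- exact: (idim_mul (bpoly_neq0 B) (bhomP B) eD0 (bhom_idim eD0) iQ).
rewrite eD ordM // ord_e; move: hd; rewrite /=; lia.
Qed.

End Model.

(** * Total fractions and delta *)

Section TotalFracTheory.
Variable R : comNzRingType.
Local Open Scope quotient_scope.
Local Notation tofrac := (@TotalFrac.tofrac R).

Lemma tofrac_inj : injective tofrac.
Proof.
move=> a b /eqP; rewrite !piE /TotalFrac.equiv /= !mulr1.
by move/eqP.
Qed.

Lemma total_frac_split (z : total_frac R) : exists a b,
  GRing.lreg b /\ z * tofrac b = tofrac a.
Proof.
elim/quotW: z => x; exists x.1, x.2; split.
  exact: (asboolW (TotalFrac.denP x)).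
rewrite -[_ * _]/(TotalFrac.mul _ _) !piE; apply/eqmodP/eqP => /=.
by ring.
Qed.

Lemma tofrac_unit b : GRing.lreg b -> exists i, i * tofrac b = 1.
Proof.
move=> hb; have hb' : TotalFrac.regular b by apply/asboolP.
exists (\pi_(TotalFrac.type R) (@TotalFrac.Ratio R (1, b) hb')).
rewrite -[RHS]/(tofrac 1) -[LHS]/(TotalFrac.mul _ _) !piE.
by apply/eqmodP/eqP => /=; ring.
Qed.

End TotalFracTheory.

Section DeltaModel.
Variable K : closedFieldType.
Local Notation O := (fps K).
Local Notation A := (fps (fps K)).
Variables (f : A) (fNU : f \isn't a GRing.unit).
Local Notation R := (principal_quot fNU).
Local Notation T := (total_frac R).
Local Notation q := (to_quot fNU).
Local Notation tofrac := (@TotalFrac.tofrac R).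

Lemma to_quot_eq0 a : q a = 0 <-> rdvd f a.
Proof.
have -> : (q a = 0) <-> (a - 0 \in principal fNU).
  by rewrite Quotient.idealrBE -[0 in X in X <-> _](rmorph0 q); split=> /eqP.
by rewrite subr0; split=> [/asboolP/ideal1P|h]; [|apply/asboolP/ideal1P].
Qed.
Lemma to_quot_surj x : exists a, x = q a.
Proof. by exists (repr x); rewrite /to_quot reprK. Qed.

Variables (X : A) (delta : nat) (U : comNzRingType) (E : {rmorphism A -> U}).
Hypothesis hm : model X f delta E.
Hypothesis X0 : X 0%N 0%N = 0.

Let tau a : T := tofrac (q a).
Let tauD a b : tau (a + b) = tau a + tau b. Proof. by rewrite /tau !rmorphD. Qed.
Let tauM a b : tau (a * b) = tau a * tau b. Proof. by rewrite /tau !rmorphM. Qed.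

Let tau_eq0 a : tau a = 0 <-> rdvd f a.
Proof.
rewrite -to_quot_eq0; split=> [h|h]; last by rewrite /tau h; exact: rmorph0.
by apply: tofrac_inj; rewrite -[RHS](rmorph0 tofrac).
Qed.
Let kE a : E a = 0 <-> rdvd f a. Proof. by case: hm. Qed.
Let tauE a : tau a = 0 <-> E a = 0. Proof. by rewrite kE. Qed.

Let lregE0 (V : comNzRingType) (b : V) : (forall x, b * x = 0 -> x = 0) -> GRing.lreg b.
Proof.
by move=> h x y e; apply/eqP; rewrite -subr_eq0; apply/eqP/h; rewrite mulrBr e subrr.
Qed.
Let lregE1 (V : comNzRingType) (b x : V) : GRing.lreg b -> b * x = 0 -> x = 0.
Proof. by move=> h e; apply: h; rewrite mulr0. Qed.

(* Some combination of u, X u, ..., X ^ delta u lies in E A, whose codimension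
   is delta; its coefficient is a power of X times a unit. *)
Let denominator u : exists a b, GRing.lreg (E b) /\ E b * u = E a.
Proof.
have [_ dE _ _ lX] := hm.
have sR : submod (range E : set (algmod (E \o @fps2C K))).
  split=> [|c _ _ [v _ <-] [w _ <-]]; first by exists 0; rewrite ?rmorph0.
  by exists (fps2C c * v + w); rewrite // rmorphD rmorphM.
have [c [[a _ ea] [i ci]]] : exists c : 'I_delta.+1 -> K,
    range E (\sum_i E (fps2C (c i)) * (E X ^+ i * u)) /\ exists i, c i != 0.
  apply: contrapT => h; suff : (delta.+1 <= delta)%N by rewrite ltnn.
  apply: (hasdim_ge (b' := fun i : 'I_delta.+1 =>
    E X ^+ i * u : algmod (E \o @fps2C K)) sR dE) => // c hc i.
  apply/eqP/negPn/negP => ci; apply: h; exists c; split; last by exists i.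
  exact: hc.
pose p := \poly_(j < delta.+1) c (inord j).
have pc (j : 'I_delta.+1) : p`_j = c j by rewrite coef_poly ltn_ord inord_val.
have p0 : poly_fps p != 0.
  apply: contraNneq ci => e; rewrite -pc -[p`_i]/(poly_fps p i) e.
  by rewrite fps0E.
exists a, (\sum_(j < delta.+1) fps2C (c j) * X ^+ j); split; last first.
  rewrite ea rmorph_sum mulr_suml; apply: eq_bigr => j _.
  by rewrite rmorphM rmorphXn mulrA.
have [po pl] := ordP p0; set m := ord (poly_fps p) in po pl.
have mlt : (m < delta.+1)%N.
  rewrite ltnNge; apply/negP => le; case/negP: po; apply/eqP.
  by rewrite -[poly_fps p m]/(p`_m) coef_poly ltnNge le.
pose w := \sum_(j < delta.+1 | (m <= j)%N) fps2C (c j) * X ^+ (j - m).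
have -> : \sum_(j < delta.+1) fps2C (c j) * X ^+ j = X ^+ m * w.
  rewrite (bigID (fun j : 'I_delta.+1 => (m <= j)%N)) /= [X in _ + X]big1 => [|j].
    rewrite addr0 mulr_sumr; apply: eq_bigr => j mj.
    by rewrite mulrCA -exprD subnKC.
  rewrite -ltnNge => /pl; rewrite -[poly_fps p j]/(p`_j) pc => ->.
  by rewrite rmorph0 mul0r.
have wU : w \is a GRing.unit.
  have -> : w = fps2C (c (Ordinal mlt)) + \sum_(j < delta.+1 |
      (m <= j)%N && (j != Ordinal mlt)) fps2C (c j) * X ^+ (j - m).
    by rewrite /w (bigD1 (Ordinal mlt)) //= subnn mulr1.
  rewrite unit2E fpsDE fps_sumE fps_sumE big1 ?addr0 => [|j /andP[mj jm]].
    rewrite -[fps2C _]/(fpsC (fpsC _)) !fpsCE !eqxx -pc.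
    exact: po.
  rewrite fpsM0 fpsM0; have -> : (X ^+ (j - m)) 0%N 0%N = 0.
    have : (0 < j - m)%N.
      by rewrite subn_gt0 ltn_neqAle mj andbT; move: jm; rewrite -val_eqE eq_sym.
    by case: (j - m)%N => // r _; rewrite exprS !fpsM0 X0 mul0r.
  by rewrite mulr0.
rewrite rmorphM rmorphXn; apply: lregM; first exact: lregX.
have /unitrPr [w' ww'] := wU.
apply: lregE0 => x h; rewrite -[x]mul1r -(rmorph1 E) -ww' rmorphM.
by rewrite mulrAC h mul0r.
Qed.

(** A relation b x = 0 in U is multiplied by a denominator of x, which brings it back to the image
    of A, that is to A / (f). *)
Let lreg_EP b : GRing.lreg (q b) <-> GRing.lreg (E b).
Proof.
split=> hb; apply: lregE0 => x hx.
  have [a [c [hc ca]]] := denominator x.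
  have /kE/to_quot_eq0 : E (b * a) = 0 by rewrite rmorphM -ca mulrCA hx mulr0.
  rewrite rmorphM => /(lregE1 hb)/to_quot_eq0/kE ea.
  by apply: (lregE1 hc); rewrite ca.
have [a xa] := to_quot_surj x; move: hx; rewrite xa -rmorphM.
move=> /to_quot_eq0/kE; rewrite rmorphM => /(lregE1 hb)/kE.
by move/to_quot_eq0.
Qed.

(** Graph of the isomorphism between the normalization and U: z and u are the same fraction a / b,
    read in the total fractions of A / (f) and in U. Independence of the chosen fraction is settled
    once, by [Rel0]. *)
Let Rel (z : T) (u : U) : Prop :=
  exists a b, [/\ GRing.lreg (E b), z * tau b = tau a & E b * u = E a].

Let Rel_tau a : Rel (tau a) (E a).
Proof.
exists a, 1; split; first by rewrite rmorph1; exact: GRing.lreg1.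
  by rewrite /tau !rmorph1 mulr1.
by rewrite rmorph1 mul1r.
Qed.
Let RelD z u z' u' : Rel z u -> Rel z' u' -> Rel (z + z') (u + u').
Proof.
move=> [a [b [hb za ua]]] [a' [b' [hb' za' ua']]].
exists (a * b' + a' * b), (b * b'); split.
- by rewrite rmorphM; exact: lregM.
- by rewrite tauD !tauM -za -za'; ring.
- by rewrite rmorphD !rmorphM -ua -ua'; ring.
Qed.
Let RelM z u z' u' : Rel z u -> Rel z' u' -> Rel (z * z') (u * u').
Proof.
move=> [a [b [hb za ua]]] [a' [b' [hb' za' ua']]].
exists (a * a'), (b * b'); split.
- by rewrite rmorphM; exact: lregM.
- by rewrite !tauM -za -za'; ring.
- by rewrite !rmorphM -ua -ua'; ring.
Qed.
Let Rel_unit b : GRing.lreg (E b) -> exists i, i * tau b = 1.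
Proof. by move=> /lreg_EP /tofrac_unit. Qed.
Let Rel0 z u : Rel z u -> (z = 0 <-> u = 0).
Proof.
move=> [a [b [hb za ua]]]; have [i ib] := Rel_unit hb; split=> e.
  apply: (lregE1 hb); rewrite ua; apply/tauE.
  by rewrite -za e mul0r.
have /tauE ta : E a = 0 by rewrite -ua e mulr0.
by rewrite -[z]mulr1 -ib mulrCA za ta mulr0.
Qed.
Let Rel_total u : exists z, Rel z u.
Proof.
have [a [b [hb ba]]] := denominator u; have [i ib] := Rel_unit hb.
exists (tau a * i), a, b; split=> //.
by rewrite -mulrA ib mulr1.
Qed.

Let Rel_horner (p : {poly A}) z u : Rel z u ->
  Rel (map_poly tau p).[z] (map_poly E p).[u].
Proof.
move=> h; rewrite /map_poly !horner_poly.
elim/big_rec2: _ => [|i y x _ IH].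
  rewrite -(rmorph0 E) -[0](_ : tau 0 = 0) ?Rel_tau //.
  by apply/tau_eq0; exists 0; rewrite mul0r.
apply: RelD => //; apply: RelM; first exact: Rel_tau.
elim: (nat_of_ord i) => [|n IHn]; last by rewrite !exprS; exact: RelM.
by rewrite !expr0 -(rmorph1 E) -[1](_ : tau 1 = 1) ?Rel_tau // /tau !rmorph1.
Qed.

Let Rel_normal z u : Rel z u -> @normalization K f fNU z.
Proof.
move=> h; have [_ _ _ iE _] := hm; have [p pm /rootP pu] := iE u.
exists (map_poly q p); first exact: monic_map.
rewrite /root -map_poly_comp; apply/eqP/(Rel0 (Rel_horner p h)).
by rewrite pu.
Qed.

Let normal_Rel z : @normalization K f fNU z -> exists u, Rel z u.
Proof.
move=> [p pm pz]; have [_ _ cE _ _] := hm.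
have [x [y [hy zy]]] := total_frac_split z.
have [a xa] := to_quot_surj x; have [b yb] := to_quot_surj y.
rewrite xa yb in hy zy.
have /choice [c hc] i : exists c, p`_i = q c by exact: to_quot_surj.
pose n := (size p).-1.
have sp : size p = n.+1 by rewrite prednK // size_poly_gt0 monic_neq0.
have pn : p`_n = 1 by exact/eqP.
have zy' : z * tau b = tau a := zy.
have tauX x' k : tau (x' ^+ k) = tau x' ^+ k by rewrite /tau !rmorphXn.
have tauS F : tau (\sum_(i < n) F i) = \sum_(i < n) tau (F i).
  by rewrite /tau !rmorph_sum.
(* The integral equation of z = a / b multiplied by b^n, the shape required by
   [integrally_closed]. *)
have e : tau (a ^+ n + \sum_(i < n) c i * a ^+ i * b ^+ (n - i)) = 0.
  have -> : tau (a ^+ n + \sum_(i < n) c i * a ^+ i * b ^+ (n - i)) =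
     (map_poly tofrac p).[z] * tau b ^+ n.
    rewrite /map_poly horner_poly sp big_ord_recr /= pn rmorph1 mul1r mulrDl.
    rewrite -exprMn zy' tauD [LHS]addrC tauX tauS; congr (_ + _).
    rewrite mulr_suml; apply: eq_bigr => i _.
    rewrite !tauM !tauX hc -zy' exprMn -[tofrac _]/(tau (c i)).
    have -> : tau b ^+ n = tau b ^+ i * tau b ^+ (n - i).
      by rewrite -exprD subnKC // ltnW.
    by rewrite !mulrA.
  by rewrite (rootP pz) mul0r.
have {}e : E a ^+ n = \sum_(i < n) - E (c i) * E a ^+ i * E b ^+ (n - i).
  have /tauE := e; rewrite rmorphD rmorphXn rmorph_sum => /eqP.
  rewrite addr_eq0 -sumrN => /eqP ->; apply: eq_bigr => i _.
  by rewrite (rmorphM E) (rmorphM E) !(rmorphXn E) !mulNr.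
have [u eu] := cE _ _ _ (fun i => - E (c i)) (proj1 (lreg_EP b) hy) e.
by exists u, a, b; split=> //; [exact/lreg_EP|rewrite mulrC].
Qed.

(** [F] is the linear bijection from U to the normalization with graph [Rel]; it carries the image
    of A to A / (f), so the codimension is that of the model. *)
Lemma delta_nonunit_model : delta_nonunit fNU = delta%:Z%:E.
Proof.
have [_ dE _ _ _] := hm.
have /choice [F hF] u : exists z, Rel z u by exact: Rel_total.
have RelN z u : Rel z u -> Rel (- z) (- u).
  move=> h; rewrite -mulN1r -[- u]mulN1r; apply: RelM => //.
  by rewrite -(rmorphN1 E) -[-1](_ : tau (-1) = -1) ?Rel_tau // /tau !rmorphN1.
have F_eq z u : Rel z u -> F u = z.
  move=> h; apply/eqP; rewrite -subr_eq0; apply/eqP.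
  by apply/(Rel0 (RelD (hF u) (RelN _ _ h))); rewrite subrr.
have Frange u : range E u <-> range tofrac (F u).
  split=> [[a _ <-]|[x _]]; first by rewrite (F_eq _ _ (Rel_tau a)); exists (q a).
  have [a ->] := to_quot_surj x => e; exists a => //.
  have h : Rel (tau a - F u) (E a - u) by apply: RelD => //; exact: RelN.
  have : E a - u = 0 by apply/(Rel0 h); rewrite /tau e subrr.
  by move/eqP; rewrite subr_eq0 => /eqP.
pose TK : lmodType K := algmod (scalars fNU).
have sW : submod (range tofrac : set TK).
  split=> [|c _ _ [u _ <-] [v _ <-]]; first by exists 0; rewrite ?rmorph0.
  by exists (q (fps2C c) * u + v); rewrite // rmorphD rmorphM.
rewrite /delta_nonunit; apply: (dim_mod_eq sW).
apply: (@hasdim_transport K (algmod (E \o @fps2C K)) TK F setT (range E)) dE => //.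
- move=> c u v; apply: F_eq; apply: RelD => //; apply: RelM => //.
  exact: Rel_tau.
- by move=> u _; exact: (Rel_normal (hF u)).
move=> z /normal_Rel [u hu]; exists u => //; rewrite (F_eq _ _ hu) subrr.
by exists 0; rewrite ?rmorph0.
Qed.

End DeltaModel.

(** * Multiplicity, branches and linear changes of coordinates *)

Section Coordinates.
Variable K : closedFieldType.
Local Notation O := (fps K).
Local Notation A := (fps (fps K)).
Implicit Types f g h : A.

Lemma fpsC2E (g : O) j i : (fpsC g : A) j i = g i *+ (j == 0%N).
Proof. by rewrite (fpsCE g j); case: j => [|j] //; exact: fps0E. Qed.

Lemma xyfil_split n f : xyfil K n.+1 f -> exists g h,
  [/\ xyfil K n g /\ xyfil K n h, f = varx K * g + vary K * h,
      forall j, g j.+1 = 0, forall i, g 0%N i = f 0%N i.+1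
    & forall j, h j = f j.+1].
Proof.
move=> /xyfilP hf; exists (fpsC (fps_drop 1 (f 0%N))), (fps_drop 1 f); split=> //; first split.
- apply/xyfilP => -[|j] i ji; last by rewrite fpsC2E mulr0n.
  by rewrite fpsC2E mulr1n fps_dropE; apply: hf; lia.
- by apply/xyfilP => j i ji; rewrite fps_dropE; apply: hf; lia.
- rewrite {1}(fps_split0 f) -rmorphM; congr (fpsC _ + _).
  by rewrite -[fpsX K]expr1; apply: fps_drop0 => -[|//] _; exact: hf.
Qed.

Lemma xyfil_const f : f = fps2C (f 0%N 0%N) + (f - fps2C (f 0%N 0%N)) /\
  xyfil K 1 (f - fps2C (f 0%N 0%N)).
Proof.
split; first by rewrite addrC subrK.
apply/xyfilP => -[|//] [|//] _; rewrite fpsBE.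
by rewrite -[fps2C _]/(fpsC (fpsC _)) fpsC2E fpsCE subrr.
Qed.

Lemma ideal_exp_xyfil n f : ideal_exp (@maxideal K) n f <-> xyfil K n f.
Proof.
elim: n f => [|n IH] f; first by split=> // _; exact: fil_full.
split=> [[k [c [s [hs ->]]]]|hf].
  apply: fil_bigsum => i _; apply: filMl.
  have [a [b [[l [c' [s' [hs' ->]]]] /IH hb ->]]] := hs i.
  rewrite -add1n; apply: filM => //; apply: fil_bigsum => j _; apply: filMl.
  by case: (hs' j) => ->; apply/xyfilP => -[|//] [].
have [g [h [[hg hh] -> _ _ _]]] := xyfil_split hf.
exists 2%N, (fun=> 1), (fun i => if i == ord0 then varx K * g else vary K * h).
split; last first.
  by rewrite big_ord_recl big_ord1 /= [1 * (varx K * g)]mul1r [1 * (vary K * h)]mul1r.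
have hX v : (v = varx K \/ v = vary K) -> @maxideal K v.
  move=> hv; exists 1%N, (fun=> 1), (fun=> v); split; last by rewrite big_ord1 mul1r.
  by move=> _; case: hv => ->; [left|right].
move=> i; case: eqP => _; [exists (varx K), g|exists (vary K), h]; split=> //.
- by apply: hX; left.
- exact/IH.
- by apply: hX; right.
exact/IH.
Qed.

Lemma maxideal_xyfil f : maxideal f -> xyfil K 1 f.
Proof.
move=> [k [c [s [hs ->]]]]; apply: fil_bigsum => i _; apply: filMl.
by case: (hs i) => ->; apply/xyfilP => -[|//] [].
Qed.

Lemma mult_exists f : f != 0 -> exists m,
  xyfil K m f /\ ~ xyfil K m.+1 f.
Proof.
move=> f0; pose Q m := `[< ~ xyfil K m.+1 f >].
have [m hm] : exists m, Q m.
  apply/not_existsP => h; case/eqP: f0; apply: (@fil_sep _ (xyfil K)) => -[|n].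
    exact: fil_full.
  by apply: contrapT => hn; apply: (h n); apply/asboolP.
case: (ex_minnP (ex_intro (fun k => Q k) m hm)) => k /asboolP hk kmin; exists k; split=> //.
case: k hk kmin => [|k] _ kmin; first exact: fil_full.
apply: contrapT => h; suff : (k.+1 <= k)%N by rewrite ltnn.
by apply: kmin; apply/asboolP.
Qed.

Lemma mult_eq f m : xyfil K m f -> ~ xyfil K m.+1 f -> mult f = m%:Z%:E.
Proof.
move=> hm hm1.
have le n : ideal_exp (@maxideal K) n f -> (n <= m)%N.
  move=> /ideal_exp_xyfil h; rewrite leqNgt; apply/negP => lt; apply: hm1.
  exact: fil_le h.
apply: enat_of_eq => [|k [/le km /(_ m)]]; first by split; [exact/ideal_exp_xyfil|].
move=> /(_ (proj2 (ideal_exp_xyfil m f) hm)) mk.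
by apply/eqP; rewrite eqn_leq km.
Qed.

(* The restriction to the line x = c s, y = s has leading form f_m(c, 1). *)
Lemma line_coef c (rho : {rmorphism A -> O}) m f :
  (forall a, rho (fps2C a) = fpsC a) -> rho (varx K) = fpsC c * fpsX K ->
  rho (vary K) = fpsX K -> xyfil K m f ->
  rho f m = \sum_(i < m.+1) f (m - i)%N i * c ^+ i /\
  forall j, (j < m)%N -> rho f j = 0.
Proof.
move=> rC rx ry; elim: m f => [|m IH] f hf.
  split=> //; rewrite big_ord1 expr0 mulr1 {1}(proj1 (xyfil_const f)).
  have [g [h [_ -> _ _ _]]] := xyfil_split (proj2 (xyfil_const f)).
  rewrite !rmorphD !rmorphM rC rx ry !fpsDE -mulrA fpsCM !fpsXM0 mulr0 !addr0.
  by rewrite fpsCE.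
have [g [h [[hg hh] -> gS g0 hS]]] := xyfil_split hf.
have [eg lg] := IH g hg; have [eh lh] := IH h hh.
have E j : rho (varx K * g + vary K * h) j.+1 = c * rho g j + rho h j.
  by rewrite rmorphD !rmorphM rx ry fpsDE -mulrA fpsCM !fpsXMS.
have E0 : rho (varx K * g + vary K * h) 0%N = 0.
  by rewrite rmorphD !rmorphM rx ry fpsDE -mulrA fpsCM !fpsXM0 mulr0 addr0.
split; last by case=> [|j] jm; [|rewrite E lg // lh // mulr0 addr0].
rewrite E eg eh.
have -> : \sum_(i < m.+1) g (m - i)%N i * c ^+ i = g 0%N m * c ^+ m.
  rewrite big_ord_recr /= subnn big1 ?add0r // => i _.
  have -> : (m - i = (m - i).-1.+1)%N by rewrite prednK ?subn_gt0.
  by rewrite gS fps0E mul0r.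
have xyE j i : (varx K * g + vary K * h) j i =
    g j i.-1 *+ (0 < i)%N + (if j is j'.+1 then h j' i else 0).
  rewrite fpsDE; congr (_ + _).
    rewrite fpsCM; case: i => [|i]; first by rewrite fpsXM0.
    by rewrite fpsXMS.
  by case: j => [|j]; rewrite ?fpsXM0 ?fps0E // fpsXMS.
have recr (F : nat -> K) : \sum_(i < m.+2) F i = \sum_(i < m.+1) F i + F m.+1.
  by rewrite big_ord_recr.
rewrite (recr (fun i => (varx K * g + vary K * h) (m.+1 - i)%N i * c ^+ i)).
rewrite xyE subnn addr0 mulr1n addrC; congr (_ + _); last first.
  by rewrite exprS mulrCA.
apply: eq_bigr => i _; rewrite xyE subSn -1?ltnS //=.
by rewrite gS fps0E mul0rn add0r.
Qed.

Section TwoVariableHoms.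
Variables (S : comNzRingType) (Phi : filtration S).

Lemma hom2_ext (e e' : {rmorphism A -> S}) :
  Phi 1%N (e (varx K)) -> Phi 1%N (e (vary K)) ->
  (forall c, e (fps2C c) = e' (fps2C c)) -> e (varx K) = e' (varx K) ->
  e (vary K) = e' (vary K) -> e =1 e'.
Proof.
move=> hx hy eC ex ey; apply: (@fps_hom_ext _ _ Phi) => //.
by apply: (@fps_hom_ext _ _ Phi (e \o @fpsC O) (e' \o @fpsC O)).
Qed.

Lemma derivation2_0 (e : {rmorphism A -> S}) (D : A -> S) :
  Phi 1%N (e (varx K)) -> Phi 1%N (e (vary K)) ->
  (forall f g, D (f + g) = D f + D g) ->
  (forall f g, D (f * g) = D f * e g + e f * D g) ->
  (forall c, D (fps2C c) = 0) -> D (varx K) = 0 -> D (vary K) = 0 ->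
  forall f, D f = 0.
Proof.
move=> hx hy DD DM DC Dx Dy; apply: (@fps_derivation0 _ _ Phi e) => //.
apply: (@fps_derivation0 _ _ Phi (e \o @fpsC O) (D \o @fpsC O)) => // f g.
  by rewrite /= rmorphD DD.
by rewrite /= rmorphM DM.
Qed.

Lemma hom2_exists (a b : S) (phi : {rmorphism K -> S}) :
  Phi 1%N a -> Phi 1%N b -> exists e : {rmorphism A -> S},
  [/\ forall c, e (fps2C c) = phi c, e (varx K) = a & e (vary K) = b].
Proof.
move=> ha hb; have [iota [iC iX _]] := fps_evalP phi ha.
have [E [EC EX _]] := fps_evalP iota hb.
exists E; split=> [c||]; last exact: EX.
  by rewrite -[fps2C c]/(fpsC (fpsC c)) EC iC.
by rewrite -[varx K]/(fpsC (fpsX K)) EC iX.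
Qed.

End TwoVariableHoms.

Lemma varx_fil1 : xyfil K 1 (varx K). Proof. by apply/xyfilP => -[|//] []. Qed.
Lemma vary_fil1 : xyfil K 1 (vary K). Proof. by apply/xyfilP => -[|//] []. Qed.

(** Chosen so that the y-derivative of s f is the image of c f_x + f_y, by [dery_shear]: the generic
    polar becomes a partial derivative. *)
Definition shear c (s : A -> A) : Prop :=
  [/\ forall a, s (fps2C a) = fps2C a, s (varx K) = varx K + fps2C c * vary K
    & s (vary K) = vary K].

Lemma shear_fil1 c (s : A -> A) : shear c s ->
  xyfil K 1 (s (varx K)) /\ xyfil K 1 (s (vary K)).
Proof.
move=> [_ -> ->]; split; last exact: vary_fil1.
by apply: filD; [exact: varx_fil1|apply: filMl; exact: vary_fil1].
Qed.

Lemma shear_exists c : exists s : {rmorphism A -> A}, shear c s.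
Proof.
have [|s hs] := @hom2_exists _ (xyfil K) (varx K + fps2C c * vary K) (vary K)
  (@fps2C K) _ vary_fil1; last by exists s.
by apply: filD; [exact: varx_fil1|apply: filMl; exact: vary_fil1].
Qed.

Lemma shearK c (s t : {rmorphism A -> A}) : shear c s -> shear (- c) t -> cancel s t.
Proof.
move=> [sC sx sy] [tC tx ty] f.
apply: (@hom2_ext _ (xyfil K) (t \o s : {rmorphism A -> A}) (idfun : {rmorphism A -> A})).
- rewrite /= sx rmorphD rmorphM tx ty tC rmorphN mulNr subrK; exact: varx_fil1.
- by rewrite /= sy ty; exact: vary_fil1.
- by move=> a; rewrite /= sC tC.
- by rewrite /= sx rmorphD rmorphM tx ty tC rmorphN mulNr subrK.
by rewrite /= sy ty.
Qed.

Lemma deryD f g : dery (f + g) = dery f + dery g.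
Proof. exact: fps_derivD. Qed.
Lemma dery_const (c : O) : dery (fpsC c) = 0 :> A.
Proof. exact: fps_derivC. Qed.
Lemma dery_y : dery (vary K) = 1. Proof. exact: fps_derivX. Qed.
Lemma derxE f j : derx f j = fps_deriv (f j). Proof. by []. Qed.
Lemma derxD f g : derx (f + g) = derx f + derx g.
Proof. by apply: fpsP => j; rewrite [RHS]fpsDE !derxE -fps_derivD. Qed.
Lemma derxM f g : derx (f * g) = derx f * g + f * derx g.
Proof.
apply: fpsP => j; rewrite fpsDE derxE (fpsME f g) (fpsME (derx f)) (fpsME f).
rewrite -big_split; elim/big_rec2: _ => [|i y x _ IH].
  by apply: fpsP => n; rewrite fpsE !fps0E mul0rn.
by rewrite fps_derivD IH fps_derivM.
Qed.
Lemma derx_const c : derx (fps2C c) = 0 :> A.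
Proof.
apply: fpsP => j; rewrite derxE -[fps2C c]/(fpsC (fpsC c)) fpsCE.
by case: j => [|j]; rewrite ?mulr1n ?mulr0n ?fps_derivC -?(rmorph0 (@fpsC K))
  ?fps_derivC ?fps0E ?rmorph0.
Qed.
Lemma derx_x : derx (varx K) = 1.
Proof.
apply: fpsP => j; rewrite derxE fps1E -[varx K]/(fpsC (fpsX K)) fpsCE.
by case: j => [|j]; rewrite ?mulr1n ?mulr0n ?fps_derivX // -(rmorph0 (@fpsC K))
  fps_derivC rmorph0.
Qed.
Lemma derx_y : derx (vary K) = 0.
Proof.
apply: fpsP => j; rewrite derxE fps0E -[vary K]/(fpsX O) fpsXE.
by case: eqP => _; rewrite -?(rmorph1 (@fpsC K)) -?(rmorph0 (@fpsC K)) fps_derivC ?rmorph0.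
Qed.

Lemma derx_shear c (s : {rmorphism A -> A}) f : shear c s -> derx (s f) = s (derx f).
Proof.
move=> hs; have [hx hy] := shear_fil1 hs; have [sC sx sy] := hs.
apply/eqP; rewrite -subr_eq0; apply/eqP.
apply: (@derivation2_0 _ (xyfil K) s (fun f => derx (s f) - s (derx f))) => //.
- by move=> g h; rewrite !(rmorphD, derxD) /=; ring.
- by move=> g h; rewrite !(derxM, rmorphD, rmorphM) /=; ring.
- by move=> a; rewrite sC derx_const rmorph0 subrr.
- rewrite sx derxD derxM derx_const derx_x derx_y rmorph1; ring.
by rewrite sy derx_y rmorph0 subrr.
Qed.

Lemma dery_shear c (s : {rmorphism A -> A}) f : shear c s ->
  dery (s f) = s (fps2C c * derx f + dery f).
Proof.
move=> hs; have [hx hy] := shear_fil1 hs; have [sC sx sy] := hs.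
apply/eqP; rewrite -subr_eq0; apply/eqP.
apply: (@derivation2_0 _ (xyfil K) s
  (fun f => dery (s f) - s (fps2C c * derx f + dery f))) => //.
- move=> g h; rewrite rmorphD deryD derxD deryD !rmorphD !rmorphM !rmorphD; ring.
- move=> g h; rewrite derxM deryM !rmorphM deryM !rmorphD !rmorphM !rmorphD !rmorphM; ring.
- by move=> a; rewrite sC dery_const derx_const mulr0 rmorphD !rmorph0 !addr0 subrr.
- rewrite sx deryD deryM [dery (varx K)]dery_const [dery (fps2C c)]dery_const.
  by rewrite dery_y derx_x mulr1 addr0 sC; ring.
by rewrite sy derx_y dery_y mulr0 add0r rmorph1 subrr.
Qed.

(** Both sides are derivations along e, so [derivation2_0] reduces the comparison to constants, x
    and y. *)
Lemma param_chain_rule d (e : {rmorphism A -> O}) f : (0 < d)%N -> param d e ->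
  fps_deriv (e f) = e (derx f) * (fpsX K ^+ d.-1 *+ d) +
                    e (dery f) * fps_deriv (e (vary K)).
Proof.
move=> d0 [eC ex ey].
have dX : fps_deriv (fpsX K ^+ d) = fpsX K ^+ d.-1 *+ d.
  elim: d d0 {ex} => // -[|d] IH _; first by rewrite fps_derivX.
  rewrite exprS fps_derivM fps_derivX IH //= mul1r mulrnAr -exprS.
  by rewrite [RHS]mulrS.
apply/eqP; rewrite -subr_eq0; apply/eqP.
apply: (@derivation2_0 _ (xfil1 K) e (fun f => fps_deriv (e f) -
  (e (derx f) * (fpsX K ^+ d.-1 *+ d) + e (dery f) * fps_deriv (e (vary K))))) => //.
- by apply: xfil1_1; rewrite ex -[_ ^+ _]mulr1 fpsX0.
- exact: xfil1_1.
- by move=> g h; rewrite derxD deryD !rmorphD fps_derivD; ring.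
- by move=> g h; rewrite derxM deryM !rmorphD !rmorphM fps_derivM; ring.
- by move=> a; rewrite eC fps_derivC derx_const dery_const !rmorph0; ring.
- by rewrite ex dX derx_x dery_const rmorph1 rmorph0; ring.
by rewrite derx_y dery_y rmorph0 rmorph1; ring.
Qed.

Lemma idim_iso (s t : {rmorphism A -> A}) f g n :
  (forall a, s (fps2C a) = fps2C a) -> cancel s t -> cancel t s ->
  idim f g n -> idim (s f) (s g) n.
Proof.
move=> sC st ts; apply: (@hasdim_transport K (algmod (@fps2C K))
  (algmod (@fps2C K)) s setT (ideal [set f; g]%classic)) => //.
- by move=> a u v; rewrite rmorphD -[a *: u]/(fps2C a * u) rmorphM sC.
- move=> v _; split=> /ideal2P[u [w e]]; apply/ideal2P.
    by exists (s u), (s w); rewrite e rmorphD !rmorphM.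
  exists (t u), (t w); rewrite -[v]st e rmorphD !rmorphM !st.
  by [].
- move=> v _; exists (t v) => //; rewrite ts subrr; apply/ideal2P.
  by exists 0, 0; rewrite !mul0r addr0.
exact: ideal2_submod.
Qed.

End Coordinates.

(** * Prime elements and the count of irreducible factors *)

Section Factorization.
Variable R : idomainType.
Implicit Types f g h : R.

Definition prime_elt g : Prop :=
  [/\ g != 0, g \isn't a GRing.unit
    & forall a b, rdvd g (a * b) -> rdvd g a \/ rdvd g b].

Lemma prime_irreducible g : prime_elt g -> irreducible g.
Proof.
move=> [g0 gU gp]; split=> // b c e.
have gg : rdvd g (b * c) by exists 1; rewrite mul1r e.
case: (gp _ _ gg) => -[a ha]; [right|left]; apply/unitrPr; exists a.
  by apply: (mulfI g0); rewrite mulr1 {2}e ha; ring.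
by apply: (mulfI g0); rewrite mulr1 {2}e ha; ring.
Qed.

Lemma associated_sym f g : associated f g -> associated g f.
Proof. by move=> [u uU ->]; exists u^-1; rewrite ?unitrV ?mulKr. Qed.
Lemma associated_trans f g h : associated f g -> associated g h -> associated f h.
Proof.
by move=> [u uU ->] [v vU ->]; exists (v * u); rewrite ?unitrM ?uU ?vU // mulrA.
Qed.

Lemma irreducible_dvd_prime g h : g \isn't a GRing.unit -> irreducible h ->
  rdvd g h -> associated g h.
Proof.
move=> gU [h0 hU hirr] [c e]; exists c => //.
by case: (hirr _ _ e) => // gU'; rewrite gU' in gU.
Qed.

(** A prime of the list either divides h, and is then associated to it, or divides the cofactor of h
    and can be cancelled. *)
Lemma irreducible_factor (s : seq R) u h : irreducible h -> u \is a GRing.unit ->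
  (forall i, (i < size s)%N -> prime_elt s`_i) ->
  rdvd h (u * \prod_(g <- s) g) ->
  exists2 i, (i < size s)%N & associated s`_i h.
Proof.
move=> hirr uU; have [h0 hU _] := hirr.
elim: s => [|g s IH] hs [c e].
  case/negP: hU; apply/unitrPr; rewrite big_nil mulr1 in e.
  by exists (c * u^-1); rewrite mulrCA mulrA -e divrr.
have [g0 gU gp] := hs 0%N isT; rewrite big_cons in e.
have gch : rdvd g (c * h) by exists (u * \prod_(j <- s) j); rewrite -e; ring.
case: (gp _ _ gch) => [[d dE]|gh]; last first.
  by exists 0%N => //; exact: irreducible_dvd_prime.
have [i hi hih] : exists2 i, (i < size s)%N & associated s`_i h.
  apply: IH => [i hi|]; first exact: (hs i.+1).
  by exists d; apply: (mulfI g0); rewrite mulrCA e dE; ring.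
by exists i.+1.
Qed.

End Factorization.

Section Branches.
Variable K : closedFieldType.
Local Notation A := (fps (fps K)).

Lemma branches_eq (s : seq A) u f : u \is a GRing.unit ->
  f = u * \prod_(g <- s) g -> (forall i, (i < size s)%N -> prime_elt s`_i) ->
  (forall i j, (i < j)%N -> (j < size s)%N -> ~ associated s`_i s`_j) ->
  branches f = (size s)%:Z%:E.
Proof.
move=> uU fE sp sa.
have le m n (g : 'I_m -> A) (g' : 'I_n -> A) :
    (forall i, irreducible (g i) /\ rdvd (g i) f) ->
    (forall i j, associated (g i) (g j) -> i = j) ->
    (forall h, irreducible h -> rdvd h f -> exists i, associated (g' i) h) ->
    (m <= n)%N.
  move=> gi ga g's.
  have /choice [phi hphi] i : exists j, associated (g' j) (g i).
    by apply: g's; case: (gi i).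
  rewrite -[m]card_ord -[n]card_ord; apply: (@leq_card _ _ phi) => i j e.
  by apply: ga; apply: associated_trans (associated_sym (hphi i)) _; rewrite e.
pose g (i : 'I_(size s)) := s`_i.
have gi i : irreducible (g i) /\ rdvd (g i) f.
  split; first exact/prime_irreducible/sp.
  exists (u * \prod_(j < size s | j != i) s`_j).
  rewrite fE (big_nth 0) big_mkord (bigD1 i) //=.
  by rewrite mulrA [RHS]mulrAC.
have ga i j : associated (g i) (g j) -> i = j.
  move=> h; apply/val_inj; case: (ltngtP i j) => // lt.
    by case: (sa _ _ lt (ltn_ord _)).
  by case: (sa _ _ lt (ltn_ord _)); exact: associated_sym.
have gs h : irreducible h -> rdvd h f -> exists i, associated (g i) h.
  move=> hi; rewrite fE => /(irreducible_factor hi uU sp) [i lt hih].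
  by exists (Ordinal lt).
apply: enat_of_eq => [|m [g' [g'i g'a g's]]]; first by exists g.
by apply/eqP; rewrite eqn_leq (le _ _ g' g) // (le _ _ g g').
Qed.

End Branches.

(** * The kappa invariant *)

Section Kappa.
Variable K : closedFieldType.
Local Notation O := (fps K).
Local Notation A := (fps (fps K)).
Implicit Types F G f g h : A.

Lemma at_x0_x : at_x0 (varx K) = 0.
Proof. by apply: fpsP => -[|j]; rewrite at_x0E [RHS]fps0E. Qed.
Lemma at_x0_y : at_x0 (vary K) = fpsX K.
Proof.
apply: fpsP => j; rewrite at_x0E [RHS]fpsXE -[vary K]/(fpsX O) (fpsXE O j).
by case: eqP => _ /=; rewrite ?fps1E ?fps0E.
Qed.
Lemma at_x0_const a : at_x0 (fps2C a) = fpsC a :> O.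
Proof.
apply: fpsP => j; rewrite at_x0E -[fps2C a]/(fpsC (fpsC a)) fpsC2E.
by rewrite (fpsCE a j) (fpsCE a 0) eqxx mulr1n.
Qed.

(** Restricted to x = 0 the whole ideal vanishes to order l, so 1, y, ..., y^(l-1) are independent
    modulo it. *)
Lemma idim_y_bound F G l n : idim F G n ->
  (forall j, (j < l)%N -> F j 0%N = 0) -> (forall j, (j < l)%N -> G j 0%N = 0) ->
  (l <= n)%N.
Proof.
move=> hd F0 G0.
apply: (hasdim_ge (b' := fun i : 'I_l => vary K ^+ i : algmod (@fps2C K))
  (ideal2_submod F G) hd) => //.
move=> c /ideal2P[u [v huv]] i.
have low h w j : (forall j, (j < l)%N -> h j 0%N = 0) -> (j < l)%N ->
    at_x0 (w * h) j = 0.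
  move=> h0 jl; rewrite rmorphM fpsME big1 // => k _.
  rewrite [at_x0 h _]at_x0E h0 ?mulr0 //.
  exact: leq_ltn_trans (leq_subr _ _) jl.
have e : at_x0 (\sum_(i < l) fps2C (c i) * vary K ^+ i) i = 0.
  by rewrite [X in at_x0 X]huv rmorphD fpsDE !low // addr0.
move: e; rewrite rmorph_sum fps_sumE.
under eq_bigr => j _ do rewrite rmorphM rmorphXn /= at_x0_y at_x0_const fpsCM fpsXnE.
rewrite (bigD1 i) //= eqxx mulr1 big1 ?addr0 // => j.
by rewrite -val_eqE /= eq_sym => /negPf ->; rewrite mulr0.
Qed.

Lemma squarefree_coprime (s : seq (Branch K)) :
  (forall B : Branch K, ~ rdvd (bpoly B ^+ 2) (\prod_(C <- s) bpoly C)) ->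
  coprime_branches s.
Proof.
elim: s => [//|B s IH] hs; split.
  move=> /bhomP [c e]; apply: (hs B); exists c; rewrite big_cons e; ring.
apply: IH => C [c e]; apply: (hs C); exists (bpoly B * c).
by rewrite big_cons e; ring.
Qed.

Lemma coprime_branches_distinct (s : seq (Branch K)) : coprime_branches s ->
  forall i j, (i < j)%N -> (j < size s)%N ->
  ~ associated (map (@bpoly K) s)`_i (map (@bpoly K) s)`_j.
Proof.
elim: s => [//|B s IH] [/= nz cs] [|i] [|j] //= ij js; last exact: IH.
move=> [u _ e]; apply: nz; apply/bhomP.
exists (u * \prod_(k < size s | k != Ordinal (js : (j < size s)%N)) (map (@bpoly K) s)`_k).
rewrite -(big_map (@bpoly K) xpredT id) (big_nth 0) big_mkord size_map.
rewrite (bigD1 (Ordinal (js : (j < size s)%N))) //= e.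
by rewrite mulrAC -!mulrA.
Qed.

(** It generates the kernel of a homomorphism to an integral domain. *)
Lemma branch_prime (B : Branch K) : prime_elt (bpoly B).
Proof.
have eB : bhom B (bpoly B) = 0 by apply/bhomP; exists 1; rewrite mul1r.
split; first exact: bpoly_neq0.
  apply/negP => /(rmorph_unit (bhom B)); rewrite eB unitr0.
  by [].
move=> a b /bhomP; rewrite rmorphM => /eqP; rewrite mulf_eq0.
by case/orP => /eqP/bhomP; [left|right].
Qed.

Lemma prime_iso (s t : {rmorphism A -> A}) g : cancel s t -> cancel t s ->
  prime_elt g -> prime_elt (t g).
Proof.
move=> st ts [g0 gU gp]; split.
- by apply: contraNneq g0 => h; rewrite -[g]ts h rmorph0.
- by apply: contra gU => /(rmorph_unit s); rewrite ts.
move=> a b [c e]; have [|[d dE]|[d dE]] := gp (s a) (s b).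
- by exists (s c); rewrite -rmorphM e rmorphM ts.
- by left; exists (t d); rewrite -rmorphM -dE st.
by right; exists (t d); rewrite -rmorphM -dE st.
Qed.

Lemma model_iso (s t : {rmorphism A -> A}) X f g delta (U : comNzRingType)
    (E : {rmorphism A -> U}) :
  (forall a, s (fps2C a) = fps2C a) -> cancel s t -> cancel t s ->
  (forall h, rdvd g (s h) <-> rdvd f h) -> model X g delta E ->
  model (t X) f delta (E \o s).
Proof.
move=> sC st ts gf [kE dE cE iE lE]; split.
- by move=> h; rewrite -gf; exact: kE.
- have sR : submod (range (E \o s) : set (algmod ((E \o s) \o @fps2C K))).
    split=> [|a _ _ [u _ <-] [v _ <-]]; first by exists 0; rewrite // rmorph0.
    exists (fps2C a * u + v); rewrite // -[RHS]/(E (s (fps2C a)) * E (s u) + E (s v)).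
    by rewrite -!rmorphM -!rmorphD.
  apply: (@hasdim_transport K (algmod (E \o @fps2C K)) (algmod ((E \o s) \o @fps2C K))
    id setT (range E)) dE.
  + by move=> a u v; rewrite -[RHS]/(E (s (fps2C a)) * u + v) sC.
  + by [].
  + move=> v _; split=> [[a _ <-]|[a _ <-]]; last by exists (s a).
    by exists (t a); rewrite // -[LHS]/(E (s (t a))) ts.
  + by move=> v _; exists v => //; rewrite subrr; case: sR.
  + by split.
  + exact: sR.
- exact: cE.
- move=> u; have [p pm pu] := iE u; exists (map_poly t p); first exact: monic_map.
  rewrite -map_poly_comp; suff -> : map_poly ((E \o s) \o t) p = map_poly E p by [].
  by apply: eq_map_poly => a; rewrite /= ts.
change (GRing.lreg (E (s (t X)))); by rewrite ts.
Qed.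

(* On a branch of the polar curve F_y = 0, differentiating F(x(t), y(t)) gives
   F_x x'(t). *)
Lemma polar_branch p F (B : Branch K) : p \in [pchar K] ->
  bhom B (dery F) = 0 -> bhom B F != 0 -> F 0%N 0%N = 0 ->
  (ord (bhom B F) < p)%N ->
  bhom B (derx F) != 0 /\ ord (bhom B F) = (ord (bhom B (derx F)) + bdeg B)%N.
Proof.
move=> cp eFy eF F0 ltp; have [[d0 dK he] _ _ _ _] := branchP B.
have := param_chain_rule F d0 he; rewrite eFy mul0r addr0 => cr.
set g := bhom B F in eF ltp cr *; have [go gl] := ordP eF.
have g0 : g 0%N = 0.
  have hF : xyfil K 1 F by apply/xyfilP => -[|//] [].
  have /xfil1P : xfil1 K 1 g; last exact.
  apply: (fil_hom (Psi := xfil1 K)) hF; first by apply: xfil1_1; case: he.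
  apply: (@fil_hom _ _ (xfil1 K) (trivial_filtration K) (bhom B \o @fpsC O)).
    case: he => _ ex _; rewrite -[X in fil _ _ X]/(bhom B (varx K)) ex.
    by apply: xfil1_1; rewrite -[_ ^+ _]mulr1 fpsX0.
  move=> k c [->|->]; first exact: fil_full.
  by rewrite rmorph0; exact: fil_zero.
have o0 : (0 < ord g)%N.
  by rewrite lt0n; apply: contraNneq go => ->; rewrite g0.
have oK : (ord g)%:R != 0 :> K.
  rewrite -(dvdn_pcharf cp) gtnNdvd //.
have g' : fps_deriv g (ord g).-1 != 0.
  by rewrite fpsE prednK // -mulr_natr mulf_neq0.
have og' : ord (fps_deriv g) = (ord g).-1.
  apply: ord_eq => // i ilt; rewrite fpsE gl ?mul0rn //; lia.
have g'0 : fps_deriv g != 0 by apply: contraNneq g' => ->; rewrite fps0E.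
have ne : bhom B (derx F) != 0.
  by apply: contraNneq g'0 => h; rewrite cr h mul0r.
have Xn : fpsX K ^+ (bdeg B).-1 *+ bdeg B = fpsC (bdeg B)%:R * fpsX K ^+ (bdeg B).-1.
  by rewrite rmorph_nat mulr_natl.
have C0 : fpsC (bdeg B)%:R != 0 :> O by rewrite fmorph_eq0.
have X0 : fpsX K ^+ (bdeg B).-1 != 0 by rewrite expf_neq0 // fpsX_neq0.
have := congr1 (@ord K) cr; rewrite og' Xn ordM ?mulf_neq0 // ordM //.
rewrite ord_fpsC ordXn add0n => og; rewrite -(prednK o0) og.
by rewrite -[in RHS](prednK d0) addnS.
Qed.

(** Orders are nonnegative, so the bound on their sum bounds each of them by p, as [polar_branch]
    requires. *)
Lemma polar_sum p F (s : seq (Branch K)) : p \in [pchar K] -> F 0%N 0%N = 0 ->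
  rdvd (\prod_(B <- s) bpoly B) (dery F) ->
  (forall B : Branch K, rdvd (bpoly B) (dery F) -> bhom B F != 0) ->
  (\sum_(B <- s) ord (bhom B F) < p)%N ->
  [/\ all (fun B => bhom B F != 0) s, all (fun B => bhom B (derx F) != 0) s
    & (\sum_(B <- s) ord (bhom B F) =
       \sum_(B <- s) ord (bhom B (derx F)) + \sum_(B <- s) bdeg B)%N].
Proof.
move=> cp F0; elim: s => [|B s IH]; first by rewrite !big_nil.
rewrite !big_cons => -[c e] hB lt.
have Bd : rdvd (bpoly B) (dery F) by exists (c * \prod_(C <- s) bpoly C); rewrite e; ring.
have [||a1 a2 sE] := IH _ hB.
- by exists (c * bpoly B); rewrite e; ring.
- lia.
have eFy : bhom B (dery F) = 0 by apply/bhomP.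
have [|ne ->] := polar_branch cp eFy (hB B Bd) F0; first by lia.
by rewrite /= (hB B Bd) ne a1 a2 sE; split=> //; ring.
Qed.

Section GoodCoordinates.
Variables (p : nat) (F : A) (m k : nat).
Hypothesis cp : p \in [pchar K].
Hypothesis Freg : yreg m F.
Hypothesis m0 : (0 < m)%N.
Hypothesis hk : idim F (dery F) k.
Hypothesis kp : (k < p)%N.
Hypothesis Fsqf : forall B : Branch K, ~ rdvd (bpoly B ^+ 2) F.

Let Fy0 j : dery F j 0%N = F j.+1 0%N *+ j.+1.
Proof.
by rewrite fpsE -mulr_natr -[RHS]mulr_natr -(rmorph_nat (@fpsC K)) mulrC fpsCM mulrC.
Qed.

Let mK : m%:R != 0 :> K.
Proof.
have /yregP[_ Fl] := Freg.
apply/negP; rewrite -(dvdn_pcharf cp) => pm.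
suff : (m <= k)%N by move=> mk; have := dvdn_leq m0 pm; lia.
apply: (idim_y_bound hk Fl) => j jm; rewrite Fy0.
case: (ltngtP j.+1 m) => [/Fl ->|//|e]; first by rewrite mul0rn.
  by rewrite ltnNge jm.
by rewrite e -mulr_natr; move: pm; rewrite (dvdn_pcharf cp) => /eqP ->; rewrite mulr0.
Qed.

Let mp : (m < p)%N.
Proof.
have /yregP[_ Fl] := Freg.
have mk : (m.-1 <= k)%N.
  apply: (idim_y_bound hk) => j jm; first by apply: Fl; lia.
  by rewrite Fy0 Fl ?mul0rn //; lia.
have pm : m != p.
  by apply: contraNneq mK => ->; rewrite -(dvdn_pcharf cp) dvdnn.
by move: pm; rewrite neq_ltn => /orP[//|]; lia.
Qed.

Let tame_lt n : (n < p)%N -> tame K n.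
Proof. by move=> np i /andP[i0 ip]; rewrite -(dvdn_pcharf cp) gtnNdvd //; lia. Qed.

Let Fyreg : yreg m.-1 (dery F).
Proof.
have /yregP[Fm Fl] := Freg; apply/yregP; split=> [|j jm]; rewrite Fy0.
  by rewrite prednK // -mulr_natr mulf_neq0.
by rewrite Fl ?mul0rn //; lia.
Qed.

Lemma good_coordinates : exists (s : seq (Branch K)) u delta mu,
  [/\ [/\ u \is a GRing.unit, F = u * \prod_(B <- s) bpoly B & coprime_branches s],
      exists (U : comNzRingType) (E : {rmorphism A -> U}),
        model (varx K) (\prod_(B <- s) bpoly B) delta E,
      idim (dery F) (derx F) mu,
      (2 * delta + m = k + size s)%N & (k = mu + m.-1)%N].
Proof.
have [s [u [uU FE sm]]] := branch_factorization (tame_lt mp) Freg.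
have cs : coprime_branches s.
  apply: squarefree_coprime => B [c e]; apply: (Fsqf (B := B)).
  by exists (u * c); rewrite FE e mulrA.
have [s' [u' [u'U FyE s'm]]] : exists (s : seq (Branch K)) u, [/\ u \is a GRing.unit,
    dery F = u * \prod_(B <- s) bpoly B & (\sum_(B <- s) bdeg B)%N = m.-1].
  by apply: branch_factorization Fyreg; apply: tame_lt; lia.
have [delta [k' [hm hk' hd]]] : exists delta k',
   [/\ exists (U : comNzRingType) (E : {rmorphism A -> U}),
        model (varx K) (\prod_(B <- s) bpoly B) delta E,
      idim (\prod_(B <- s) bpoly B) (dery (\prod_(B <- s) bpoly B)) k'
    & (2 * delta + \sum_(C <- s) bdeg C = k' + size s)%N].
  case: s sm cs {FE} => [|B s] sm cs; last exact: branches_model.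
  by move: m0; rewrite -sm big_nil.
(* With P the product of the branches, F = u P and F_y = u_y P + u P_y, so (F, F_y) and (P, P_y) are
   the same ideal. *)
have kk' : k = k'.
  apply: (idim_uniq hk); apply: idim_ideal hk' => a.
  rewrite FE deryM; set P := \prod_(B <- s) bpoly B.
  split; apply: ideal2_sub.
  - by exists u^-1, 0; rewrite mulKr // mul0r addr0.
  - exists (- u^-1 * dery u * u^-1), u^-1.
    rewrite mulrDr [u^-1 * (u * _)]mulKr //.
    have -> : - u^-1 * dery u * u^-1 * (u * P) = - u^-1 * dery u * (u^-1 * u) * P by ring.
    by rewrite mulVr //; ring.
  - by exists u, 0; ring.
  by exists (dery u), u; ring.
(* A branch common to F and F_y would make i(F, F_y) infinite. *)
have hB (B : Branch K) : rdvd (bpoly B) (dery F) -> bhom B F != 0.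
  move=> Bd; apply/eqP => h0; have hb := branchP B.
  exact: (idim_no_common_branch hb Bd h0 (idimC hk)).
have F00 : F 0%N 0%N = 0 by have /yregP[_] := Freg; apply.
have dF : rdvd (\prod_(B <- s') bpoly B) (dery F) by exists u'; rewrite FyE.
have a1 : all (fun B => bhom B F != 0) s'.
  move: dF hB; clear; elim: s' => [//|B s IH] [c]; rewrite big_cons => e hB /=.
  rewrite hB; last by exists (c * \prod_(C <- s) bpoly C); rewrite e; ring.
  by apply: IH => //; exists (c * bpoly B); rewrite e; ring.
(* The same k is now computed along the branches of F_y instead of those of F, to be compared with
   i(F_y, F_x). *)
have kE : k = (\sum_(B <- s') ord (bhom B F))%N.
  apply: (idim_uniq (idimC hk)); rewrite FyE; apply: idim_unit => //.
  exact: idim_prod.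
have [|_ a2 sE] := polar_sum cp F00 dF hB; first by rewrite -kE.
exists s, u, delta, (\sum_(B <- s') ord (bhom B (derx F)))%N; split=> //.
- by rewrite {1}FyE; apply: idim_unit => //; exact: idim_prod.
- by rewrite kk' -hd sm.
by rewrite kE sE s'm.
Qed.

End GoodCoordinates.

(** Each excluded point (a : b) contributes the factor b X - a, nonzero because (a, b) is; a nonroot
    of the product of all of these with L exists over an algebraically closed field. *)
Lemma generic_direction (s : seq (K * K)) (L : {poly K}) : (0, 0) \notin s -> L != 0 ->
  exists c, L.[c] != 0 /\ forall q, q \in s -> c * q.2 != 1 * q.1.
Proof.
move=> s0 L0.
pose N := L * \prod_(q <- s) (q.2 *: 'X - q.1%:P).
have N0 : N != 0.
  rewrite mulf_neq0 // prodf_seq_neq0; apply/allP => -[a b] ab /=.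
  apply: contraNneq s0 => e.
  have e1 := congr1 (fun P : {poly K} => P`_1) e.
  have e0 := congr1 (fun P : {poly K} => P`_0) e.
  move: e1 e0; rewrite /= !coefB !coefZ !coefX !coefC /= mulr1 mulr0 subr0 sub0r.
  by move=> b0 /eqP; rewrite oppr_eq0 => /eqP a0; rewrite b0 a0 in ab.
have [c] := closed_nonrootP N N0; rewrite /root hornerM horner_prod mulf_eq0 negb_or.
rewrite prodf_seq_neq0 => /andP[Lc /allP hq]; exists c; split=> // q qs.
by have := hq q qs; rewrite /= !hornerE subr_eq0 mulrC.
Qed.

End Kappa.

(** * The invariants of f through generic coordinates *)

Section Main.
Variables (K : closedFieldType) (p : nat).
Local Notation O := (fps K).
Local Notation A := (fps (fps K)).

Lemma kappa_polar (f : A) : (kappa f < (p%:Z)%:E)%E -> exists (s : seq (K * K)) k,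
  [/\ (0, 0) \notin s, kappa f = k%:Z%:E, (k < p)%N
    & forall c, (forall q, q \in s -> c * q.2 != 1 * q.1) ->
      idim f (fps2C c * derx f + dery f) k].
Proof.
(* The default value +oo of [kappa] is excluded by the bound, so a generic value v exists. Only
   directions (c : 1) are used; their polar is c f_x + f_y. *)
rewrite /kappa; case: xgetP => [v _ [s [s0 hs]] vp|]; last by rewrite ltNge leey.
have ok c : (forall q, q \in s -> c * q.2 != 1 * q.1) ->
    inter f (fps2C c * derx f + dery f) = v.
  move=> hc; rewrite -(hs c 1 _ hc).
    by congr (inter f (_ + _)); rewrite rmorph1 mul1r.
  by apply/eqP => -[_ /eqP]; rewrite oner_eq0.
have [c0 [_ hc0]] := generic_direction s0 (oner_neq0 {poly K}).
have vfin : v != +oo%E by apply: contraTneq vp => ->; rewrite ltNge leey.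
have [k hk] : exists k, idim f (fps2C c0 * derx f + dery f) k.
  by apply: idim_inter; rewrite ok.
have vE : v = k%:Z%:E by rewrite -(ok c0 hc0); exact: inter_idim.
have kp : (k < p)%N by move: vp; rewrite vE lte_fin ltz_nat.
have idimk c : (forall q, q \in s -> c * q.2 != 1 * q.1) ->
    idim f (fps2C c * derx f + dery f) k.
  move=> hc; have [n hn] : exists n, idim f (fps2C c * derx f + dery f) n.
    by apply: idim_inter; rewrite ok.
  suff -> : k = n by exact: hn.
  have : k%:Z%:E = n%:Z%:E by rewrite -vE -(ok c hc); exact: inter_idim.
  by case.
by exists s, k; split; [exact: s0|exact: vE|exact: kp|exact: idimk].
Qed.

(** All values are exhibited as natural numbers, which turns the identities between extended
    integers into linear arithmetic. *)
Lemma invariants (f : A) : p \in [pchar K] -> maxideal f -> reduced f ->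
  (kappa f < (p%:Z)%:E)%E -> exists kap del mu m r,
  [/\ [/\ kappa f = kap%:Z%:E, delta f = del%:Z%:E & milnor f = mu%:Z%:E],
      mult f = m%:Z%:E /\ branches f = r%:Z%:E, (0 < m)%N,
      (2 * del + m = kap + r)%N & (kap = mu + m.-1)%N].
Proof.
move=> cp f_max [f0 f_sqf] kapp.
have [s [k [s0 kE kp hk]]] := kappa_polar kapp.
have [m [fm fm1]] := mult_exists f0.
have m0 : (0 < m)%N.
  by case: m fm fm1 => // _ []; exact: maxideal_xyfil.
(* L(c) = f_m(c, 1) for the leading form f_m of f. A nonroot c gives f(c y, y) order exactly m, so
   the sheared series is regular of order m in y. *)
pose L := \poly_(i < m.+1) f (m - i)%N i.
have L0 : L != 0.
  apply/eqP => L0; apply: fm1; apply/xyfilP => j i ji.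
  case: (ltngtP (j + i)%N m) => jim; [|lia|].
    by have /xyfilP := fm; apply.
  have := congr1 (fun P : {poly K} => P`_i) L0.
  by rewrite /= coef_poly coef0 ifT; [rewrite -jim addnK|lia].
have [c [Lc hc]] := generic_direction s0 L0.
have [sg hs] := shear_exists c; have [tg ht] := shear_exists (- c).
have st : cancel sg tg := shearK hs ht.
have ts : cancel tg sg by apply: shearK ht _; rewrite opprK.
have [sC sx sy] := hs; have [tC _ _] := ht.
pose F := sg f.
have Freg : yreg m F.
  have [|||ec el] := @line_coef K c (@at_x0 K \o sg) m f _ _ _ fm.
  - by move=> a; rewrite -[LHS]/(at_x0 (sg (fps2C a))) sC at_x0_const.
  - rewrite -[LHS]/(at_x0 (sg (varx K))) sx rmorphD rmorphM /=.
    by rewrite at_x0_x at_x0_y at_x0_const add0r.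
  - by rewrite -[LHS]/(at_x0 (sg (vary K))) sy at_x0_y.
  apply/yregP; split=> [|j jm]; last exact: el.
  move: ec; rewrite -[LHS]/(F m 0%N) => ->; move: Lc.
  by rewrite /L horner_poly.
have hF : idim F (dery F) k.
  by rewrite (dery_shear f hs); apply: (idim_iso sC st ts); apply: hk => q /hc.
have Fsqf (B : Branch K) : ~ rdvd (bpoly B ^+ 2) F.
  move=> [h e]; apply: (f_sqf (tg (bpoly B))).
    exact/prime_irreducible/(prime_iso st ts)/branch_prime.
  by exists (tg h); rewrite -[f]st -rmorphXn -rmorphM -e.
have [S [u [del [mu [[uU FE cS] [U [E hE]] hmu hdel hkap]]]]] :=
  good_coordinates cp Freg m0 hF kp Fsqf.
exists k, del, mu, m, (size S); split=> //.
- split=> //.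
  + have f00 : f 0%N 0%N = 0 by have /xyfilP := maxideal_xyfil f_max; apply.
    rewrite /delta; case: pselect => [h|[]]; last by rewrite unit2E f00 eqxx.
    (* The model of the branch product of F, composed with the shear, is a model of f. Its regular
       element becomes the image of x under the inverse shear, which still has no constant term. *)
    apply: (@delta_nonunit_model K f h (tg (varx K)) del U (E \o sg)).
      apply: (model_iso sC st ts) hE => g; split=> -[a e].
        exists (tg (a * u^-1)); rewrite -[g]st e; set P := \prod_(B <- S) bpoly B.
        have -> : a * P = a * u^-1 * F by rewrite FE -mulrA mulKr.
        by rewrite rmorphM st.
      exists (sg a * u); rewrite e rmorphM -[sg f]/F FE; ring.
    by have /xyfilP := (shear_fil1 ht).1; apply.
  + apply: inter_idim; have := idimC hmu.
    (* Undoing the shear turns (F_x, F_y) into (f_x, c f_x + f_y), the same ideal as (f_x, f_y). *)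
    rewrite (derx_shear f hs) (dery_shear f hs) => /(idim_iso tC ts st).
    rewrite !st => /(@idim_modl _ _ _ (- fps2C c)).
    by congr (idim _ _ _); ring.
- split; first exact: mult_eq.
  rewrite -(size_map (tg \o @bpoly K) S); apply: (branches_eq (u := tg u)).
  - exact: rmorph_unit.
  - by rewrite -[f]st -/F FE rmorphM rmorph_prod big_map.
  - move=> i; rewrite size_map => iS; rewrite map_comp (nth_map 0) ?size_map //.
    apply: (prime_iso st ts); case: S iS {FE cS hE hdel} => [//|B S'] iS.
    by rewrite (nth_map B) //; exact: branch_prime.
  move=> i j ij; rewrite size_map => jS; have iS := ltn_trans ij jS.
  rewrite map_comp !(nth_map 0) ?size_map // => -[v vU e].
  apply: (coprime_branches_distinct cS ij jS); exists (sg v).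
    exact: rmorph_unit.
  by rewrite -[LHS]ts e rmorphM ts.
Qed.
End Main.

Theorem corollary3p2 (K : closedFieldType) (p : nat) (charK : p \in [pchar K]%R)
    (f : fps (fps K)) (f_max : maxideal f) (f_red : reduced f)
    (kappa_lt_p : (kappa f < (p%:Z)%:E)%E) :
  (swan f = 0 /\
   kappa f = 2%:E * delta f + mult f - branches f /\
   2%:E * delta f + mult f - branches f = milnor f + mult f - 1)%E.
Proof.
have [k [d [mu [m [r [[kE dE muE] [mE rE] m0 e1 e2]]]]]] :=
  invariants charK f_max f_red kappa_lt_p.
(* As m is positive, the predecessor becomes a true difference before passing to integers. *)
have e3 : (k = mu + m - 1)%N by lia.
rewrite /swan kE dE muE mE rE.
by split; last split; congr EFin => /=; lia.
Qed.
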